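(* Let $1<p<\infty$, let $\Omega$ be a domain in $\mathbb{R}^n$ or in a noncompact Riemannian manifold of dimension $n$, $n\ge2$, and let $V_0,V_1\in L^\infty_{\mathrm{loc}}(\Omega)$ be real valued. Let $v_j$, $j=0,1$, be two positive, linearly independent, $C^2$ solutions (resp. supersolutions) of the equation $Q_{V_j}(u)=0$ in $\Omega$. Assume that $\nabla v_0$ does not vanish in $\Omega$, and that $v_1=\varphi_1(v_0)$ for some $C^2$ function $\varphi_1$ such that $\varphi_1'(u)\neq0$. For $0\le\alpha\le1$ define the function $$v_\alpha:=v_1^{\alpha}v_0^{1-\alpha},$$ and let $$V_\alpha:=\Big((1-\alpha)V_0|\nabla\log v_0|^{2-p}+\alpha V_1|\nabla\log v_1|^{2-p}\Big)|\nabla\log v_\alpha|^{p-2},$$ $$W_\alpha:=\alpha(1-\alpha)(p-1)\left|\nabla\log\left(\frac{v_0}{v_1}\right)\right|^2|\nabla\log v_\alpha|^{p-2}.$$ (On the right-hand sides $V_0,V_1$ and $v_0,v_1$ are the given potentials and functions.) Then $v_\alpha$ is a positive solution (resp. supersolution) of the equation $$Q_{V_\alpha-W_\alpha}(u)=0\qquad\text{in }\Omega,$$ and the following improved inequality holds: $$\int_\Omega\big(|\nabla\varphi|^p+V_\alpha|\varphi|^p\big)\,d\nu\ \ge\ \int_\Omega W_\alpha|\varphi|^p\,d\nu\qquad\forall\varphi\in C_0^\infty(\Omega).$$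
   Context: $\Omega$ is equipped with a measure $\nu$, absolutely continuous with respect to Lebesgue (resp. Riemannian) measure, with positive smooth density. $\Delta_p(u):=\mathrm{div}(|\nabla u|^{p-2}\nabla u)$, where $\mathrm{div}$ is the divergence with respect to $\nu$, i.e. $-\int \mathrm{div}(X)\varphi\,d\nu=\int X\cdot\nabla\varphi\,d\nu$ for smooth compactly supported $X,\varphi$. For a potential $V$, $Q_V(u):=-\Delta_p(u)+V|u|^{p-2}u$. A function $u\in W^{1,p}_{\mathrm{loc}}(\Omega)$ is a solution (resp. supersolution) of $Q_V(u)=0$ in $\Omega$ if $\int_\Omega(|\nabla u|^{p-2}\nabla u\cdot\nabla\varphi+V|u|^{p-2}u\varphi)\,d\nu$ is $=0$ for all $\varphi\in C_0^\infty(\Omega)$ (resp. $\ge0$ for all nonnegative $\varphi\in C_0^\infty(\Omega)$).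
   Formalization: For p<2 the formal theorem also assumes that W_α is locally integrable in Ω (and reads |∇log v_α|^{p-2} as 0 where ∇v_α=0): there this factor is undefined, and V_α−W_α may fail to be locally integrable, so that the equation and the integrals lose their meaning. *)

(* Defs.v *)
From HB Require Import structures.
From mathcomp Require Import all_boot all_order all_algebra.
From mathcomp Require Import all_classical all_reals all_analysis.

Set Implicit Arguments.
Unset Strict Implicit.
Unset Printing Implicit Defensive.

Import Order.TTheory GRing.Theory Num.Theory.
Import numFieldNormedType.Exports.

Local Open Scope classical_set_scope.
Local Open Scope ring_scope.

Notation borel T := (g_sigma_algebraType (@open T)).

Section euclidean_calculus.
Context {R : realType} {n : nat}.

Definition partial (a : 'I_n) (f : 'rV[R]_n -> R) : 'rV[R]_n -> R :=
  fun y => 'D_(delta_mx 0 a) f y.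

(* f is of class C^k on U; meant for open U, where the germs of f at the points
   of U are those of its restriction to U. *)
Fixpoint Ck (k : nat) (U : set 'rV[R]_n) (f : 'rV[R]_n -> R) : Prop :=
  match k with
  | 0 => forall y, U y -> {for y, continuous f}
  | k'.+1 => (forall y, U y -> differentiable f y) /\
             (forall a, Ck k' U (partial a f))
  end.

Definition smooth (U : set 'rV[R]_n) (f : 'rV[R]_n -> R) : Prop :=
  forall k, Ck k U f.

(* Test functions C_0^\infty(U). *)
Definition rV_test (U : set 'rV[R]_n) (psi : 'rV[R]_n -> R) : Prop :=
  smooth U psi /\
  exists K, [/\ compact K, K `<=` U & forall y, ~ K y -> psi y = 0].

(* These values determine the Borel measure lam. *)
Definition is_lebesgue (lam : {measure set (borel 'rV[R]_n) -> \bar R}) : Prop :=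
  forall a b : 'rV[R]_n, (forall i, a 0 i <= b 0 i) ->
    lam [set y : 'rV[R]_n | forall i, a 0 i < y 0 i <= b 0 i] =
    (\prod_i (b 0 i - a 0 i))%:E.

End euclidean_calculus.

(* A smooth atlas on a Hausdorff second countable space. [param i] is the
   inverse of the chart [coord i : dom i -> R^n], extended arbitrarily outside
   the image; [chart_at x] is some chart around x. *)
Record smooth_manifold (R : realType) (n : nat) (M : ptopologicalType) := {
  idx : Type ;
  dom : idx -> set M ;
  coord : idx -> M -> 'rV[R]_n ;
  param : idx -> 'rV[R]_n -> M ;
  chart_at : M -> idx ;
  manifold_hausdorff : hausdorff_space M ;
  manifold_second_countable : @second_countable M ;
  dom_chart_at : forall x, dom (chart_at x) x ;
  open_dom : forall i, open (dom i) ;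
  open_coord_dom : forall i, open (coord i @` dom i) ;
  coordK : forall i x, dom i x -> param i (coord i x) = x ;
  coord_continuous : forall i x, dom i x -> {for x, continuous (coord i)} ;
  param_continuous : forall i y, (coord i @` dom i) y ->
    {for y, continuous (param i)} ;
  transition_smooth : forall i j a,
    smooth (coord i @` (dom i `&` dom j)) (fun y => coord j (param i y) 0 a)
}.

Section manifold_calculus.
Context {R : realType} {n : nat} {M : ptopologicalType}.
Variable X : smooth_manifold R n M.

(* Row a, column b: derivative of the b-th coordinate of chart j in the a-th
   coordinate direction of chart i, at x. *)
Definition transition_jacobian (i j : idx X) (x : M) : 'M[R]_n :=
  jacobian (fun y => coord j (param i y)) (coord i x).

Definition Ck_on (k : nat) (O : set M) (f : M -> R) : Prop :=
  forall i : idx X, Ck k (coord i @` (dom i `&` O)) (fun y => f (param i y)).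

Definition smooth_on (O : set M) (f : M -> R) : Prop := forall k, Ck_on k O f.

Definition test_function (O : set M) (phi : M -> R) : Prop :=
  smooth_on O phi /\
  exists K, [/\ compact K, K `<=` O & forall x, ~ K x -> phi x = 0].

(* The coordinates of df at x in chart i. *)
Definition differential (f : M -> R) (i : idx X) (x : M) : 'rV[R]_n :=
  \row_a partial a (fun y => f (param i y)) (coord i x).

(* A vector field is given by its components in every chart (those of chart i
   being relevant on [dom i]), subject to the usual change of coordinates. *)
Definition vector_field := idx X -> M -> 'rV[R]_n.

Definition vector_field_on (O : set M) (Y : vector_field) : Prop :=
  forall i j x, O x -> dom i x -> dom j x ->
    Y j x = Y i x *m transition_jacobian i j x.

Definition measurable_vector_field (O : set M) (Y : vector_field) : Prop :=
  forall (i : idx X) a, measurable_fun ((O `&` dom i) : set (borel M))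
    (fun x : borel M => Y i x 0 a).

End manifold_calculus.

Record riemannian_metric (R : realType) (n : nat) (M : ptopologicalType)
    (X : smooth_manifold R n M) := {
  gram : idx X -> M -> 'M[R]_n ;
  gram_smooth : forall i a b,
    smooth (coord i @` dom i) (fun y => gram i (param i y) a b) ;
  gram_sym : forall i x, dom i x -> (gram i x)^T = gram i x ;
  gram_posdef : forall i x (w : 'rV[R]_n), dom i x -> w != 0 ->
    0 < (w *m gram i x *m w^T) 0 0 ;
  gram_transition : forall i j x, dom i x -> dom j x ->
    gram i x =
    transition_jacobian i j x *m gram j x *m (transition_jacobian i j x)^T
}.

Section riemannian.
Context {R : realType} {n : nat} {M : ptopologicalType}.
Context {X : smooth_manifold R n M}.
Variable g : riemannian_metric X.

(* The pairing does not depend on the chart used for its evaluation. *)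
Definition inner (Y Z : vector_field X) (x : M) : R :=
  let i := chart_at X x in (Y i x *m gram g i x *m (Z i x)^T) 0 0.

Definition vnorm (Y : vector_field X) (x : M) : R := Num.sqrt (inner Y Y x).

Definition grad (f : M -> R) : vector_field X :=
  fun i x => differential f i x *m invmx (gram g i x).

Variable lam : {measure set (borel 'rV[R]_n) -> \bar R}.

Definition is_riemannian_volume (vol : {measure set (borel M) -> \bar R}) : Prop :=
  forall (i : idx X) (A : set (borel M)), measurable A -> A `<=` dom i ->
    vol A = (\int[lam]_(y in (coord i @` A : set (borel 'rV[R]_n)))
               (Num.sqrt (\det (gram g i (param i y))))%:E)%E.

Definition smooth_positive_density (vol nu : {measure set (borel M) -> \bar R})
    (O : set M) : Prop :=
  exists rho : M -> R,
    [/\ smooth_on X O rho, (forall x, O x -> 0 < rho x) &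
        forall A : set (borel M), measurable A -> A `<=` O ->
          nu A = (\int[vol]_(x in A) (rho x)%:E)%E].

Variable nu : {measure set (borel M) -> \bar R}.

Definition locally_integrable_on (O : set M) (f : M -> R) : Prop :=
  forall K, compact K -> K `<=` O ->
    nu.-integrable (K : set (borel M)) (fun x : borel M => (f x)%:E).

Definition Linfty_loc (O : set M) (V : M -> R) : Prop :=
  measurable_fun (O : set (borel M)) (V : borel M -> R) /\
  forall K, compact K -> K `<=` O ->
    exists C : R, {ae nu, forall x : borel M, K x -> `|V x| <= C}.

(* u is in W^{1,p}_loc(O) with weak gradient Y: in every chart i, the functions
   (Y_i *m gram_i)_a, i.e. the components of the covector field dual to Y, are
   the weak partial derivatives of u with respect to Lebesgue measure. *)
Definition W1p_loc (p : R) (O : set M) (u : M -> R) (Y : vector_field X) : Prop :=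
  [/\ measurable_fun (O : set (borel M)) (u : borel M -> R) /\
      locally_integrable_on O (fun x => `|u x| `^ p),
      vector_field_on O Y /\ measurable_vector_field O Y,
      locally_integrable_on O (fun x => vnorm Y x `^ p) &
      forall (i : idx X) (a : 'I_n) (psi : 'rV[R]_n -> R),
        let U := coord i @` (dom i `&` O) in
        rV_test U psi ->
        (\int[lam]_(y in (U : set (borel 'rV[R]_n)))
            (u (param i y) * partial a psi y)%:E =
         - \int[lam]_(y in (U : set (borel 'rV[R]_n)))
            ((Y i (param i y) *m gram g i (param i y)) 0 a * psi y)%:E)%E].

(* The integrand of the weak form of Q_V(u) = 0, where Y is the weak gradient
   of u and phi the test function. *)
Definition weak_integrand (p : R) (V u : M -> R) (Y : vector_field X)
    (phi : M -> R) (x : M) : R :=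
  vnorm Y x `^ (p - 2) * inner Y (grad phi) x
  + V x * `|u x| `^ (p - 2) * u x * phi x.

Definition solution (p : R) (O : set M) (V u : M -> R) : Prop :=
  exists Y : vector_field X, W1p_loc p O u Y /\
    forall phi, test_function X O phi ->
      nu.-integrable (O : set (borel M))
        (fun x : borel M => (weak_integrand p V u Y phi x)%:E) /\
      (\int[nu]_(x in (O : set (borel M))) (weak_integrand p V u Y phi x)%:E = 0)%E.

Definition supersolution (p : R) (O : set M) (V u : M -> R) : Prop :=
  exists Y : vector_field X, W1p_loc p O u Y /\
    forall phi, test_function X O phi -> (forall x, 0 <= phi x) ->
      nu.-integrable (O : set (borel M))
        (fun x : borel M => (weak_integrand p V u Y phi x)%:E) /\
      (0 <= \int[nu]_(x in (O : set (borel M))) (weak_integrand p V u Y phi x)%:E)%E.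

Definition grad_log_norm (v : M -> R) : M -> R :=
  vnorm (grad (fun x => ln (v x))).

Definition v_interp (alpha : R) (v0 v1 : M -> R) : M -> R :=
  fun x => v1 x `^ alpha * v0 x `^ (1 - alpha).

(* Where the gradient of v_alpha vanishes, the last factor [0 `^ (p - 2)] of
   V_interp and W_interp evaluates to 0 when p != 2, and to 1 when p = 2; for
   p < 2 the mathematical expression is not defined there. *)
Definition V_interp (p alpha : R) (V0 V1 v0 v1 : M -> R) : M -> R := fun x =>
  ((1 - alpha) * V0 x * grad_log_norm v0 x `^ (2 - p)
   + alpha * V1 x * grad_log_norm v1 x `^ (2 - p))
  * grad_log_norm (v_interp alpha v0 v1) x `^ (p - 2).

Definition W_interp (p alpha : R) (v0 v1 : M -> R) : M -> R := fun x =>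
  alpha * (1 - alpha) * (p - 1)
  * grad_log_norm (fun z => v0 z / v1 z) x ^+ 2
  * grad_log_norm (v_interp alpha v0 v1) x `^ (p - 2).

End riemannian.

Arguments smooth_positive_density {R n M} X vol nu O.

Definition domain (M : topologicalType) (O : set M) : Prop :=
  [/\ open O, connected O & O !=set0].

Definition positive_on (T : Type) (R : realType) (O : set T) (f : T -> R) : Prop :=
  forall x, O x -> 0 < f x.

Definition linearly_independent_on (T : Type) (R : realType) (O : set T)
    (f h : T -> R) : Prop :=
  forall a b : R, (forall x, O x -> a * f x + b * h x = 0) -> a = 0 /\ b = 0.

(* For an open set J. *)
Definition C2_real (R : realType) (J : set R) (f : R -> R) : Prop :=
  forall t, J t ->
    [/\ derivable f t 1, derivable (derive1 f) t 1 &
        {for t, continuous (derive1 (derive1 f))}].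

(* R^n with its Euclidean metric is an instance, with Lebesgue measure as
   Riemannian volume. *)
Section euclidean_space.
Variables (R : realType) (n : nat).
Local Notation E := 'rV[R]_n.

Lemma rV_hausdorff : hausdorff_space E.
Proof. exact: norm_hausdorff. Qed.

Lemma rV_second_countable : @second_countable E.
Proof.
pose f (qk : 'rV[rat]_n * nat) : set E :=
  ball (map_mx ratr qk.1 : E) (qk.2.+1%:R^-1).
exists (range f); first by apply: sub_countable (card_image_le _ _) _; exact: countableP.
split=> [_ [qk _ <-]|x A /nbhs_ballP[_/posnumP[e] eA]].
  exact: ball_open.
pose k := Num.truncn (2 / e%:num).
have ke : k.+1%:R^-1 <= e%:num / 2.
  rewrite -[leRHS]invf_div lef_pV2 ?posrE //.
  by apply: ltW; rewrite truncnS_gt.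
have h i : {q : rat | ratr q \in `](x 0 i - k.+1%:R^-1), (x 0 i + k.+1%:R^-1)[}.
  apply/cid/rat_in_itvoo.
  by rewrite ltrD2l gtrN.
exists (f (\row_i sval (h i), k)).
  split; first by exists (\row_i sval (h i), k).
  split=> [|i j]; first by rewrite invr_gt0.
  rewrite !mxE (ord1 i) /= -ball_normE /=.
  case: (h j) => q /=; rewrite in_itv /= => /andP[q1 q2].
  by rewrite ltr_distl q1 q2.
move=> y [_ xy]; apply: eA; split=> // i j.
have := xy i j; rewrite !mxE (ord1 i) /= -!ball_normE /=.
case: (h j) => q /=; rewrite in_itv /= => /andP[q1 q2] qy.
rewrite (le_lt_trans (ler_distD (ratr q) _ _))// (splitr e%:num) ltrD//.
  by rewrite (lt_le_trans _ ke)// distrC ltr_distl q1.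
exact: lt_le_trans ke.
Qed.

Lemma Ck_cst k (U : set E) (c : R) : Ck k U (cst c).
Proof.
elim: k c => [|k IH] c /=; first by move=> y _; exact: cst_continuous.
split=> [y _|a]; first exact: differentiable_cst.
rewrite (_ : partial a _ = cst 0); first exact: IH.
by apply/funext => y; rewrite /partial derive_cst.
Qed.

Lemma derivative_coord (a b : 'I_n) (y : E) :
  partial a (fun z : E => z 0 b) y = (a == b)%:R.
Proof.
have /(congr1 (fun w : E => w 0 b)) := derive_id y (delta_mx 0 a : E).
rewrite (_ : id = (fun z : E => z)) // derive_mx; last exact: derivable_id.
by rewrite !mxE eqxx eq_sym => <-.
Qed.

Lemma smooth_coord (U : set E) a : smooth U (fun y : E => y 0 a).
Proof.
case=> [|k] /=; first by move=> y _; exact/differentiable_continuous/differentiable_coord.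
split=> [y _|b]; first exact: differentiable_coord.
rewrite (_ : partial b _ = cst (b == a)%:R); first exact: Ck_cst.
by apply/funext => y; rewrite derivative_coord.
Qed.

Definition euclidean_space : smooth_manifold R n E.
Proof.
refine (@Build_smooth_manifold R n E unit (fun _ => setT) (fun _ => id)
  (fun _ => id) (fun _ => tt) rV_hausdorff rV_second_countable _ _ _ _ _ _ _).
- by [].
- by move=> _; exact: openT.
- by move=> _; rewrite image_id; exact: openT.
- by [].
- by move=> _ x _; exact: id.
- by move=> _ x _; exact: id.
- by move=> _ _ a; exact: smooth_coord.
Defined.

Definition euclidean_metric : riemannian_metric euclidean_space.
Proof.
refine (@Build_riemannian_metric R n E euclidean_space (fun _ _ => 1%:M) _ _ _ _).
- by move=> i a b k; exact: Ck_cst.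
- by move=> i x _; rewrite trmx1.
- move=> i x w _ w0; rewrite mulmx1 mxE.
  have [j wj] : exists j, w 0 j != 0.
    apply/existsP; apply: contra_neqT w0 => /existsPn wj.
    by apply/rowP => j; have := wj j; rewrite negbK mxE => /eqP.
  rewrite (bigD1 j)//= mxE ltr_wpDr ?sumr_ge0//.
    by move=> k _; rewrite mxE -expr2 sqr_ge0.
  by rewrite -expr2 exprn_even_gt0.
- move=> i j x _ _.
  suff -> : transition_jacobian i j x = 1%:M by rewrite !mul1mx trmx1.
  rewrite /transition_jacobian /jacobian /=.
  apply/matrixP => a b; rewrite mxE.
  by rewrite diff_val !mxE eqxx eq_sym.
Defined.

Lemma euclidean_volume (lam : {measure set (borel E) -> \bar R}) :
  is_riemannian_volume euclidean_metric lam lam.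
Proof.
move=> i A mA _ /=; rewrite image_id det1 sqrtr1.
by rewrite integral_cst// mul1e.
Qed.

End euclidean_space.

(* Main.v *)
(* Write v_j = F_j(v0), let q_j = F_j'/F_j be the logarithmic derivative of F_j,
   and let D be the divergence of |grad v0|^(p-2) grad v0.  For u = F(v0) with
   q = F'/F the flux |grad u|^(p-2) grad u is F^(p-1) q|q|^(p-2) times that
   field, hence
     Q_V(u) / (F^(p-1) |q|^(p-2))
       = - (q D + (p-1) (q^2 + q') |grad v0|^p) + V |q|^(2-p).
   The profile of v_alpha has q = alpha q_1 + (1-alpha) q_0, and
     alpha q_1^2 + (1-alpha) q_0^2 = q^2 + alpha (1-alpha) (q_1 - q_0)^2,
   so the convex combination of the expressions for v_0 and v_1 is the one for
   v_alpha, the defect in the square being W_alpha.  Where q vanishes the power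
   q|q|^(p-2) need not be C^1; it is approximated by C^1 functions vanishing
   near 0, and dominated convergence applies because |q|^(p-2) is locally
   integrable as soon as W_alpha is.  The integral inequality is Picone's: test
   the equation for v_alpha with |phi|^p v_alpha^(1-p). *)
From mathcomp Require Import all_boot all_order all_algebra.
From mathcomp Require Import all_classical all_reals all_analysis.
From mathcomp Require Import perm measurable_realfun ring lra.
Require Import Defs.

Set Implicit Arguments.
Unset Strict Implicit.
Unset Printing Implicit Defensive.

Import Order.TTheory GRing.Theory Num.Theory.
Import numFieldNormedType.Exports.

Local Open Scope classical_set_scope.
Local Open Scope ring_scope.

(** * Calculus in coordinates *)

(** The potentials are only locally bounded, so the equations have no pointwise meaning. The
    comparison therefore takes place between densities in a chart ([residual]): weak inequalities
    for v_0 and v_1 become almost everywhere signs of these densities, and a partition of unity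
    brings the sign obtained for v_alpha back to an integral over the domain. The definition of a
    (super)solution leaves the weak gradient unspecified, so it has to be identified almost
    everywhere with the classical one before densities can be read off. Dividing by F_j^(p-1)
    |q_j|^(p-2) is legitimate because q_0 = 1/s and q_1 = phi1'/phi1 have no zeros on the values of
    v_0, whereas the combination q may vanish; the identity for v_alpha is multiplied, never
    divided, by |q|^(p-2). Since v_0 is C^2 with nonvanishing gradient, the field |grad v_0|^(p-2)
    grad v_0 is C^1 and its divergence is a continuous function. Picone's test function is C^1 but
    not smooth, which is why the weak form for v_alpha is established for C^1 test functions. *)

Section calculus.
Context {R : realType} {n : nat}.
Local Notation E := 'rV[R]_n.
Implicit Types (f h : E -> R) (U V : set E) (y z : E) (a b : 'I_n).

(** A locally equal function has the same first-order expansion. Functions here are total but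
    meaningful only on open sets, so this replacement occurs constantly. *)
Lemma near_eq_differentiable (V W : normedModType R) (f h : V -> W) (y : V) :
  (\forall z \near y, f z = h z) -> differentiable f y -> differentiable h y.
Proof.
move=> fh df.
have hy : f y = h y by exact: nbhs_singleton fh.
suff H : h \o shift y = cst (h y) + 'd f y +o_ 0 id.
  apply/diff_locallyP; rewrite (diff_unique (diff_continuous df) H); split => //.
  exact: (diff_continuous df).
apply/eqaddoP => e e0.
have /eqaddoP/(_ _ e0) := diff_locally df.
have fh0 : \forall z \near (0 : V), f (z + y) = h (z + y).
  by move/nbhs0P : fh; apply: filterS => z; rewrite addrC.
apply: filterS2 fh0 => z fhz.
by rewrite !fctE /= fhz -hy.
Qed.

(** [Ck] speaks only of germs, so it can be checked one point at a time. Together with [Ck_near]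
    this reduces gluing and extension by zero to exhibiting, near each point, a locally equal
    function of class C^k. *)
Lemma CkP k U f : Ck k U f <-> forall y, U y -> Ck k [set y] f.
Proof.
elim: k f => [|k IH] f /=.
  by split=> H y Uy; [move=> _ ->; exact: H|exact: (H y Uy y)].
split=> [[H1 H2] y Uy|H].
  by split=> [_ ->|a]; [exact: H1 | move/IH: (H2 a); exact].
split=> [y Uy|a]; first by have [+ _] := H _ Uy; apply.
by apply/IH => y Uy; have [_ +] := H _ Uy; apply.
Qed.

Lemma Ck_sub k U V f : U `<=` V -> Ck k V f -> Ck k U f.
Proof. by move=> UV /CkP H; apply/CkP => y /UV; exact: H. Qed.

Lemma CkW k U f : Ck k.+1 U f -> Ck k U f.
Proof.
elim: k f => [|k IH] f /= [H1 H2].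
  by move=> y Uy; apply/differentiable_continuous/H1.
by split=> // a; apply: IH.
Qed.

Lemma Ck_diff k U f y : Ck k.+1 U f -> U y -> differentiable f y.
Proof. by case=> + _; apply. Qed.

Lemma Ck0 k U f y : Ck k U f -> U y -> {for y, continuous f}.
Proof. by elim: k f => [|k IH] f /= => [|/CkW/IH]; exact. Qed.

Lemma near_eq_partial a f h y : (\forall z \near y, f z = h z) ->
  \forall z \near y, partial a f z = partial a h z.
Proof.
by move=> /nbhs_interior; apply: filterS => z; exact: near_eq_derive.
Qed.

Lemma Ck_near k f h y : (\forall z \near y, f z = h z) ->
  Ck k [set y] f -> Ck k [set y] h.
Proof.
elim: k f h => [|k IH] f h fh /=.
  move=> H _ ->; have := H y erefl.
  rewrite /prop_for /continuous_at -(nbhs_singleton fh).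
  move=> cf; apply: cvg_trans cf.
  by apply: (@near_eq_cvg _ _ (nbhs y)); exact: fh.
move=> [H1 H2]; split=> [_ ->|a].
  exact: near_eq_differentiable fh (H1 _ _).
exact: IH (near_eq_partial a fh) (H2 a).
Qed.

Lemma open_near U f h y : open U -> (forall z, U z -> f z = h z) -> U y ->
  \forall z \near y, f z = h z.
Proof. by move=> oU fh Uy; apply: filterS (open_nbhs_nbhs (conj oU Uy)). Qed.

Lemma Ck_eq k U f h : open U -> (forall z, U z -> f z = h z) ->
  Ck k U f -> Ck k U h.
Proof.
move=> oU fh /CkP H; apply/CkP => y Uy.
exact: Ck_near (open_near oU fh Uy) (H y Uy).
Qed.

Lemma eq_partial U f h a y : open U -> (forall z, U z -> f z = h z) -> U y ->
  partial a f y = partial a h y.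
Proof. by move=> oU fh /(open_near oU fh); exact: near_eq_derive. Qed.

Lemma partialD f h a y : differentiable f y -> differentiable h y ->
  partial a (fun z => f z + h z) y = partial a f y + partial a h y.
Proof. by move=> df dh; apply: deriveD; exact: diff_derivable. Qed.

Lemma partialM f h a y : differentiable f y -> differentiable h y ->
  partial a (fun z => f z * h z) y = f y * partial a h y + h y * partial a f y.
Proof. by move=> df dh; apply: deriveM; exact: diff_derivable. Qed.

Lemma partial_cst (c : R) a y : partial a (fun=> c) y = 0.
Proof. exact: derive_cst. Qed.

Lemma CkD k U f h : open U -> Ck k U f -> Ck k U h ->
  Ck k U (fun z => f z + h z).
Proof.
move=> oU; elim: k f h => [|k IH] f h.
  by move=> cf ch y Uy; exact: continuousD (cf y Uy) (ch y Uy).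
move=> [df1 df2] [dh1 dh2]; split=> [y Uy|a].
  by apply: differentiableD; [exact: df1|exact: dh1].
apply: (Ck_eq oU _ (IH _ _ (df2 a) (dh2 a))) => z Uz.
by rewrite partialD//; [exact: df1|exact: dh1].
Qed.

Lemma CkM k U f h : open U -> Ck k U f -> Ck k U h ->
  Ck k U (fun z => f z * h z).
Proof.
move=> oU; elim: k f h => [|k IH] f h.
  by move=> cf ch y Uy; exact: continuousM (cf y Uy) (ch y Uy).
move=> cf ch; move: (cf) (ch) => [df1 df2] [dh1 dh2]; split=> [y Uy|a].
  by apply: differentiableM; [exact: df1|exact: dh1].
apply: (Ck_eq oU _ (CkD oU (IH _ _ (CkW cf) (dh2 a)) (IH _ _ (CkW ch) (df2 a)))) => z Uz.
by rewrite partialM//; [exact: df1|exact: dh1].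
Qed.

Lemma CkZ k U f c : open U -> Ck k U f -> Ck k U (fun z => c * f z).
Proof. by move=> oU; apply: CkM => //; exact: Ck_cst. Qed.

Lemma Ck_sum k U (I : Type) (r : seq I) (P : pred I) (F : I -> E -> R) :
  open U -> (forall i, P i -> Ck k U (F i)) ->
  Ck k U (fun z => \sum_(i <- r | P i) F i z).
Proof.
move=> oU H; elim: r => [|i r IH].
  by under eq_fun do rewrite big_nil; exact: Ck_cst.
under eq_fun do rewrite big_cons.
by case: (boolP (P i)) => // Pi; apply: CkD => //; exact: H.
Qed.

Lemma Ck_prod k U (I : Type) (r : seq I) (P : pred I) (F : I -> E -> R) :
  open U -> (forall i, P i -> Ck k U (F i)) ->
  Ck k U (fun z => \prod_(i <- r | P i) F i z).
Proof.
move=> oU H; elim: r => [|i r IH].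
  by under eq_fun do rewrite big_nil; exact: Ck_cst.
under eq_fun do rewrite big_cons.
by case: (boolP (P i)) => // Pi; apply: CkM => //; exact: H.
Qed.

Lemma differentiable_comp1 (g : R -> R) f dg y :
  is_derive (f y) 1 g dg -> differentiable f y ->
  differentiable (fun z => g (f z)) y.
Proof.
move=> gd fd; apply: (@differentiable_comp _ _ _ _ f g) => //.
exact/derivable1_diffP.
Qed.

Lemma partial_comp1 (g : R -> R) f dg a y :
  is_derive (f y) 1 g dg -> differentiable f y ->
  partial a (fun z => g (f z)) y = dg * partial a f y.
Proof.
move=> gd fd; have dd : differentiable g (f y) by exact/derivable1_diffP.
rewrite /partial deriveE; last exact: differentiable_comp1 gd fd.
rewrite (_ : (fun z => g (f z)) = g \o f)// diff_comp//= deriveE//.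
by rewrite diff1E//= derive1E derive_val mulrC.
Qed.

(** The outer function is typically a real power or a profile, regular only on part of the line;
    hence its derivative [dg] is a separate datum, constrained only at the values taken by [f]. *)
Lemma C1_comp1 (g dg : R -> R) U f : open U ->
  (forall y, U y -> is_derive (f y) 1 g (dg (f y))) ->
  (forall y, U y -> {for f y, continuous dg}) ->
  Ck 1 U f -> Ck 1 U (fun z => g (f z)).
Proof.
move=> oU gd cdg cf; split=> [y Uy|a].
  by apply: differentiable_comp1 (gd _ Uy) _; exact: (Ck_diff cf Uy).
have H : Ck 0 U (fun z => dg (f z) * partial a f z).
  apply: CkM => //; last by have [_] := cf; apply.
  move=> y Uy; apply: (@continuous_comp _ _ _ f dg); last exact: cdg.
  exact: Ck0 cf Uy.
apply: (Ck_eq oU _ H) => z Uz.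
by rewrite (partial_comp1 _ (gd _ Uz))//; exact: (Ck_diff cf Uz).
Qed.

Lemma rV_sum_delta (w : E) : w = \sum_b w 0 b *: delta_mx 0 b.
Proof. exact: row_sum_delta. Qed.

Lemma differentiable_rV (T : E -> E) y :
  (forall b, differentiable (fun z => T z 0 b) y) -> differentiable T y.
Proof.
move=> H; rewrite (_ : T = \sum_b (fun z => T z 0 b *: delta_mx 0 b)).
  by apply: differentiable_sum => b; exact: differentiableZl.
by apply/funext => z; rewrite fct_sumE; exact: rV_sum_delta.
Qed.

Lemma diff_partial f y w : differentiable f y ->
  'd f y w = \sum_b w 0 b * partial b f y.
Proof.
move=> df; rewrite [in LHS](rV_sum_delta w) linear_sum.
by apply: eq_bigr => b _; rewrite linearZ /= /partial deriveE.
Qed.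

Lemma differentiable_compV (T : E -> E) f y :
  (forall b, differentiable (fun z => T z 0 b) y) -> differentiable f (T y) ->
  differentiable (fun z => f (T z)) y.
Proof.
move=> /differentiable_rV dT df.
exact: (@differentiable_comp _ _ _ _ T f).
Qed.

Lemma partial_compV (T : E -> E) f a y :
  (forall b, differentiable (fun z => T z 0 b) y) -> differentiable f (T y) ->
  partial a (fun z => f (T z)) y =
  \sum_b partial b f (T y) * partial a (fun z => T z 0 b) y.
Proof.
move=> dT df; have dT' := differentiable_rV dT.
rewrite {1}/partial deriveE; last exact: differentiable_compV.
rewrite (_ : (fun z => f (T z)) = f \o T)// diff_comp//= diff_partial//.
apply: eq_bigr => b _; rewrite mulrC; congr (_ * _).
rewrite -deriveE// derive_mx ?mxE//; exact: diff_derivable.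
Qed.

(** T is meant to be a transition map, hence smooth; the extra derivative asked of its components
    yields the continuity of T in the base case. *)
Lemma Ck_compV k (T : E -> E) U V f : open U -> (forall y, U y -> V (T y)) ->
  (forall b, Ck k.+1 U (fun z => T z 0 b)) -> Ck k V f ->
  Ck k U (fun z => f (T z)).
Proof.
move=> oU UV; elim: k f => [|k IH] f cT cf.
  move=> y Uy; apply: (@continuous_comp _ _ _ T f); last exact/cf/UV.
  apply/differentiable_continuous/differentiable_rV => b; exact: Ck_diff (cT b) Uy.
have cT' b : Ck k.+1 U (fun z => T z 0 b) by exact: CkW.
split=> [y Uy|a].
  apply: differentiable_compV => [b|]; first exact: Ck_diff (cT b) Uy.
  exact: Ck_diff cf (UV _ Uy).
have H : Ck k U (fun z => \sum_b partial b f (T z) * partial a (fun z => T z 0 b) z).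
  apply: Ck_sum => // b _; apply: CkM => //; first by apply: IH => //; have [_] := cf; apply.
  by apply: CkW; have [_ ] := cT b; apply.
apply: (Ck_eq oU _ H) => z Uz; rewrite partial_compV// => [b|].
  exact: Ck_diff (cT b) Uz.
exact: Ck_diff cf (UV _ Uz).
Qed.

End calculus.

(** * Flat functions built from exp(-1/t) *)

Section flat_function.
Context {R : realType}.

(** Serves at the origin for functions defined by cases or through |t|, where the rules of calculus
    do not apply: the difference quotient is bounded by w. *)
Lemma is_derive_squeeze0 (f w : R -> R) : f 0 = 0 ->
  (forall t, `|f t| <= `|t| * w t) -> w t @[t --> 0] --> 0 ->
  is_derive (0 : R) (1 : R) f 0.
Proof.
move=> f0 fw w0.
have H : h^-1 *: ((f \o shift 0) (h *: 1) - f 0) @[h --> 0^'] --> (0 : R).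
  apply: norm_cvg0.
  have w0' : w t @[t --> 0^'] --> (0 : R).
    by apply: cvg_trans w0; apply: cvg_app; exact: cvg_within.
  apply: (@squeeze_cvgr _ _ _ _ (fun=> 0) w) => //; last exact: cvg_cst.
  near=> h; rewrite normr_ge0 /= f0 subr0 addr0 normrM normfV.
  have h0 : h != 0 by near: h; exact: nbhs_dnbhs_neq.
  by rewrite /GRing.scale/= mulr1 ler_pdivrMl ?normr_gt0.
split; first by apply/cvg_ex; exists 0.
exact: cvg_lim H.
Unshelve. all: by end_near. Qed.

(* flat j t = t^-j exp(-1/t) on the positive half-line: the family is stable
   under differentiation. *)
Definition flat (j : nat) (t : R) : R :=
  if 0 < t then t^-1 ^+ j * expR (- t^-1) else 0.

Lemma flat_neg j t : t <= 0 -> flat j t = 0.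
Proof. by move=> t0; rewrite /flat ltNge t0. Qed.

Lemma flat_ge0 j t : 0 <= flat j t.
Proof.
rewrite /flat; case: ifPn => // t0.
by rewrite mulr_ge0 ?expR_ge0// exprn_ge0// invr_ge0 ltW.
Qed.

Lemma flat_gt0 j t : 0 < t -> 0 < flat j t.
Proof. by move=> t0; rewrite /flat t0 mulr_gt0 ?expR_gt0// exprn_gt0// invr_gt0. Qed.

Lemma flat0_le1 t : flat 0 t <= 1.
Proof.
rewrite /flat; case: ifPn => // t0.
by rewrite expr0 mul1r -expR0 ler_expR oppr_le0 invr_ge0 ltW.
Qed.

(** For t > 0 and u = 1/t this is u^j <= j! exp(u), which keeps a single term of the exponential
    series. *)
Lemma flat_le j t : flat j t <= j`!%:R.
Proof.
rewrite /flat; case: ifPn => [t0|_]; last exact: ler0n.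
have u0 : 0 <= t^-1 by rewrite invr_ge0 ltW.
rewrite expRN ler_pdivrMr ?expR_gt0//.
case: j => [|j]; first by rewrite expr0 fact0 mul1r -expR0 ler_expR.
have := expR_ge1Dxn j u0.
have f0 : 0 < (j.+1)`!%:R :> R by rewrite ltr0n fact_gt0.
move=> H; rewrite mulrC -ler_pdivrMr//; apply: le_trans H.
by rewrite lerDr.
Qed.

Lemma flatS j t : 0 < t -> flat j.+1 t = t^-1 * flat j t.
Proof. by move=> t0; rewrite /flat t0 exprS mulrA. Qed.

Lemma is_derive_flat j t :
  is_derive t (1 : R) (flat j) (flat j.+2 t - j%:R * flat j.+1 t).
Proof.
have [t0|t0|t0] := ltgtP t 0.
- rewrite !flat_neg ?ltW// mulr0 subr0.
  apply: (@near_eq_is_derive _ _ _ (cst 0)).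
  by near=> s; rewrite flat_neg// ltW//; near: s; exact: lt_nbhsl.
- pose f := fun s : R => s^-1 ^+ j * expR (- s^-1).
  apply: (@near_eq_is_derive _ _ _ f).
    near=> s; rewrite /f /flat ifT//; near: s; exact: lt_nbhsr.
  have iv : is_derive t (1 : R) (fun s : R => s^-1) (- t^-1 ^+ 2).
    have tn0 : id t != 0 by rewrite gt_eqF.
    apply: is_derive_eq (is_deriveV tn0 (is_derive_id _ _)) _.
    by rewrite /GRing.scale/= mulr1 exprVn.
  have ivj : is_derive t (1 : R) (fun s : R => s^-1 ^+ j) (- (j%:R * t^-1 ^+ j.+1)).
    have pj : is_derive t^-1 (1 : R) (@GRing.exp R ^~ j) (j%:R * t^-1 ^+ j.-1).
      split; first exact: exprn_derivable.
      by rewrite exp_derive /GRing.scale/= mulr1.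
    apply: is_derive_eq (is_derive1_comp pj iv) _.
    rewrite mulrN; congr (- _).
    by case: j {f pj} => [|j]; rewrite ?mul0r// -mulrA -exprD addn2.
  have ex : is_derive t (1 : R) (fun s : R => expR (- s^-1)) (expR (- t^-1) * t^-1 ^+ 2).
    have ivN : is_derive t (1 : R) (fun s : R => - s^-1) (t^-1 ^+ 2).
      by apply: is_derive_eq (is_deriveN iv) _; rewrite opprK.
    apply: is_derive_eq (is_derive1_comp _ ivN) _.
    by rewrite mulrC.
  apply: is_derive_eq (is_deriveM ivj ex) _.
  rewrite /flat t0 /GRing.scale/= !exprS; ring.
- rewrite t0 !flat_neg// mulr0 subr0.
  (* For s > 0, [flat j s] equals s^2 [flat j.+2 s]; the bound (j+2)! on the last factor leaves |s|
     times a quantity tending to 0. *)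
  apply: (@is_derive_squeeze0 _ (fun s => (j.+2)`!%:R * `|s|)).
  + exact: flat_neg.
  + move=> s; have [s0|s0] := leP s 0.
      by rewrite flat_neg// normr0 mulr_ge0// mulr_ge0.
    rewrite ger0_norm ?flat_ge0// (gtr0_norm s0).
    have := flat_le j.+2 s; rewrite !flatS// => H.
    rewrite mulrCA -ler_pdivrMr ?mulr_gt0//; apply: le_trans H.
    by rewrite mulrA -invfM mulrC.
  + rewrite -[X in _ --> X](mulr0 (j.+2)`!%:R); apply: cvgMr.
    rewrite -[X in _ --> X](@normr0 _ R); apply: cvg_norm; exact: cvg_id.
Unshelve. all: by end_near. Qed.

Lemma continuous_flat j : continuous (flat j).
Proof.
move=> t; apply/differentiable_continuous/derivable1_diffP.
by have [] := is_derive_flat j t.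
Qed.

Lemma Ck_flat {n} k j (U : set 'rV[R]_n) (f : 'rV[R]_n -> R) : open U ->
  smooth U f -> Ck k U (fun z => flat j (f z)).
Proof.
move=> oU sf; elim: k j => [|k IH] j.
  move=> y Uy; apply: (@continuous_comp _ _ _ f (flat j)).
    exact: sf 0%N y Uy.
  exact: continuous_flat.
split=> [y Uy|a].
  apply: differentiable_comp1 (is_derive_flat _ _) _; exact: (Ck_diff (sf 1%N) Uy).
have H : Ck k U (fun z => (flat j.+2 (f z) + (- j%:R) * flat j.+1 (f z)) * partial a f z).
  apply: CkM => //; last by have [_] := sf k.+1; apply.
  by apply: CkD => //; apply: CkZ.
apply: (Ck_eq oU _ H) => z Uz.
by rewrite (partial_comp1 _ (is_derive_flat _ _)) ?mulNr//; exact: (Ck_diff (sf 1%N) Uz).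
Qed.

End flat_function.

(** * Borel sets, change of variables and integration by parts *)

Section borel_measurability.
Context {T : ptopologicalType}.

Lemma borel_open (U : set T) : open U -> measurable (U : set (borel T)).
Proof. by move=> oU; exact: sub_sigma_algebra. Qed.

Lemma borel_closed (U : set T) : closed U -> measurable (U : set (borel T)).
Proof.
by move=> cU; rewrite -(setCK U); apply: measurableC; apply: borel_open; exact: closed_openC.
Qed.

Lemma borel_compact (K : set T) : hausdorff_space T -> compact K ->
  measurable (K : set (borel T)).
Proof. by move=> hT cK; apply: borel_closed; exact: compact_closed. Qed.

Lemma open_preimageI (T' : topologicalType) (U : set T) (f : T -> T') (O : set T') :
  open U -> (forall x, U x -> {for x, continuous f}) -> open O ->
  open (U `&` f @^-1` O).
Proof.
move=> oU cf oO; rewrite openE => x [Ux Ofx]; apply: filterI.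
  exact: open_nbhs_nbhs.
by apply: (cf x Ux); exact: open_nbhs_nbhs.
Qed.

Lemma continuous_on_measurable (R : realType) (U : set T) (f : T -> R) :
  open U -> (forall x, U x -> {for x, continuous f}) ->
  measurable_fun (U : set (borel T)) (f : borel T -> R).
Proof.
move=> oU cf; apply: (measurability _ (RGenOpens.measurableE R)).
by move=> _ [_ [a [b ->] <-]]; apply: borel_open; exact: open_preimageI.
Qed.

Lemma continuous_on_measurable_borel (T' : ptopologicalType) (U : set T) (f : T -> T') :
  open U -> (forall x, U x -> {for x, continuous f}) ->
  measurable_fun (U : set (borel T)) (f : borel T -> borel T').
Proof.
move=> oU cf; apply: (@measurability _ _ _ _ _ _ (@open T' : set (set (borel T')))) => //.
by move=> _ [V oV <-]; apply: borel_open; exact: open_preimageI.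
Qed.

End borel_measurability.

(** * Change of variables for a measure given by a density *)

Section change_of_variables.
Context d1 d2 (T1 : measurableType d1) (T2 : measurableType d2) (R : realType).
Variables (mu1 : {measure set T1 -> \bar R}) (mu2 : {measure set T2 -> \bar R}).
Variables (D1 : set T1) (D2 : set T2) (theta : T2 -> T1) (m : T2 -> R).
Hypotheses (mD1 : measurable D1) (mD2 : measurable D2).
Hypotheses (mtheta : measurable_fun D2 theta) (thetaD : forall y, D2 y -> D1 (theta y)).
Hypotheses (mm : measurable_fun D2 m) (m0 : forall y, D2 y -> 0 <= m y).
Hypothesis mu1E : forall A, measurable A -> A `<=` D1 ->
  (mu1 A = \int[mu2]_(y in D2 `&` theta @^-1` A) (m y)%:E)%E.

Import HBNNSimple.

Let comp_measurable (d : measure_display) (U : measurableType d) (f : T1 -> U) :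
  measurable_fun D1 f -> measurable_fun D2 (f \o theta).
Proof.
move=> mf; apply: (measurable_comp mD1) => //.
by move=> _ [y D2y <-]; exact: thetaD.
Qed.

(** [mu1E] says that on [D1] the measure [mu1] is the image under [theta] of [mu2] with density [m].
    This is the simple-function stage of the usual extension from indicators to integrable
    functions; the uses are translations and chart parametrizations. *)
Lemma nnsfun_integral_change (h : {nnsfun T1 >-> R}) :
  (\int[mu1]_(x in D1) (h x)%:E =
   \int[mu2]_(y in D2) ((h (theta y))%:E * (m y)%:E))%E.
Proof.
have mA r : measurable (h @^-1` [set r]) by [].
have m1 r : measurable_fun D2 (fun y => m y * \1_(h @^-1` [set r]) (theta y)).
  apply: measurable_funM => //.
  by apply: (@comp_measurable _ _ (\1_(h @^-1` [set r]) : T1 -> R)); exact: measurable_indic.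
transitivity (\sum_(r \in range h)
    (\int[mu2]_(y in D2) (r%:E * (m y * \1_(h @^-1` [set r]) (theta y))%:E)))%E.
  under eq_integral do rewrite fimfunE -fsumEFin//.
  rewrite ge0_integral_fsum//; last 2 first.
  - by move=> y; apply/measurable_EFinP/measurable_funM.
  - by move=> y x _; rewrite nnfun_muleindic_ge0.
  apply: eq_fsbigr => r _.
  have [r0|r0] := leP 0 r; last first.
    rewrite preimage_nnfun0// indic0.
    transitivity (0 : \bar R); [|symmetry]; apply: integral0_eq => x _ /=.
      by rewrite mulr0.
    by rewrite mulr0 mule0.
  transitivity (r%:E * \int[mu1]_(x in D1) (\1_(h @^-1` [set r]) x)%:E)%E.
    by rewrite -ge0_integralZl//; exact/measurable_EFinP.
  rewrite integral_indic// mu1E; [|exact: measurableI|exact: subIsetr].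
  rewrite [RHS]ge0_integralZl//; last 2 first.
  - exact/measurable_EFinP.
  - by move=> y D2y; rewrite lee_fin mulr_ge0// m0.
  congr (_ * _)%E; rewrite integral_mkcondr; apply: eq_integral => y /[!inE] D2y.
  rewrite patchE indicE; case: (pselect (h (theta y) = r)) => hr.
    by rewrite !mem_set ?mulr1//=; split => //; exact: thetaD.
  by rewrite !memNset ?mulr0// => -[].
rewrite -ge0_integral_fsum//.
- apply: eq_integral => x /[!inE] D2x; rewrite -EFinM [in RHS]fimfunE.
  rewrite !fsbig_finite//= mulr_suml -sumEFin.
  by apply: eq_bigr => r _; rewrite -EFinM; congr (_ %:E); ring.
- by move=> r; apply/measurable_EFinP; exact: measurable_funM.
- move=> r y D2y; have [r0|r0] := leP 0 r.
    by rewrite mule_ge0 ?lee_fin// mulr_ge0// m0.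
  by rewrite preimage_nnfun0// indic0 mulr0 mule0.
Qed.

Lemma ge0_integral_change (f : T1 -> \bar R) :
  measurable_fun D1 f -> (forall x, D1 x -> (0 <= f x)%E) ->
  (\int[mu1]_(x in D1) f x = \int[mu2]_(y in D2) (f (theta y) * (m y)%:E))%E.
Proof.
move=> mf f0.
pose f_ := nnsfun_approx mD1 mf.
transitivity (limn (fun n => \int[mu1]_(x in D1) (f_ n x)%:E))%E.
  rewrite -monotone_convergence//.
  - apply: eq_integral => y /[!inE] yD; apply/esym/cvg_lim => //.
    exact: cvg_nnsfun_approx.
  - by move=> n; apply/measurable_EFinP; exact: measurable_funTS.
  - by move=> n y _; rewrite lee_fin.
  - by move=> y _ k n kn; rewrite lee_fin; exact/lefP/nd_nnsfun_approx.
have mfth n : measurable_fun D2 (f_ n \o theta).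
  by apply: measurableT_comp => //; exact: measurable_funP.
under eq_fun do rewrite nnsfun_integral_change.
rewrite -monotone_convergence//; last 3 first.
- move=> n; apply: emeasurable_funM; apply/measurable_EFinP; last exact: mm.
  exact: mfth.
- by move=> n x D2x /=; rewrite mule_ge0// lee_fin// m0.
- move=> x D2x k n kn; rewrite lee_wpmul2r ?lee_fin ?m0//.
  exact/lefP/nd_nnsfun_approx.
apply: eq_integral => y /[!inE] D2y /=; apply/cvg_lim => //.
apply: cvgeZr => //.
by apply: cvg_nnsfun_approx => //; exact: thetaD.
Qed.

Lemma integral_change (f : T1 -> R) : measurable_fun D1 f ->
  (\int[mu1]_(x in D1) (f x)%:E = \int[mu2]_(y in D2) (f (theta y) * m y)%:E)%E.
Proof.
move=> mf; rewrite integralE [RHS]integralE.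
have mfE : measurable_fun D1 (EFin \o f) by exact/measurable_EFinP.
congr (_ - _)%E; rewrite ge0_integral_change//.
- apply: eq_integral => y /[!inE] D2y.
  by rewrite muleC !funeposE maxeMr ?lee_fin ?m0// mule0 -EFinM mulrC.
- exact: measurable_funepos.
- apply: eq_integral => y /[!inE] D2y.
  by rewrite muleC !funenegE maxeMr ?lee_fin ?m0// mule0 -!EFinN -EFinM mulrN mulrC.
- exact: measurable_funeneg.
Qed.

Lemma integrable_change (f : T1 -> R) : measurable_fun D1 f ->
  mu1.-integrable D1 (EFin \o f) <->
  mu2.-integrable D2 (fun y => (f (theta y) * m y)%:E).
Proof.
move=> mf.
have mf2 : measurable_fun D2 (fun y => f (theta y) * m y).
  by apply: measurable_funM => //; exact: comp_measurable.
have E : (\int[mu1]_(x in D1) `|(f x)%:E| =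
          \int[mu2]_(y in D2) `|(f (theta y) * m y)%:E|)%E.
  rewrite ge0_integral_change//.
    apply: eq_integral => y /[!inE] D2y.
    by rewrite EFinM abseM [X in (_ = _ * X)%E]gee0_abs// lee_fin m0.
  by apply: measurableT_comp => //; exact/measurable_EFinP.
split=> /integrableP[_ H]; apply/integrableP; split.
- exact/measurable_EFinP.
- by rewrite -E.
- exact/measurable_EFinP.
- by rewrite E.
Qed.

End change_of_variables.

Lemma compact_bound (T : topologicalType) (R : realType) (K : set T) (f : T -> R) :
  compact K -> (forall x, K x -> {for x, continuous f}) ->
  exists2 C, 0 <= C & forall x, K x -> `|f x| <= C.
Proof.
move=> cK cf.
have cfK : {within K, continuous f}.
  by apply: continuous_in_subspaceT => x /[!inE] Kx; exact: cf.
have /compact_bounded[C [_ HC]] := continuous_compact cfK cK.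
exists (`|C| + 1) => [|x Kx]; first by rewrite addr_ge0.
apply: HC; last by exists x.
by rewrite (le_lt_trans (ler_norm C))// ltrDl.
Qed.

Lemma fin_adde_eq0 (R : realType) (x y : \bar R) : x \is a fin_num ->
  y \is a fin_num -> (x + y = 0 -> x = - y)%E.
Proof.
by move: x y => [x| |] [y| |]//= _ _ [] /eqP; rewrite addr_eq0 => /eqP ->.
Qed.

(** * Lebesgue measure: boxes, translations, compact sets *)

Section lebesgue.
Context {R : realType} {n : nat}.
Local Notation E := 'rV[R]_n.
Variable lam : {measure set (borel E) -> \bar R}.
Hypothesis hlam : is_lebesgue lam.

Definition hbox (a b : E) : set E := [set y : E | forall i, a 0 i < y 0 i <= b 0 i].

Lemma rV_coord_continuous (i : 'I_n) : continuous (fun y : E => y 0 i).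
Proof. by move=> y; apply/differentiable_continuous/differentiable_coord. Qed.

Lemma measurable_hbox a b : measurable (hbox a b : set (borel E)).
Proof.
rewrite (_ : hbox a b = \bigcap_(i in [set: 'I_n])
    ((fun y : E => y 0 i) @^-1` `]a 0 i, b 0 i])); last first.
  apply/seteqP; split=> [y H i _|y H i]; first by rewrite /= in_itv/=; exact: H.
  by have /= := H i Logic.I; rewrite in_itv.
apply: fin_bigcap_measurable => // i _.
rewrite -[X in measurable X]setTI.
apply: (continuous_on_measurable openT) => // y _; exact: rV_coord_continuous.
Qed.

Lemma hbox_setI_closed : setI_closed (range (fun ab : E * E => hbox ab.1 ab.2)).
Proof.
move=> _ _ [[a b] _ <-] [[c d] _ <-].
exists (\row_i Num.max (a 0 i) (c 0 i), \row_i Num.min (b 0 i) (d 0 i)) => //=.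
apply/seteqP; split=> y /=.
  by move=> H; split=> i; have := H i; rewrite !mxE gt_max le_min;
    case/andP => /andP[? ?] /andP[? ?]; apply/andP.
move=> [H1 H2] i; rewrite !mxE gt_max le_min.
by have /andP[-> ->] := H1 i; have /andP[-> ->] := H2 i.
Qed.

Definition rat_center (q : 'rV[rat]_n) : E := map_mx ratr q.

Lemma rat_cube (U : set E) (x : E) : open U -> U x ->
  exists (q : 'rV[rat]_n) (k : nat),
    (forall i, `|x 0 i - rat_center q 0 i| < k.+1%:R^-1) /\
    [set y : E | forall i, `|y 0 i - rat_center q 0 i| <= k.+1%:R^-1] `<=` U.
Proof.
move=> oU Ux.
have /nbhs_ballP[_/posnumP[e] eU] : nbhs x U by exact: open_nbhs_nbhs.
pose k := Num.truncn (2 / e%:num).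
have ke : k.+1%:R^-1 <= e%:num / 2.
  rewrite -[leRHS]invf_div lef_pV2 ?posrE //.
  by apply: ltW; rewrite truncnS_gt.
have h i : {q : rat | ratr q \in `](x 0 i - k.+1%:R^-1), (x 0 i + k.+1%:R^-1)[}.
  apply/cid/rat_in_itvoo.
  by rewrite ltrD2l gtrN.
exists (\row_i sval (h i)), k; split=> [i|y yq].
  rewrite !mxE; case: (h i) => q /=; rewrite in_itv/= ltr_distl.
  set d := k.+1%:R^-1; lra.
apply: eU; split=> // i j; rewrite (ord1 i) -ball_normE/=.
have := yq j; rewrite !mxE; case: (h j) => q /=; rewrite in_itv/= ltr_distl ler_distl.
move: ke; set d := k.+1%:R^-1; lra.
Qed.

(** An open set is the union of the rational half-open boxes it contains, and these are countably
    many. Uniqueness and approximation arguments can then be run on boxes. *)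
Lemma borel_hbox :
  @measurable _ (borel E) = <<s range (fun ab : E * E => hbox ab.1 ab.2) >>.
Proof.
apply/seteqP; split; last first.
  apply: smallest_sub; first exact: sigma_algebra_measurable.
  by move=> _ [[a b] _ <-]; exact: measurable_hbox.
apply: smallest_sub; first exact: smallest_sigma_algebra.
move=> U oU.
pose B (qk : 'rV[rat]_n * nat) := hbox (rat_center qk.1 - const_mx qk.2.+1%:R^-1)
  (rat_center qk.1 + const_mx qk.2.+1%:R^-1).
pose P := [set qk | B qk `<=` U].
rewrite (_ : U = \bigcup_qk (if `[< P qk >] then B qk else set0)); last first.
  apply/seteqP; split=> [x Ux|x [qk _]]; last by case: asboolP => // H /H.
  have [q [k [xq qU]]] := rat_cube oU Ux.
  have BE y : B (q, k) y = forall i, - k.+1%:R^-1 < y 0 i - rat_center q 0 i <= k.+1%:R^-1.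
    apply/propext; split=> H i; have := H i; rewrite !mxE; set d := k.+1%:R^-1; lra.
  exists (q, k) => //; case: asboolP => [_|]; last first.
    move=> H; exfalso; apply: H => y; rewrite BE => yB; apply: qU => i.
    by have := yB i; rewrite ler_norml; set d := k.+1%:R^-1; lra.
  by rewrite BE => i; have := xq i; rewrite ltr_norml; set d := k.+1%:R^-1; lra.
apply: (@countable_bigcupT_measurable _ (g_sigma_algebraType (range (fun ab : E * E => hbox ab.1 ab.2)))).
  exact: countableP.
move=> qk; case: asboolP => // _; apply: sub_sigma_algebra.
by exists (rat_center qk.1 - const_mx qk.2.+1%:R^-1, rat_center qk.1 + const_mx qk.2.+1%:R^-1).
Qed.

Definition cube (r : R) : set E := hbox (const_mx (- r)) (const_mx r).

Lemma lam_cube r : (lam (cube r) < +oo)%E.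
Proof.
have [r0|r0] := leP 0 r.
  by rewrite hlam ?ltry// => i; rewrite !mxE; lra.
(* For negative r the cube is empty, except in dimension 0, where it is the single point of the
   space. *)
have [n0|n0] := posnP n; last first.
  rewrite (_ : cube r = set0) ?measure0//; apply/seteqP; split => // y.
  by move=> /(_ (Ordinal n0)); rewrite !mxE; lra.
have E0 (i : 'I_n) : False by move: i; rewrite n0; case.
by rewrite hlam ?ltry// => i; case: (E0 i).
Qed.

Lemma cube_cover : \bigcup_k cube k%:R = [set: E].
Proof.
apply/seteqP; split => // y _.
pose B := \sum_i `|y 0 i|.
have yB i : `|y 0 i| <= B.
  by rewrite /B (bigD1 i)//= lerDl sumr_ge0.
exists (Num.truncn B).+1 => // i; rewrite !mxE.
have := yB i; have := truncnS_gt B; rewrite ler_norml; lra.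
Qed.

Lemma measurable_shift (h : E) : measurable_fun setT (fun y : borel E => y + h : borel E).
Proof.
apply: (continuous_on_measurable_borel openT) => y _.
by apply: (@continuousD _ _ _ id (cst h)); [exact: id|exact: cst_continuous].
Qed.

(** Uniqueness of measures: [lam] and its translate agree on half-open boxes, a family stable under
    intersection that generates the Borel sets and contains an exhaustion by cubes of finite
    measure. *)
Lemma lam_shift (h : E) (A : set (borel E)) : measurable A ->
  lam [set y : E | A (y + h)] = lam A.
Proof.
move=> mA; pose phi := fun y : borel E => y + h : borel E.
pose m1 : {measure set (borel E) -> \bar R} :=
  measure_function_pushforward__canonical__measure_function_Measure lam (measurable_shift h).
rewrite -[LHS]/(m1 A); apply/esym.
have U1 := @measure_unique _ R (borel E) _ (fun k => cube k%:R) borel_hbox hbox_setI_closed.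
have U2 := U1 _ cube_cover.
apply: (U2 _ lam m1) => //.
- by move=> k; exists (const_mx (- k%:R), const_mx k%:R).
- move=> _ [[a b] _ <-]; rewrite /m1/= /pushforward.
  have -> : phi @^-1` hbox a b = hbox (a - h) (b - h).
    by apply/seteqP; split=> y H i; have := H i; rewrite !mxE; lra.
  have [ab|] := pselect (forall i, a 0 i <= b 0 i).
    rewrite !hlam// => [|i]; last by rewrite !mxE; have := ab i; lra.
    by congr (_ %:E); apply: eq_bigr => i _; rewrite !mxE; ring.
  move=> /existsNP[i ab].
  have e0 (c d : E) : d 0 i < c 0 i -> hbox c d = set0.
    move=> dc; apply/seteqP; split=> // y /(_ i); lra.
  rewrite !e0 ?measure0// ?mxE; move/negP: ab; rewrite -ltNge//; lra.
- by move=> k; exact: lam_cube.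
Qed.

Lemma compact_coord_bound (K : set E) : compact K ->
  exists2 B : 'I_n -> R, (forall i, 0 <= B i) & forall i y, K y -> `|y 0 i| <= B i.
Proof.
move=> cK; have H i : exists2 C, 0 <= C & forall y, K y -> `|y 0 i| <= C.
  by apply: (compact_bound cK) => y _; exact: rV_coord_continuous.
by exists (fun i => sval (cid2 (H i))) => i; case: cid2.
Qed.

Lemma lam_compact (K : set E) : compact K -> (lam K < +oo)%E.
Proof.
move=> cK.
have [B B0 HB] := compact_coord_bound cK.
apply: (@le_lt_trans _ _ (lam (hbox (\row_i (- B i - 1)) (\row_i (B i + 1))))).
  apply: le_measure; rewrite ?inE.
  - by apply: borel_compact => //; exact: norm_hausdorff.
  - exact: measurable_hbox.
  - move=> y Ky i; rewrite !mxE; have := HB i y Ky; rewrite ler_norml; lra.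
by rewrite hlam ?ltry// => i; rewrite !mxE; have := B0 i; lra.
Qed.

Definition translate (h : E) : borel E -> borel E := fun y => (y : E) + h.

Lemma lam_shift_change (h : E) (A : set (borel E)) : measurable A -> A `<=` setT ->
  (lam A = \int[lam]_(y in setT `&` translate h @^-1` A)
    (1 : R)%:E)%E.
Proof.
move=> mA _; rewrite setTI integral_cst ?mul1e ?lam_shift//.
by rewrite -[X in measurable X]setTI; exact: measurable_shift.
Qed.

Lemma integral_shift (h : E) (f : E -> R) :
  measurable_fun setT (f : borel E -> R) ->
  (\int[lam]_y (f ((y : E) + h)%R)%:E = \int[lam]_y (f y)%:E)%E.
Proof.
move=> mf; rewrite [RHS](@integral_change _ _ _ _ _ _ lam setT setT
  (translate h) (fun=> 1) _ _ (measurable_shift h) _ _ _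
  (@lam_shift_change h))//.
by apply: eq_integral => y _; rewrite mulr1.
Qed.

Lemma integrable_shift (h : E) (f : E -> R) :
  lam.-integrable setT (fun y : borel E => (f y)%:E) ->
  lam.-integrable setT (fun y : borel E => (f ((y : E) + h)%R)%:E).
Proof.
move=> fi; have mf : measurable_fun setT (f : borel E -> R).
  by apply/measurable_EFinP; exact: measurable_int fi.
have := (@integrable_change _ _ _ _ _ lam lam setT setT
  (translate h) (fun=> 1) _ _ (measurable_shift h) _ _ _
  (@lam_shift_change h) f mf).1.
move=> /(_ measurableT measurableT (fun _ _ => I) (measurable_cst _) (fun _ _ => ler01) fi).
by apply: eq_integrable => // y _; rewrite mulr1.
Qed.

End lebesgue.

Section compact_support.
Context {T : ptopologicalType} {R : realType}.
Variable mu : {measure set (borel T) -> \bar R}.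

Lemma integrable_on_compact (K U : set T) (f : T -> R) : hausdorff_space T ->
  compact K -> (mu K < +oo)%E -> open U -> K `<=` U ->
  (forall x, U x -> {for x, continuous f}) ->
  mu.-integrable (K : set (borel T)) (fun x : borel T => (f x)%:E).
Proof.
move=> hT cK Kfin oU KU cf.
apply: (measurable_bounded_integrable (f := (f : borel T -> R))) => //.
- exact: borel_compact.
- by apply: measurable_funS (continuous_on_measurable oU cf) => //; exact: borel_open.
- have [C C0 HC] := compact_bound cK (fun x Kx => cf x (KU x Kx)).
  exists C; split; first exact: num_real.
  by move=> M CM x Kx /=; rewrite (le_trans (HC _ Kx))// ltW.
Qed.

Lemma integrable_zero_off (K D : set (borel T)) (f : borel T -> \bar R) :
  measurable K -> measurable D -> K `<=` D -> (forall x, D x -> ~ K x -> f x = 0%E) ->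
  mu.-integrable K f -> mu.-integrable D f.
Proof.
move=> mK mD KD f0 /(integrable_mkcond _ mK) H.
have := integrableS measurableT mD (@subsetT _ D) H.
apply: eq_integrable => // x /[!inE] Dx; rewrite patchE.
by case: ifPn => //; rewrite notin_setE => /(f0 _ Dx).
Qed.

Lemma integral_zero_off (K D : set (borel T)) (f : borel T -> \bar R) :
  K `<=` D -> (forall x, D x -> ~ K x -> f x = 0%E) ->
  (\int[mu]_(x in D) f x = \int[mu]_(x in K) f x)%E.
Proof.
move=> KD f0; rewrite integral_mkcond [RHS]integral_mkcond; apply: eq_integral => x _.
rewrite !patchE; case: ifPn; rewrite ?notin_setE ?in_setE => Dx; last first.
  by rewrite memNset// => /KD.
by case: ifPn => //; rewrite notin_setE => /(f0 _ Dx).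
Qed.

End compact_support.

(** * Integration by parts in coordinates *)

Section integration_by_parts.
Context {R : realType} {n : nat}.
Local Notation E := 'rV[R]_n.
Variable lam : {measure set (borel E) -> \bar R}.
Hypothesis hlam : is_lebesgue lam.

Lemma partial_zero_off (K : set E) (f : E -> R) a : compact K ->
  (forall y, ~ K y -> f y = 0) -> forall y, ~ K y -> partial a f y = 0.
Proof.
move=> cK f0 y Ky; rewrite -(@partial_cst R n 0 a y).
apply: (@eq_partial _ _ (~` K)) => //.
by apply: closed_openC; apply: compact_closed => //; exact: norm_hausdorff.
Qed.

Lemma Ck_zero_off k (K U : set E) (f : E -> R) : compact K -> K `<=` U ->
  (forall y, ~ K y -> f y = 0) -> Ck k U f -> Ck k setT f.
Proof.
move=> cK KU f0 /CkP H; apply/CkP => y _.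
have [Ky|Ky] := pselect (K y); first exact/H/KU.
apply: (@Ck_near _ _ _ (fun=> 0)); last exact: Ck_cst.
apply: (@open_near _ _ (~` K)) => // [|z /f0//].
by apply: closed_openC; apply: compact_closed => //; exact: norm_hausdorff.
Qed.

Lemma is_derive_line (f : E -> R) (a : 'I_n) (y : E) (t : R) :
  differentiable f (y + t *: delta_mx 0 a) ->
  is_derive t (1 : R) (fun s : R => f (y + s *: delta_mx 0 a))
    (partial a f (y + t *: delta_mx 0 a)).
Proof.
move=> /(@diff_derivable _ _ _ _ _ (delta_mx 0 a)) df.
have Eq : (fun h : R => h^-1 *: (((fun s : R => f (y + s *: delta_mx 0 a)) \o shift t) (h *: 1)
                             - f (y + t *: delta_mx 0 a))) =
       (fun h : R => h^-1 *: ((f \o shift (y + t *: delta_mx 0 a)) (h *: delta_mx 0 a)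
                             - f (y + t *: delta_mx 0 a))).
  apply/funext => h; congr (_ *: (f _ - _)).
  have -> : shift t (h%:A : R) = h + t by rewrite /= /shift /GRing.scale/= mulr1.
  by rewrite scalerDl addrCA.
by split; rewrite /derivable /derive /partial Eq.
Qed.

(* Translation invariance makes the integral of a difference quotient vanish. *)
Lemma integral_partial0 (K : set E) (f : E -> R) a : compact K ->
  (forall y, ~ K y -> f y = 0) -> Ck 1 setT f ->
  lam.-integrable setT (fun y : borel E => (partial a f y)%:E) /\
  (\int[lam]_y (partial a f y)%:E = 0)%E.
Proof.
move=> cK f0 cf.
have cpf : forall y, setT y -> {for y, continuous (partial a f)}.
  by have [_ /(_ a)] := cf; exact.
have cff : forall y, setT y -> {for y, continuous f}.
  by move=> y _; exact: Ck0 cf I.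
have df y : differentiable f y by exact: (Ck_diff cf).
have mf : measurable_fun setT (f : borel E -> R).
  exact: (continuous_on_measurable openT).
have pf0 := partial_zero_off a cK f0.
have [C C0 HC] := compact_bound cK (fun y _ => cpf y I).
have {}HC y : `|partial a f y| <= C.
  by have [/HC//|/pf0 ->] := pselect (K y); rewrite normr0.
have [B B0 HB] := compact_coord_bound cK.
(* Points moved into K by a translation of length at most 1 along a coordinate must stay in Q; the
   rest of the margin 2 absorbs the strict inequality at the left end of a half-open box. *)
pose Q : set E := hbox (\row_i (- B i - 2)) (\row_i (B i + 2)).
have mQ : measurable (Q : set (borel E)) by exact: measurable_hbox.
have Qfin : (lam Q < +oo)%E by rewrite hlam ?ltry// => i; rewrite !mxE; have := B0 i; lra.
pose e : E := delta_mx 0 a.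
have KQ y t : 0 <= t <= 1 -> K (y + t *: e) -> Q y.
  move=> t01 Ky i; rewrite !mxE; have := HB i _ Ky; rewrite !mxE eqxx /=.
  by rewrite ler_norml; case: (i == a); rewrite /= ?mulr1 ?mulr0; lra.
pose u (k : nat) : R := k.+1%:R^-1.
have u01 k : 0 < u k <= 1.
  by rewrite invr_gt0 ltr0n /= invf_le1 ?ler1n ?ltr0n.
pose F k (y : borel E) : R := (u k)^-1 * (f ((y : E) + u k *: e) - f y).
have fi : lam.-integrable setT (fun y : borel E => (f y)%:E).
  apply: (@integrable_zero_off _ _ _ K) => //.
  - by apply: borel_compact => //; exact: norm_hausdorff.
  - by move=> y _ /f0 ->.
  - exact: (integrable_on_compact (@norm_hausdorff _ _) cK (lam_compact hlam cK) openT (@subsetT _ K) cff).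
have fsi k := integrable_shift hlam (u k *: e) fi.
have iF k : lam.-integrable setT (fun y => (F k y)%:E).
  have := integrableZl measurableT (u k)^-1 (integrableB measurableT (fsi k) fi).
  by apply: eq_integrable => // y _; rewrite /F EFinM EFinB.
have intF k : (\int[lam]_y (F k y)%:E = 0)%E.
  under eq_integral do rewrite /F EFinM EFinB.
  rewrite integralZl//; last exact: integrableB.
  rewrite integralB// integral_shift// subee ?mule0//.
  exact: integrable_fin_num.
(* By the mean value theorem each difference quotient is a value of the partial derivative, so C
   times the indicator of Q dominates all of them. *)
have FC k y : `|F k y| <= C.
  have /andP[u0 u1] := u01 k.
  have [|s _ ms] := @MVT_segment R (fun s => f (y + s *: e)) (fun s => partial a f (y + s *: e)) 0 (u k) (ltW u0)
      (fun s _ => is_derive_line (df _)).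
    apply: derivable_within_continuous => s _.
    by have [] := is_derive_line (df (y + s *: e)).
  rewrite /F; move: ms; rewrite scale0r addr0 subr0 => ->.
  by rewrite mulrC mulfK ?gt_eqF.
have F0 k y : ~ Q y -> F k y = 0.
  move=> Qy; rewrite /F !f0 ?subr0 ?mulr0// => Ky; apply: Qy.
    by apply: (KQ _ 0); rewrite ?lexx ?ler01// scale0r addr0.
  by apply: (KQ _ (u k)) => //; have := u01 k; lra.
have Fcvg y : F k y @[k --> \oo] --> partial a f y.
  have /(@diff_derivable _ _ _ _ _ e) dfe := df y.
  have u0 : u k @[k --> \oo] --> (0 : R)^'.
    move=> A A0; have : \forall k \near \oo, u k != 0 -> A (u k) := @cvg_harmonic R _ A0.
    by apply: filterS => k H1; apply: H1; rewrite gt_eqF//; have /andP[] := u01 k.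
  have := cvg_comp _ _ u0 dfe; apply: cvg_trans; apply: near_eq_cvg; near=> k.
  change ((u k)^-1 * (f (u k *: e + (y : E)) - f y) = F k y).
  by rewrite /F [u k *: e + _]addrC.
have gi : lam.-integrable setT (EFin \o (cst C \_ Q)).
  rewrite -restrict_EFin; apply/(integrable_mkcond _ mQ).
  apply: (measurable_bounded_integrable mQ Qfin) => //.
  exists C; split; first exact: num_real.
  by move=> M CM y _ /=; rewrite ger0_norm// ltW.
have [] := @dominated_convergence _ _ _ lam setT measurableT (fun k y => (F k y)%:E)
    (fun y => (partial a f y)%:E) (EFin \o (cst C \_ Q)).
- by move=> k; exact: measurable_int (iF k).
- by apply/measurable_EFinP; exact: (continuous_on_measurable openT).
- by apply: aeW => y _; apply: cvg_EFin; [exact: nearW|exact: Fcvg].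
- exact: gi.
- apply: aeW => y k _ /=; rewrite lee_fin patchE; case: ifPn => [_|]; first exact: FC.
  by rewrite notin_setE => /F0 ->; rewrite normr0.
move=> i1 _ l; split => //.
move/cvg_lim : l => <- //.
by apply/lim_near_cst => //; apply: nearW => k /=; rewrite intF.
Unshelve. all: by end_near. Qed.

(** Although f is controlled only on U, the product f psi is C^1 with compact support on the whole
    space, because psi vanishes off K; the integral of its partial derivative is therefore 0. *)
Lemma integration_by_parts (K U : set E) (f psi : E -> R) a : open U -> compact K ->
  K `<=` U -> Ck 1 U f -> Ck 1 U psi -> (forall y, ~ K y -> psi y = 0) ->
  [/\ lam.-integrable (U : set (borel E)) (fun y : borel E => (f y * partial a psi y)%:E),
      lam.-integrable (U : set (borel E)) (fun y : borel E => (partial a f y * psi y)%:E) &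
      (\int[lam]_(y in (U : set (borel E))) (f y * partial a psi y)%:E =
       - \int[lam]_(y in (U : set (borel E))) (partial a f y * psi y)%:E)%E].
Proof.
move=> oU cK KU cf cpsi psi0.
have hE : hausdorff_space E by exact: norm_hausdorff.
have mU := borel_open oU; have mK := borel_compact hE cK.
have ppsi0 := partial_zero_off a cK psi0.
have int0 (h : E -> R) : Ck 0 U h -> (forall y, ~ K y -> h y = 0) ->
    lam.-integrable (U : set (borel E)) (fun y : borel E => (h y)%:E).
  move=> ch h0; apply: (@integrable_zero_off _ _ _ K) => //.
    by move=> y _ /h0 ->.
  by apply: (@integrable_on_compact _ _ _ _ U) => //; exact: lam_compact.
have i1 : lam.-integrable (U : set (borel E)) (fun y : borel E => (f y * partial a psi y)%:E).
  apply: int0 => [|y /ppsi0 ->]; last by rewrite mulr0.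
  by apply: CkM => //; [exact: CkW|have [_] := cpsi; apply].
have i2 : lam.-integrable (U : set (borel E)) (fun y : borel E => (partial a f y * psi y)%:E).
  apply: int0 => [|y /psi0 ->]; last by rewrite mulr0.
  by apply: CkM => //; [have [_] := cf; apply|exact: CkW].
split => //.
have fpsi0 y : ~ K y -> f y * psi y = 0 by move=> /psi0 ->; rewrite mulr0.
have cfp : Ck 1 setT (fun y => f y * psi y).
  exact: (Ck_zero_off cK KU fpsi0 (CkM oU cf cpsi)).
have [_ I0] := integral_partial0 a cK fpsi0 cfp.
apply: fin_adde_eq0; [exact: integrable_fin_num|exact: integrable_fin_num|].
rewrite -integralD// -[RHS]I0.
rewrite [RHS]integral_mkcond [LHS]integral_mkcond; apply: eq_integral => y _.
rewrite !patchE in_setT; case: ifPn; rewrite ?in_setE ?notin_setE => Uy.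
  rewrite partialM; [|exact: (Ck_diff cf)|exact: (Ck_diff cpsi)].
  by rewrite -EFinD [psi y * _]mulrC.
by rewrite (partial_zero_off a cK fpsi0)// => /KU.
Qed.

End integration_by_parts.

(** * The fundamental lemma of the calculus of variations *)

Section fundamental_lemma.
Context {R : realType} {n : nat}.
Local Notation E := 'rV[R]_n.
Variable lam : {measure set (borel E) -> \bar R}.
Hypothesis hlam : is_lebesgue lam.

Lemma smooth_prod_flat (c d : 'I_n -> R) (j : nat) :
  smooth setT (fun y : E => \prod_a flat j (c a * y 0 a + d a)).
Proof.
move=> k; apply: Ck_prod => [|a _]; first exact: openT.
apply: Ck_flat => [|k']; first exact: openT.
apply: CkD; [exact: openT| |exact: Ck_cst].
apply: CkZ; [exact: openT|exact: smooth_coord].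
Qed.

Lemma smoothM (U : set E) (f h : E -> R) : open U -> smooth U f -> smooth U h ->
  smooth U (fun y => f y * h y).
Proof. by move=> oU sf sh k; exact: CkM. Qed.

Lemma smooth_measurable (f : E -> R) : smooth setT f ->
  measurable_fun setT (f : borel E -> R).
Proof. by move=> /(_ 0%N) cf; exact: (continuous_on_measurable openT). Qed.

(** The two factors of coordinate a are positive exactly when y_a > c_a - r and when y_a < c_a + r,
    so this smooth function lives on the open cube of centre c and half-side r. The affine forms are
    written in the shape that [smooth_prod_flat] expects. *)
Definition cube_bump (c : E) (r : R) (y : E) : R :=
  (\prod_a flat 0 (1 * y 0 a + (r - c 0 a))) * (\prod_a flat 0 ((- 1) * y 0 a + (c 0 a + r))).

Lemma smooth_bump c r : smooth setT (cube_bump c r).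
Proof. by apply: smoothM; [exact: openT|exact: smooth_prod_flat|exact: smooth_prod_flat]. Qed.

Lemma bump_ge0 c r y : 0 <= cube_bump c r y.
Proof. by rewrite mulr_ge0// prodr_ge0// => a _; exact: flat_ge0. Qed.

Lemma prodr_ge0_le1 (I : Type) (s : seq I) (F : I -> R) :
  (forall i, 0 <= F i <= 1) -> 0 <= \prod_(i <- s) F i <= 1.
Proof.
move=> H; elim: s => [|i s /andP[h1 h2]]; first by rewrite big_nil ler01 lexx.
by rewrite big_cons; have /andP[? ?] := H i; rewrite mulr_ge0//= mulr_ile1.
Qed.

Lemma prod_flat01 (f : 'I_n -> R) : 0 <= \prod_i flat 0 (f i) <= 1.
Proof. by apply: prodr_ge0_le1 => i; rewrite flat_ge0 flat0_le1. Qed.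

Lemma bump_le1 c r y : cube_bump c r y <= 1.
Proof. by rewrite mulr_ile1//; apply: (andP (prod_flat01 _)).1 || apply: (andP (prod_flat01 _)).2. Qed.

Lemma bump_gt0 (c : E) r (y : E) : (forall a, `|y 0 a - c 0 a| < r) -> 0 < cube_bump c r y.
Proof.
move=> yc; rewrite mulr_gt0//; apply: prodr_gt0 => a _; apply: flat_gt0;
  by have := yc a; rewrite ltr_norml; lra.
Qed.

Lemma bump_eq0 (c : E) r (y : E) : ~ (forall a, `|y 0 a - c 0 a| <= r) -> cube_bump c r y = 0.
Proof.
move=> /existsNP[a] /negP; rewrite ler_norml negb_and -!ltNge => H.
apply/eqP; rewrite mulf_eq0; apply/orP.
case/orP : H => H; [left|right]; apply/prodf_eq0; exists a => //; rewrite flat_neg//; lra.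
Qed.

Definition ccube (c : E) (r : R) : set E := [set y | forall a, `|y 0 a - c 0 a| <= r].

Lemma compact_ccube c r : compact (ccube c r).
Proof.
rewrite (_ : ccube c r = [set y : E | forall a, `[c 0 a - r, c 0 a + r]%classic (y ord0 a)]).
  apply: (@rV_compact R n (fun a => `[c 0 a - r, c 0 a + r]%classic)) => a.
  exact: segment_compact.
by apply/seteqP; split=> y H a; have := H a; rewrite /= in_itv/= ler_norml; lra.
Qed.

Lemma cvg_prodr (I : Type) (s : seq I) (F : I -> nat -> R) (l : I -> R) :
  (forall i, F i k @[k --> \oo] --> l i) ->
  \prod_(i <- s) F i k @[k --> \oo] --> \prod_(i <- s) l i.
Proof.
move=> H; elim: s => [|i s IH].
  by rewrite big_nil; under eq_fun do rewrite big_nil; exact: cvg_cst.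
by rewrite big_cons; under eq_fun do rewrite big_cons; exact: cvgM.
Qed.

(** The first product tends to the indicator of a < y. In the second, with m = k + 1, the argument
    is m - m^2 (y - b): it tends to infinity for y <= b, endpoint included thanks to the linear
    term, and is eventually negative for y > b because of the quadratic one. *)
Definition hbox_approx (a b : E) (k : nat) (y : E) : R :=
  (\prod_i flat 0 (k.+1%:R * y 0 i + (- (k.+1%:R * a 0 i)))) *
  (\prod_i flat 0 (- (k.+1%:R ^+ 2) * y 0 i + (k.+1%:R ^+ 2 * b 0 i + k.+1%:R))).

Lemma smooth_hbox_approx a b k : smooth setT (hbox_approx a b k).
Proof. by apply: smoothM; [exact: openT|exact: smooth_prod_flat|exact: smooth_prod_flat]. Qed.

Lemma hbox_approx01 a b k y : 0 <= hbox_approx a b k y <= 1.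
Proof.
apply/andP; split.
  by rewrite mulr_ge0//; exact: (andP (prod_flat01 _)).1.
by rewrite mulr_ile1//; apply: (andP (prod_flat01 _)).1 || apply: (andP (prod_flat01 _)).2.
Qed.

Lemma cvg_flat0 (w : nat -> R) : (forall A, \forall k \near \oo, A <= w k) ->
  flat 0 (w k) @[k --> \oo] --> (1 : R).
Proof.
move=> wy; apply/cvgrPdist_le => e e0; near=> k.
have wk : e^-1 <= w k by near: k; exact: wy.
have w0 : 0 < w k by apply: lt_le_trans wk; rewrite invr_gt0.
have we : (w k)^-1 <= e by rewrite -[e]invrK lef_pV2// posrE invr_gt0.
have := flat0_le1 (w k); rewrite /flat w0 expr0 mul1r => H1.
rewrite ger0_norm ?subr_ge0//.
have := expR_ge1Dx (- (w k)^-1); move: we; set u := (w k)^-1; lra.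
Unshelve. all: by end_near. Qed.

Lemma cvg_hbox_approx (a b y : E) :
  hbox_approx a b k y @[k --> \oo] --> (\1_(hbox a b) y : R).
Proof.
have k1 (A : R) : \forall k \near \oo, A <= k.+1%:R.
  near=> k; have : A <= k%:R by near: k; exact: nbhs_infty_ger.
  by move=> /le_trans; apply; rewrite ler_nat.
have -> : (\1_(hbox a b) y : R) =
    (\prod_i ((a 0 i < y 0 i)%R)%:R) * (\prod_i ((y 0 i <= b 0 i)%R)%:R).
  rewrite -big_split/= indicE; have [yab|yab] := pselect (hbox a b y).
    by rewrite mem_set// big1// => i _; have /andP[-> ->] := yab i; rewrite mulr1.
  rewrite memNset//; move/existsNP : yab => [i /negP yab].
  apply/esym/eqP/prodf_eq0; exists i => //; rewrite -natrM mulnb pnatr_eq0.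
  by rewrite eqb0.
apply: cvgM; apply: cvg_prodr => i.
  case: ltP => ya.
    apply: cvg_flat0 => A; near=> k; rewrite -mulrBr -ler_pdivrMr ?subr_gt0//.
    by near: k; exact: k1.
  rewrite (_ : (fun k => _) = (fun=> 0)); first exact: cvg_cst.
  by apply/funext => k; rewrite flat_neg// -mulrBr mulr_ge0_le0// subr_le0.
case: leP => yb.
  apply: cvg_flat0 => A; near=> k.
  have : A <= k.+1%:R by near: k; exact: k1.
  have : 0 <= k.+1%:R ^+ 2 * (b 0 i - y 0 i) by rewrite mulr_ge0// subr_ge0.
  set m := k.+1%:R; lra.
have H : \forall k \near \oo, flat 0 (- (k.+1%:R ^+ 2) * y 0 i + (k.+1%:R ^+ 2 * b 0 i + k.+1%:R)) = 0.
  near=> k; rewrite flat_neg//.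
  have : (y 0 i - b 0 i)^-1 <= k.+1%:R by near: k; exact: k1.
  rewrite -[X in X <= _]mul1r ler_pdivrMr ?subr_gt0// => H.
  have : k.+1%:R * 1 <= k.+1%:R * (k.+1%:R * (y 0 i - b 0 i)) by rewrite ler_wpM2l.
  set m := k.+1%:R; rewrite mulr1 expr2 => H2; rewrite -subr_ge0.
  rewrite [leRHS](_ : _ = m * (m * (y 0 i - b 0 i)) - m); last by ring.
  by rewrite subr_ge0.
exact: cvg_near_cst.
Unshelve. all: by end_near. Qed.

Lemma small_integral (g : E -> R) (h : nat -> E -> R) (e : R) :
  lam.-integrable setT (fun y : borel E => (g y)%:E) -> (forall y, 0 <= g y) ->
  (forall k, measurable_fun setT (h k : borel E -> R)) ->
  (forall k y, `|h k y| <= 1) -> (forall y, h k y @[k --> \oo] --> (0 : R)) -> 0 < e ->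
  exists k, (\int[lam]_y (`|h k y| * g y)%:E < e%:E)%E.
Proof.
move=> gi g0 mh h1 hcvg e0.
have mg : measurable_fun setT (g : borel E -> R).
  by apply/measurable_EFinP; exact: measurable_int gi.
have mhk k : measurable_fun setT (fun y : borel E => `|h k y| : R).
  exact: (measurableT_comp (@normr_measurable R setT) (mh k)).
have := @dominated_cvg _ _ _ lam setT measurableT
  (fun k y => (`|h k y| * g y)%:E) (cst 0%E) (fun y => (g y)%:E).
move=> /(_ (fun k => _)); move=> H.
have {}H := H (fun k => (measurable_EFinP _ _).2 (measurable_funM (mhk k) mg)).
have {H} : (\int[lam]_x (`|h k x| * g x)%:E)%E @[k --> \oo] --> (\int[lam]_x (cst 0%E) x)%E.
  apply: H => //.
  - move=> y _; apply: cvg_EFin; first exact: nearW.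
    rewrite -[X in _ --> X](mul0r (g y)); apply: cvgMl.
    by rewrite -[X in _ --> X](@normr0 _ R); apply: cvg_norm; exact: hcvg.
  - move=> k y _ /=; rewrite lee_fin ger0_norm ?mulr_ge0//.
    by rewrite ler_piMl.
rewrite integral_cst// mul0e => H.
have N : nbhs (0%:E : \bar R) [set x | (x < e%:E)%E].
  exact: (@nbhs_open_ereal_lt R 0 (fun=> e)).
have [k _ Hk] := H _ N.
by exists k; apply: (Hk k) => /=.
Qed.

Definition smooth01 (eta : E -> R) := smooth setT eta /\ forall y, 0 <= eta y <= 1.

(* Monotone class argument: half-open boxes generate the Borel sets. *)
Lemma smooth_indic_approx (g : E -> R) (A : set (borel E)) :
  lam.-integrable setT (fun y : borel E => (g y)%:E) -> (forall y, 0 <= g y) ->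
  measurable A -> forall e, 0 < e -> exists2 eta, smooth01 eta &
  (\int[lam]_y (`|\1_A y - eta y| * g y)%:E < e%:E)%E.
Proof.
move=> gi g0; rewrite borel_hbox => mA.
have mg : measurable_fun setT (g : borel E -> R).
  by apply/measurable_EFinP; exact: measurable_int gi.
have mh (A' : set (borel E)) (eta : E -> R) : measurable A' -> smooth01 eta ->
    measurable_fun setT (fun y : borel E => \1_A' y - eta y : R).
  move=> mA' [seta _]; apply: measurable_funB; first exact: measurable_indic.
  exact: smooth_measurable.
have mi (w : E -> R) : measurable_fun setT (w : borel E -> R) ->
    measurable_fun setT (fun y : borel E => (`|w y| * g y)%:E).
  move=> mw; apply/measurable_EFinP; apply: measurable_funM => //.
  exact: (measurableT_comp (@normr_measurable R setT) mw).
pose H := [set A : set (borel E) | measurable A /\ forall e, 0 < e ->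
  exists2 eta, smooth01 eta & (\int[lam]_y (`|\1_A y - eta y| * g y)%:E < e%:E)%E].
suff : H A by case.
move: A mA; apply: (@lambda_system_subset _ _ hbox_setI_closed setT H).
- split.
  + by [].
  + split; first exact: measurableT.
    move=> e e0; exists (fun=> 1).
      by split=> [k|y]; [exact: Ck_cst|rewrite ler01 lexx].
    rewrite integral0_eq ?lte_fin// => y _.
    by rewrite indicT subrr normr0 mul0r.
  + move=> A B BA [mA HA] [mB HB]; split; first exact: measurableD.
    move=> e e0; have e20 : 0 < e / 2 by rewrite divr_gt0.
    have [eA sA iA] := HA _ e20; have [eB sB iB] := HB _ e20.
    (* All values lie in [0, 1], so eta_A (1 - eta_B) approximates the indicator of the difference
       with an error at most the sum of the two given errors. *)
    have sD : smooth01 (fun y => eA y * (1 + (- 1) * eB y)).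
      split=> [k|y].
        apply: CkM; [exact: openT|exact: sA.1|].
        apply: CkD; [exact: openT|exact: Ck_cst|].
        by apply: CkZ; [exact: openT|exact: sB.1].
      have /andP[a0 a1] := sA.2 y; have /andP[b0 b1] := sB.2 y.
      by rewrite mulN1r mulr_ge0 ?subr_ge0//= mulr_ile1 ?subr_ge0// gerBl.
    exists (fun y => eA y * (1 + (- 1) * eB y)) => //.
    apply: (@le_lt_trans _ _ (\int[lam]_y ((`|\1_A y - eA y| * g y)%:E + (`|\1_B y - eB y| * g y)%:E))%E).
      apply: ge0_le_integral => //.
      * by move=> y _; rewrite lee_fin mulr_ge0.
      * by apply: mi; apply: mh => //; exact: measurableD.
      * by apply: emeasurable_funD; apply: mi; exact: mh.
      * move=> y _; rewrite -EFinD lee_fin -mulrDl ler_wpM2r//.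
        have /andP[a0 a1] := sA.2 y; have /andP[b0 b1] := sB.2 y.
        have -> : \1_(A `\` B) y = \1_A y * (1 - \1_B y) :> R.
          rewrite !indicE in_setD.
          by case: (y \in A); case: (y \in B); rewrite /= ?mulr1n ?mulr0n; ring.
        have i01 : 0 <= (\1_B y : R) <= 1.
          by rewrite indicE; case: (y \in B); rewrite /= ?lexx ?ler01.
        rewrite (_ : _ - _ = (\1_A y - eA y) * (1 - \1_B y) + eA y * (eB y - \1_B y)); last by ring.
        apply: le_trans (ler_normD _ _) _; rewrite !normrM; apply: lerD.
          by rewrite ler_piMr// ler_norml; lra.
        by rewrite [X in _ * X]distrC ler_piMl// ger0_norm.
    rewrite ge0_integralD//; last 4 first.
    * by move=> y _; rewrite lee_fin mulr_ge0.
    * by apply: mi; exact: mh.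
    * by move=> y _; rewrite lee_fin mulr_ge0.
    * by apply: mi; exact: mh.
    by rewrite [e]splitr EFinD lteD.
  + move=> F0 ndF HF0; pose F : nat -> set (borel E) := F0.
    have HF k : H (F k) := HF0 k.
    change (H (\bigcup_k F k)).
    have mF k : measurable (F k) by have [] := HF k.
    have mU : measurable (\bigcup_k F k) by exact: bigcup_measurable.
    split => // e e0; have e20 : 0 < e / 2 by rewrite divr_gt0.
    have mdiff k : measurable_fun setT (fun y : borel E => \1_(\bigcup_k F k) y - \1_(F k) y : R).
      by apply: measurable_funB; exact: measurable_indic.
    have d1 k y : `|\1_(\bigcup_k F k) y - \1_(F k) y : R| <= 1.
      rewrite !indicE; case: (y \in _); case: (y \in _);
        by rewrite /= ?subrr ?subr0 ?sub0r ?normrN ?normr0 ?normr1 ?ler01 ?lexx.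
    have dc y : (\1_(\bigcup_k F k) y - \1_(F k) y : R) @[k --> \oo] --> (0 : R).
      have [[j _ Fjy]|yF] := pselect ((\bigcup_k F k) y); last first.
        rewrite (_ : (fun k => _) = (fun=> 0)); first exact: cvg_cst.
        apply/funext => k; rewrite !indicE !memNset ?subrr//.
        by move=> Fky; apply: yF; exists k.
      apply: cvg_near_cst; exists j => // k /= jk; rewrite !indicE !mem_set ?subrr//; last by exists j.
      by have /subsetPset := ndF _ _ jk; exact.
    (* The indicators converge pointwise along the increasing union, so some F k already misses a
       part of weight below e / 2. *)
    have [k ik] := small_integral gi g0 mdiff d1 dc e20.
    have [eF sF iF] := (HF k).2 _ e20.
    exists eF => //.
    apply: (@le_lt_trans _ _ (\int[lam]_y ((`|\1_(\bigcup_k F k) y - \1_(F k) y| * g y)%:E + (`|\1_(F k) y - eF y| * g y)%:E))%E).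
      apply: ge0_le_integral => //.
      * by move=> y _; rewrite lee_fin mulr_ge0.
      * by apply: mi; exact: mh.
      * apply: emeasurable_funD; apply: mi; last exact: mh.
        by apply: measurable_funB; exact: measurable_indic.
      * move=> y _; rewrite -EFinD lee_fin -mulrDl ler_wpM2r//.
        by apply: le_trans (ler_normD _ _); rewrite addrA subrK.
    rewrite ge0_integralD//; last 4 first.
    * by move=> y _; rewrite lee_fin mulr_ge0.
    * by apply: mi; apply: measurable_funB; exact: measurable_indic.
    * by move=> y _; rewrite lee_fin mulr_ge0.
    * by apply: mi; exact: mh.
    by rewrite [e]splitr EFinD lteD.
- move=> _ [[a b] _ <-] /=; split; first exact: measurable_hbox.
  move=> e e0.
  have sk k : smooth01 (hbox_approx a b k).
    by split; [exact: smooth_hbox_approx|exact: hbox_approx01].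
  have d1 k y : `|\1_(hbox a b) y - hbox_approx a b k y : R| <= 1.
    have /andP[] := hbox_approx01 a b k y; rewrite indicE ler_norml.
    by case: (y \in _) => /=; lra.
  have dc y : (\1_(hbox a b) y - hbox_approx a b k y : R) @[k --> \oo] --> (0 : R).
    rewrite -[X in _ --> X](subrr (\1_(hbox a b) y)); apply: cvgB.
      exact: cvg_cst.
    exact: cvg_hbox_approx.
  have [k ik] := small_integral gi g0 (fun k => mh _ _ (measurable_hbox a b) (sk k)) d1 dc e0.
  by exists (hbox_approx a b k).
- by [].
Qed.

(** On a cube with cutoff chi, the test functions are chi times smooth approximations of the
    indicator of A = {f < 0}. In the limit the integral of f chi over A is nonnegative although its
    integrand is nonpositive, so A is negligible where chi > 0. Countably many rational cubes cover
    U. *)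
Lemma ae_ge0_of_test (U : set E) (f : E -> R) : open U ->
  (forall K, compact K -> K `<=` U ->
     lam.-integrable (K : set (borel E)) (fun y : borel E => (f y)%:E)) ->
  (forall psi, rV_test U psi -> (forall y, 0 <= psi y) ->
     (0 <= \int[lam]_(y in (U : set (borel E))) (f y * psi y)%:E)%E) ->
  {ae lam, forall y : borel E, U y -> 0 <= f y}.
Proof.
move=> oU fi ftest.
have hE : hausdorff_space E by exact: norm_hausdorff.
have mU := borel_open oU.
have cubes c r : ccube c r `<=` U ->
    lam.-negligible [set y : borel E | (forall a, `|(y : E) 0 a - c 0 a| < r) /\ f y < 0].
  move=> KU; pose K : set (borel E) := ccube c r; have cK : compact K by exact: compact_ccube.
  have mK : measurable K by exact: borel_compact.
  have fK := fi K cK KU.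
  have mfK : measurable_fun K (f : borel E -> R).
    by apply/measurable_EFinP; exact: measurable_int fK.
  pose chi := cube_bump c r.
  have schi : smooth setT chi by exact: smooth_bump.
  have mchi : measurable_fun K (chi : borel E -> R).
    by apply: measurable_funTS; exact: smooth_measurable.
  have chi0 y : 0 <= chi y by exact: bump_ge0.
  have chiK y : ~ K y -> chi y = 0 by exact: bump_eq0.
  have chi1 y : chi y <= 1 by exact: bump_le1.
  have chi_gt0 (y : E) : (forall a, `|y 0 a - c 0 a| < r) -> 0 < chi y by exact: bump_gt0.
  clearbody chi.
  have mulK (w : E -> R) : measurable_fun K (w : borel E -> R) ->
      (forall y, `|w y| <= 1) ->
      lam.-integrable K (fun y : borel E => (f y * chi y * w y)%:E).
    move=> mw w1; apply: le_integrable fK => //.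
      by apply/measurable_EFinP; do 2 apply: measurable_funM => //.
    move=> y Ky; rewrite /= lee_fin !normrM -mulrA ler_piMr// mulr_ile1//.
    by rewrite ger0_norm.
  (* The weight in which the indicator of A is approximated: with it, the approximation error bounds
     the change in the tested integral. *)
  pose g y := if `[< K y >] then `|f y * chi y| else 0.
  have g0 y : 0 <= g y by rewrite /g; case: ifP.
  have gK y : K y -> g y = `|f y * chi y| by move=> Ky; rewrite /g asboolT.
  have gi : lam.-integrable setT (fun y : borel E => (g y)%:E).
    apply: (@integrable_zero_off _ _ _ K) => //.
      by move=> y _ Ky; rewrite /g asboolF.
    have n11 : `|1 : R| <= 1 by rewrite normr1.
    have /integrable_abse := mulK (fun=> 1) (measurable_cst _) (fun _ => n11).
    by apply: eq_integrable => // y /[!inE] Ky; rewrite gK//= mulr1.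
  pose A : set (borel E) := K `&` [set y : borel E | f y < 0].
  have mA : measurable A.
    rewrite /A (_ : [set y : borel E | f y < 0] = f @^-1` `]-oo, 0[); first exact: mfK.
    by apply/seteqP; split=> y; rewrite /= in_itv.
  have mIA D : measurable_fun D (\1_A : borel E -> R) by exact: measurable_indic.
  have IA1 y : `|\1_A y : R| <= 1.
    by rewrite indicE; case: (y \in A); rewrite ?normr1 ?normr0.
  have iA := mulK (\1_A) (mIA _) IA1.
  have pos : (0 <= \int[lam]_(y in K) (f y * chi y * \1_A y)%:E)%E.
    apply/lee_addgt0Pr => e e0.
    have [eta [seta eta01] ieta] := smooth_indic_approx gi g0 mA e0.
    have eta1 y : `|eta y| <= 1 by have := eta01 y; rewrite ler_norml; lra.
    have meta : measurable_fun K (eta : borel E -> R).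
      by apply: measurable_funTS; exact: smooth_measurable.
    have ie := mulK eta meta eta1.
    have test : rV_test U (fun y => chi y * eta y).
      split=> [k|].
        by apply: (@Ck_sub _ _ _ _ setT) => //; apply: smoothM => //; exact: openT.
      by exists K; split => // y /chiK ->; rewrite mul0r.
    have := ftest _ test (fun y => mulr_ge0 (chi0 y) _).
    have -> : (\int[lam]_(y in (U : set (borel E))) (f y * (chi y * eta y))%:E =
        \int[lam]_(y in K) (f y * chi y * eta y)%:E)%E.
      rewrite (@integral_zero_off _ _ _ K)//; last by move=> y _ /chiK ->; rewrite mul0r mulr0.
      by apply: eq_integral => y _; rewrite mulrA.
    move=> /(_ (fun y => (andP (eta01 y)).1)) /le_trans; apply.
    rewrite -leeBlDl ?integrable_fin_num// -integralB//.
    have mw : measurable_fun setT (fun y : borel E => \1_A y - eta y : R).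
      apply: measurable_funB; [exact: mIA|exact: smooth_measurable].
    have w1 y : `|\1_A y - eta y| <= 1.
      by have := eta01 y; rewrite indicE ler_norml; case: (y \in A) => /=; lra.
    have iw := integrable_abse (mulK _ (measurable_funTS mw) w1).
    apply: (@le_trans _ _ (\int[lam]_(y in K) `|(f y * chi y * (\1_A y - eta y))%:E|)%E).
      apply: le_integral => //; first exact: integrableB.
      move=> y /[!inE] Ky; rewrite -EFinB lee_fin -mulrBr (le_trans (ler_norm _))//.
      by rewrite normrM [X in _ <= X]normrM distrC.
    apply: (@le_trans _ _ (\int[lam]_y (`|\1_A y - eta y| * g y)%:E)%E); last exact: ltW.
    have -> : (\int[lam]_(y in K) `|(f y * chi y * (\1_A y - eta y))%:E| =
        \int[lam]_(y in K) (`|\1_A y - eta y| * g y)%:E)%E.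
      apply: eq_integral => y /[!inE] Ky; rewrite gK//= normrM; congr (_ %:E); exact: mulrC.
    apply: ge0_subset_integral => //.
      apply/measurable_EFinP; apply: measurable_funM.
        exact: (measurableT_comp (@normr_measurable R setT) mw).
      by apply/measurable_EFinP; exact: measurable_int gi.
    by move=> y _; rewrite lee_fin mulr_ge0.
  have neg : (\int[lam]_(y in K) `|(f y * chi y * \1_A y)%:E| = 0)%E.
    have EI : (\int[lam]_(y in K) `|(f y * chi y * \1_A y)%:E| =
        \int[lam]_(y in K) ((-1)%:E * (f y * chi y * \1_A y)%:E))%E.
      apply: eq_integral => y /[!inE] Ky; rewrite /= -EFinM; congr (_ %:E).
      rewrite mulN1r indicE; case: (boolP (y \in A)) => [/set_mem [_ /= fy0]|_].
        by rewrite mulr1 ler0_norm// mulr_le0_ge0// ltW.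
      by rewrite mulr0 normr0 oppr0.
    apply/eqP; rewrite eq_le; apply/andP; split.
      by rewrite EI integralZl// EFinN mulN1e oppe_le0.
    by apply: integral_ge0 => y _; exact: abse_ge0.
  have : ae_eq lam K (fun y : borel E => (f y * chi y * \1_A y)%:E) (cst 0%E).
    by apply/ae_eq_integral_abs => //; exact: measurable_int iA.
  apply: negligibleS => y /= [yc fy0] H.
  have Ky : K y by move=> a; exact: ltW.
  have := H Ky; rewrite indicE mem_set// mulr1 => -[] /eqP.
  by rewrite mulf_eq0 (lt_eqF fy0) (gt_eqF (chi_gt0 _ yc)).
(* [unpickle] enumerates the pairs made of a rational centre and a size; cubes not contained in U
   contribute the empty set. *)
pose N k : set (borel E) := if unpickle k is Some qk then
    (let c := rat_center qk.1 in let r := qk.2.+1%:R^-1 in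
    if `[< ccube c r `<=` U >] then [set y : borel E | (forall a, `|(y : E) 0 a - c 0 a| < r) /\ f y < 0] else set0)
   else set0.
have : lam.-negligible (\bigcup_k N k).
  apply: negligible_bigcup => k; rewrite /N; case: unpickle => [[q j]|]; last exact: negligible_set0.
  by case: asboolP => [H|_]; [exact: cubes|exact: negligible_set0].
apply: negligibleS => y /= /not_implyP[Uy /negP]; rewrite -ltNge => fy.
have [q [k [yq qU]]] := rat_cube oU Uy.
exists (pickle (q, k)) => //; rewrite /N pickleK /=.
by rewrite asboolT.
Qed.

End fundamental_lemma.

(** * Gradients on a Riemannian manifold *)

Section positive_definite.
Context {R : realType} {n : nat}.
Implicit Types (A : 'M[R]_n) (w z : 'rV[R]_n).

Definition posdef A := forall w, w != 0 -> 0 < (w *m A *m w^T) 0 0.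

Lemma posdef_det_neq0 A : posdef A -> \det A != 0.
Proof.
move=> pA; apply/negP => /det0P[w w0 wA].
by have := pA w w0; rewrite wA mul0mx mxE ltxx.
Qed.

Lemma posdef_unit A : posdef A -> A \in unitmx.
Proof. by move=> /posdef_det_neq0; rewrite unitmxE unitfE. Qed.

Lemma posdef1 : posdef (1%:M : 'M[R]_n).
Proof.
move=> w w0; rewrite mulmx1 mxE.
have [j wj] : exists j, w 0 j != 0.
  apply/existsP; apply: contra_neqT w0 => /existsPn wj.
  by apply/rowP => j; have := wj j; rewrite negbK mxE => /eqP.
rewrite (bigD1 j)//= mxE ltr_wpDr ?sumr_ge0//.
  by move=> k _; rewrite mxE -expr2 sqr_ge0.
by rewrite -expr2 exprn_even_gt0.
Qed.

Lemma posdef_convex A (t : R) : posdef A -> 0 <= t <= 1 ->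
  posdef ((1 - t) *: 1%:M + t *: A).
Proof.
move=> pA t01 w w0; rewrite mulmxDr mulmxDl -!scalemxAr -!scalemxAl !mxE.
have := posdef1 w0; have := pA w w0; rewrite !mxE => a b.
have [t0|t0] := eqVneq t 0; first by rewrite t0 subr0 mul1r mul0r addr0.
by rewrite ltr_wpDl ?mulr_ge0 ?mulr_gt0// ?lt0r ?t0; lra.
Qed.

Lemma continuous_det (B : R -> 'M[R]_n) : (forall i j, continuous (fun t => B t i j)) ->
  continuous (fun t => \det (B t)).
Proof.
move=> cB t.
have cprod (s : seq 'I_n) (F : 'I_n -> R -> R) : (forall i, {for t, continuous (F i)}) ->
    {for t, continuous (fun t => \prod_(i <- s) F i t)}.
  move=> cF; elim: s => [|i s IH].
    rewrite (_ : (fun t => _) = cst 1); first exact: cst_continuous.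
    by apply/funext => u; rewrite big_nil.
  rewrite (_ : (fun t => _) = (fun t => F i t * \prod_(j <- s) F j t)).
    exact: (@continuousM _ _ (F i) (fun t => \prod_(j <- s) F j t)).
  by apply/funext => u; rewrite big_cons.
have csum (I : Type) (s : seq I) (F : I -> R -> R) : (forall i, {for t, continuous (F i)}) ->
    {for t, continuous (fun t => \sum_(i <- s) F i t)}.
  move=> cF; elim: s => [|i s IH].
    rewrite (_ : (fun t => _) = cst 0); first exact: cst_continuous.
    by apply/funext => u; rewrite big_nil.
  rewrite (_ : (fun t => _) = (fun t => F i t + \sum_(j <- s) F j t)).
    exact: (@continuousD _ _ _ (F i) (fun t => \sum_(j <- s) F j t)).
  by apply/funext => u; rewrite big_cons.
apply: csum => s.
apply: (@continuousM _ _ (fun=> (-1) ^+ s) (fun t => \prod_i B t i (s i))).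
  exact: cst_continuous.
by apply: cprod => i; exact: cB.
Qed.

(* The determinant does not vanish on the segment from the identity to A. *)
Lemma posdef_det_gt0 A : posdef A -> 0 < \det A.
Proof.
move=> pA; rewrite ltNge; apply/negP => dA.
pose f t := \det ((1 - t) *: 1%:M + t *: A).
have f0 : f 0 = 1 by rewrite /f subr0 scale1r scale0r addr0 det1.
have f1 : f 1 = \det A by rewrite /f subrr scale1r scale0r add0r.
have cf : continuous f.
  apply: continuous_det => i j.
  rewrite (_ : (fun t => _) = (fun t : R => (1 - t) * (i == j)%:R + t * A i j)); last first.
    by apply/funext => t; rewrite !mxE.
  move=> t; apply: (@continuousD _ _ _ (fun t : R => (1 - t) * (i == j)%:R) (fun t : R => t * A i j)).
    apply: (@continuousM _ _ (fun t : R => 1 - t) (fun=> (i == j)%:R)); last exact: cst_continuous.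
    apply: (@continuousB _ _ _ (fun=> 1 : R) id); [exact: cst_continuous|exact: id].
  by apply: (@continuousM _ _ id (fun=> A i j)); [exact: id|exact: cst_continuous].
have [|c c01 fc] := @IVT R f 0 1 0 ler01 (continuous_subspaceT cf).
  by rewrite f0 f1 ge_min dA orbT le_max ler01.
have := posdef_det_neq0 (posdef_convex pA c01).
by rewrite -/(f c) fc eqxx.
Qed.

Lemma posdef_cauchy_schwarz A w z : posdef A -> A^T = A ->
  ((w *m A *m z^T) 0 0) ^+ 2 <= (w *m A *m w^T) 0 0 * (z *m A *m z^T) 0 0.
Proof.
move=> pA sA.
have sym : (z *m A *m w^T) 0 0 = (w *m A *m z^T) 0 0.
  rewrite -[in LHS](trmxK (z *m A *m w^T)) mxE trmx_mul trmxK trmx_mul sA.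
  by rewrite mulmxA.
have psd (v : 'rV[R]_n) : 0 <= (v *m A *m v^T) 0 0.
  by have [->|/pA/ltW//] := eqVneq v 0; rewrite !mul0mx mxE.
set a := (w *m A *m w^T) 0 0; set b := (w *m A *m z^T) 0 0; set c := (z *m A *m z^T) 0 0.
have [z0|z0] := eqVneq z 0.
  have -> : b = 0 by rewrite /b z0 trmx0 mulmx0 mxE.
  by rewrite expr0n/=; exact: mulr_ge0 (psd _) (psd _).
have c0 : 0 < c by exact: pA.
(* The quadratic form at c w - b z equals c (c a - b^2), and c > 0 can be divided out. *)
have := psd (c *: w - b *: z).
have -> : ((c *: w - b *: z) *m A *m (c *: w - b *: z)^T) 0 0 = c * (c * a - b ^+ 2).
  have T : (c *: w - b *: z)^T = c *: w^T - b *: z^T by rewrite linearB/= !linearZ.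
  have B11 : (w *m A *m w^T) 0 0 = a by [].
  have B12 : (w *m A *m z^T) 0 0 = b by [].
  have B22 : (z *m A *m z^T) 0 0 = c by [].
  move: B11 B12 B22 sym; rewrite T !(mulmxBl, mulmxBr) -!scalemxAl -!scalemxAr -?scalemxAl.
  move: (w *m A *m w^T) (w *m A *m z^T) (z *m A *m z^T) (z *m A *m w^T) => X1 X2 X3 X4.
  rewrite !mxE => -> -> -> ->; ring.
by rewrite pmulr_rge0// subr_ge0 mulrC.
Qed.

End positive_definite.

(** * C^1 regularity of powers, determinants and inverse matrices *)

Section C1_calculus.
Context {R : realType} {n : nat}.
Local Notation E := 'rV[R]_n.
Implicit Types (U : set E).

Lemma continuous_powR_pos (r t : R) : 0 < t -> {for t, continuous (fun s : R => s `^ r)}.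
Proof.
move=> t0; apply/differentiable_continuous/derivable1_diffP.
by have [] := @is_derive1_powR R r t t0.
Qed.

Lemma C1_powR (r : R) U (f : E -> R) : open U -> (forall y, U y -> 0 < f y) ->
  Ck 1 U f -> Ck 1 U (fun z => f z `^ r).
Proof.
move=> oU f0; apply: (@C1_comp1 _ _ (fun s => s `^ r) (fun s => r * s `^ (r - 1))) => // y Uy.
  exact: is_derive1_powR (f0 _ Uy).
apply: (@continuousM _ _ (fun=> r) (fun s => s `^ (r - 1))); first exact: cst_continuous.
exact: continuous_powR_pos (f0 _ Uy).
Qed.

Lemma Ck_det k U m (B : E -> 'M[R]_m) : open U -> (forall i j, Ck k U (fun y => B y i j)) ->
  Ck k U (fun y => \det (B y)).
Proof.
move=> oU cB; apply: Ck_sum => // s _; apply: CkZ => //.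
by apply: Ck_prod => // i _.
Qed.

(** Cofactor formula. The reciprocal of the determinant is written as the real power -1 so that
    [C1_powR] applies, whence the positivity asked of the determinant. *)
Lemma C1_invmx U m (B : E -> 'M[R]_m) : open U -> (forall i j, Ck 1 U (fun y => B y i j)) ->
  (forall y, U y -> 0 < \det (B y)) -> forall i j, Ck 1 U (fun y => invmx (B y) i j).
Proof.
move=> oU cB dB i j.
have H : Ck 1 U (fun y => \det (B y) `^ (-1) * ((-1) ^+ (j + i) * \det (row' j (col' i (B y))))).
  apply: CkM => //; first by apply: C1_powR => //; exact: Ck_det.
  apply: CkZ => //; apply: Ck_det => // a b.
  by under eq_fun do rewrite !mxE; exact: cB.
apply: (Ck_eq oU _ H) => y Uy; have d0 := dB y Uy.
by rewrite /invmx unitmxE unitfE gt_eqF// !mxE powR_inv1 ?ltW.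
Qed.

End C1_calculus.

(** * Charts, differentials and gradients *)

Section geometry.
Context {R : realType} {n : nat} {M : ptopologicalType}.
Variable X : smooth_manifold R n M.
Variable g : riemannian_metric X.
Variable Om : set M.
Hypothesis oOm : open Om.
Local Notation E := 'rV[R]_n.
Implicit Types (i j : idx X) (x : M) (y : E) (u phi : M -> R).

Definition chart_image i : set E := coord i @` (dom i `&` Om).
Local Notation U := chart_image.

Definition rep i u : E -> R := fun y => u (param i y).

Lemma chart_imageP i y : U i y ->
  [/\ dom i (param i y), Om (param i y) & coord i (param i y) = y].
Proof. by move=> [x [dx Ox] <-]; rewrite coordK. Qed.

Lemma chart_image_coord i x : dom i x -> Om x -> U i (coord i x).
Proof. by move=> dx Ox; exists x. Qed.

Lemma chart_imageE i : U i = coord i @` dom i `&` param i @^-1` Om.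
Proof.
apply/seteqP; split=> [_ [x [dx Ox] <-]|_ [[x dx <-]]] /=.
  by rewrite coordK//; split => //; exists x.
by rewrite coordK// => Ox; exists x.
Qed.

Lemma open_chart_image i : open (U i).
Proof.
rewrite chart_imageE; apply: open_preimageI => //; first exact: open_coord_dom.
exact: param_continuous.
Qed.

Lemma open_domI i : open (dom i `&` Om).
Proof. by apply: openI => //; exact: open_dom. Qed.

Lemma param_cont i y : U i y -> {for y, continuous (param i)}.
Proof. by move=> [x [dx _] <-]; apply: param_continuous; exists x. Qed.

Lemma near_coord i j x : dom i x -> dom j x -> Om x ->
  \forall z \near coord i x, U i z /\ dom j (param i z).
Proof.
move=> dx djx Ox.
have Ux := chart_image_coord dx Ox.
apply: filterI; first exact: open_nbhs_nbhs (conj (@open_chart_image i) Ux).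
apply: (param_cont Ux); apply: open_nbhs_nbhs; split; first exact: open_dom.
by rewrite coordK.
Qed.

Lemma continuous_of_rep u i x : dom i x -> {for coord i x, continuous (rep i u)} ->
  {for x, continuous u}.
Proof.
move=> dx cu.
have H : {for x, continuous (rep i u \o coord i)}.
  by apply: continuous_comp => //; exact: coord_continuous.
rewrite /prop_for /continuous_at /= {2}/rep coordK// in H.
apply: cvg_trans H; apply: (@near_eq_cvg _ _ (nbhs x)).
have := open_nbhs_nbhs (conj (open_dom i) dx).
by apply: filterS => z dz; rewrite /= /rep coordK.
Qed.

Lemma Ck_on_continuous k u x : Ck_on X k Om u -> Om x -> {for x, continuous u}.
Proof.
move=> cu Ox; have dx := dom_chart_at X x; apply: (continuous_of_rep dx).
exact: Ck0 (cu _) (chart_image_coord dx Ox).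
Qed.

Lemma Ck_onM k u phi : Ck_on X k Om u -> Ck_on X k Om phi ->
  Ck_on X k Om (fun x => u x * phi x).
Proof. by move=> cu cp i; apply: CkM => //; exact: open_chart_image. Qed.

Lemma Ck_onD k u phi : Ck_on X k Om u -> Ck_on X k Om phi ->
  Ck_on X k Om (fun x => u x + phi x).
Proof. by move=> cu cp i; apply: CkD => //; exact: open_chart_image. Qed.

Lemma Ck_onW k u : Ck_on X k.+1 Om u -> Ck_on X k Om u.
Proof. by move=> cu i; exact: CkW. Qed.

Lemma C1_on_comp1 (h dh : R -> R) u :
  (forall x, Om x -> is_derive (u x) 1 h (dh (u x))) ->
  (forall x, Om x -> {for u x, continuous dh}) ->
  Ck_on X 1 Om u -> Ck_on X 1 Om (fun x => h (u x)).
Proof.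
move=> hd cdh cu i; apply: (@C1_comp1 _ _ h dh _ (rep i u)) => //.
- exact: open_chart_image.
- by move=> y /chart_imageP[_ Oy _]; exact: hd.
- by move=> y /chart_imageP[_ Oy _]; exact: cdh.
Qed.

Lemma eq_Ck_on k u phi : (forall x, Om x -> u x = phi x) -> Ck_on X k Om u -> Ck_on X k Om phi.
Proof.
move=> e cu i; apply: (Ck_eq (@open_chart_image i) _ (cu i)) => y /chart_imageP[_ Oy _].
exact: e.
Qed.

Lemma transition_coord i j x a b : dom i x -> dom j x -> Om x ->
  transition_jacobian i j x a b = partial a (fun y => coord j (param i y) 0 b) (coord i x).
Proof.
move=> dx djx Ox; rewrite /transition_jacobian.
have dT : differentiable (fun y => coord j (param i y)) (coord i x).
  apply: differentiable_rV => c.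
  apply: (Ck_diff (transition_smooth i j c 1)).
  by exists x.
have := deriveEjacobian (delta_mx 0 a) dT; rewrite -rowE.
move/(congr1 (fun w : 'rV[R]_n => w 0 b)); rewrite mxE => <-.
by rewrite derive_mx ?mxE//; exact: diff_derivable.
Qed.

Lemma differential_transition i j x u : Ck_on X 1 Om u -> dom i x -> dom j x -> Om x ->
  differential u i x = differential u j x *m (transition_jacobian i j x)^T.
Proof.
move=> cu dx djx Ox; apply/rowP => a; rewrite !mxE.
transitivity (partial a (fun y => rep j u (coord j (param i y))) (coord i x)).
  apply: near_eq_derive; have := near_coord dx djx Ox.
  by apply: filterS => z [_ dz]; rewrite /rep coordK.
rewrite partial_compV; last 2 first.
- by move=> c; apply: (Ck_diff (transition_smooth i j c 1)); exists x.
- by rewrite coordK//; apply: (Ck_diff (cu j)); exact: chart_image_coord.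
apply: eq_bigr => b _; rewrite coordK// [X in _ = X * _]mxE; congr (_ * _).
by rewrite [RHS]mxE transition_coord.
Qed.

Lemma gram_unit i x : dom i x -> gram g i x \in unitmx.
Proof. by move=> dx; apply: posdef_unit => w; exact: gram_posdef. Qed.

Lemma invgram_sym i x : dom i x -> (invmx (gram g i x))^T = invmx (gram g i x).
Proof. by move=> dx; rewrite trmx_inv gram_sym. Qed.

(** By the transition law the invertible Gram matrix of chart i has the jacobian as a factor. *)
Lemma transition_unit i j x : dom i x -> dom j x -> transition_jacobian i j x \in unitmx.
Proof.
move=> dx djx; have := gram_unit dx; rewrite (gram_transition g dx djx).
by rewrite !unitmxE !det_mulmx !unitrM => /andP[/andP[]].
Qed.

(** With J the transition jacobian, du_i = du_j J^T and G_i = J G_j J^T. The factors J^T cancel and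
    leave du_i G_i^-1 = du_j G_j^-1 J^-1, the transformation law of vectors. *)
Lemma grad_vector_field u : Ck_on X 1 Om u -> vector_field_on Om (grad g u).
Proof.
move=> cu i j x Ox dx djx; rewrite /grad (differential_transition cu dx djx Ox).
set J := transition_jacobian i j x; set G := gram g j x.
have uJ : J \in unitmx by exact: transition_unit.
have uG : G \in unitmx by exact: gram_unit.
have uJT : J^T \in unitmx by rewrite unitmx_tr.
have -> : invmx (gram g i x) = invmx J^T *m invmx G *m invmx J.
  have gE := gram_transition g dx djx; rewrite -/J -/G in gE.
  apply: (can_inj (mulKmx (gram_unit dx))); rewrite mulmxV ?gram_unit// gE.
  by rewrite -!mulmxA (mulKVmx uJT) (mulKVmx uG) mulmxV.
by rewrite -!mulmxA mulVmx// mulmx1 (mulKVmx uJT).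
Qed.

Lemma inner_chart (Y Z : vector_field X) i x : vector_field_on Om Y -> vector_field_on Om Z ->
  Om x -> dom i x -> inner g Y Z x = (Y i x *m gram g i x *m (Z i x)^T) 0 0.
Proof.
move=> hY hZ Ox dx; have djx := dom_chart_at X x; rewrite /inner.
rewrite (hY i _ x Ox dx djx) (hZ i _ x Ox dx djx) (gram_transition g dx djx).
by rewrite trmx_mul !mulmxA.
Qed.

(** The metric cancels its inverse, so the pairing is Y acting on phi as a derivation. In this form
    the weak equation becomes integration by parts in coordinates. *)
Lemma inner_grad (Y : vector_field X) phi i x : vector_field_on Om Y -> Ck_on X 1 Om phi ->
  Om x -> dom i x ->
  inner g Y (grad g phi) x = \sum_a Y i x 0 a * partial a (rep i phi) (coord i x).
Proof.
move=> hY cphi Ox dx; rewrite (inner_chart hY (grad_vector_field cphi) Ox dx).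
rewrite /grad trmx_mul invgram_sym// mulmxA -[_ *m _ *m invmx _]mulmxA mulmxV ?gram_unit//.
by rewrite mulmx1 mxE; apply: eq_bigr => a _; rewrite !mxE.
Qed.

Lemma inner_ge0 (Y : vector_field X) x : 0 <= inner g Y Y x.
Proof.
rewrite /inner; have dx := dom_chart_at X x; set w := Y _ x.
have [->|w0] := eqVneq w 0; first by rewrite !mul0mx mxE.
exact: ltW (gram_posdef g dx w0).
Qed.

Lemma inner_cauchy_schwarz (Y Z : vector_field X) x :
  `|inner g Y Z x| <= vnorm g Y x * vnorm g Z x.
Proof.
rewrite -ler_sqr ?nnegrE ?mulr_ge0 ?sqrtr_ge0// real_normK ?num_real//.
rewrite exprMn !sqr_sqrtr ?inner_ge0//; have dx := dom_chart_at X x.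
by apply: posdef_cauchy_schwarz; [move=> w; exact: gram_posdef|exact: gram_sym].
Qed.

Lemma vnorm_inner (Y : vector_field X) x : inner g Y Y x = vnorm g Y x ^+ 2.
Proof. by rewrite sqr_sqrtr ?inner_ge0. Qed.

Lemma C1_invgram i a b : Ck 1 (U i) (fun y => invmx (gram g i (param i y)) a b).
Proof.
apply: C1_invmx; first exact: open_chart_image.
  move=> c d; apply: (@Ck_sub _ _ _ _ (coord i @` dom i)); last exact: gram_smooth.
  by move=> _ [x [dx _] <-]; exists x.
move=> y /chart_imageP[dy _ _]; apply: posdef_det_gt0 => w; exact: gram_posdef.
Qed.

Lemma C1_sqrt_det i : Ck 1 (U i) (fun y => Num.sqrt (\det (gram g i (param i y)))).
Proof.
have d0 y : U i y -> 0 < \det (gram g i (param i y)).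
  by move=> /chart_imageP[dy _ _]; apply: posdef_det_gt0 => w; exact: gram_posdef.
have oU := @open_chart_image i.
have H : Ck 1 (U i) (fun y => \det (gram g i (param i y)) `^ 2^-1).
  apply: C1_powR => //; apply: Ck_det => // c d.
  apply: (@Ck_sub _ _ _ _ (coord i @` dom i)); last exact: gram_smooth.
  by move=> _ [x [dx _] <-]; exists x.
by apply: (Ck_eq oU _ H) => y Uy; rewrite powR12_sqrt// ltW// d0.
Qed.

Lemma grad_rep u i y b : U i y ->
  grad g u i (param i y) 0 b =
  \sum_a partial a (rep i u) y * invmx (gram g i (param i y)) a b.
Proof.
move=> /chart_imageP[_ _ cy]; rewrite /grad mxE; apply: eq_bigr => a _.
by rewrite mxE cy.
Qed.

Lemma C1_grad u i b : Ck_on X 2 Om u -> Ck 1 (U i) (fun y => grad g u i (param i y) 0 b).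
Proof.
move=> cu; have oU := @open_chart_image i.
have H : Ck 1 (U i) (fun y => \sum_a partial a (rep i u) y * invmx (gram g i (param i y)) a b).
  by apply: Ck_sum => // a _; apply: CkM => //; [have [_] := cu i; apply|exact: C1_invgram].
by apply: (Ck_eq oU _ H) => y Uy; rewrite grad_rep.
Qed.

Lemma C0_grad u i b : Ck_on X 1 Om u -> Ck 0 (U i) (fun y => grad g u i (param i y) 0 b).
Proof.
move=> cu; have oU := @open_chart_image i.
have H : Ck 0 (U i) (fun y => \sum_a partial a (rep i u) y * invmx (gram g i (param i y)) a b).
  by apply: Ck_sum => // a _; apply: CkM => //; [have [_] := cu i; apply|apply: CkW; exact: C1_invgram].
by apply: (Ck_eq oU _ H) => y Uy; rewrite grad_rep.
Qed.

Lemma C0_inner_grad u phi : Ck_on X 1 Om u -> Ck_on X 1 Om phi ->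
  Ck_on X 0 Om (inner g (grad g u) (grad g phi)).
Proof.
move=> cu cp i; have oU := @open_chart_image i.
have H : Ck 0 (U i) (fun y => \sum_a grad g u i (param i y) 0 a * partial a (rep i phi) y).
  by apply: Ck_sum => // a _; apply: CkM => //; [exact: C0_grad|have [_] := cp i; apply].
apply: (Ck_eq oU _ H) => y /chart_imageP[dy Oy cy].
by rewrite (inner_grad (grad_vector_field cu) cp Oy dy) cy.
Qed.

Lemma C1_inner_grad u phi : Ck_on X 2 Om u -> Ck_on X 2 Om phi ->
  Ck_on X 1 Om (inner g (grad g u) (grad g phi)).
Proof.
move=> cu cp i; have oU := @open_chart_image i.
have H : Ck 1 (U i) (fun y => \sum_a grad g u i (param i y) 0 a * partial a (rep i phi) y).
  by apply: Ck_sum => // a _; apply: CkM => //; [exact: C1_grad|have [_] := cp i; apply].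
apply: (Ck_eq oU _ H) => y /chart_imageP[dy Oy cy].
by rewrite (inner_grad (grad_vector_field (Ck_onW cu)) (Ck_onW cp) Oy dy) cy.
Qed.

Lemma grad_comp1 (h : R -> R) dh u i x : Ck_on X 1 Om u -> Om x -> dom i x ->
  is_derive (u x) 1 h dh -> grad g (fun z => h (u z)) i x = dh *: grad g u i x.
Proof.
move=> cu Ox dx hd; rewrite /grad scalemxAl; congr (_ *m _).
have hd' : is_derive (rep i u (coord i x)) (1 : R) h dh by rewrite /rep coordK.
apply/rowP => a; rewrite !mxE; apply: (partial_comp1 a hd').
by apply: (Ck_diff (cu i)); exact: chart_image_coord.
Qed.

Lemma eq_grad u phi i x : (forall z, Om z -> u z = phi z) -> Om x -> dom i x ->
  grad g u i x = grad g phi i x.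
Proof.
move=> e Ox dx; rewrite /grad; congr (_ *m _); apply/rowP => a; rewrite !mxE.
apply: (@eq_partial _ _ (U i)); first exact: open_chart_image.
  by move=> z /chart_imageP[_ Oz _]; exact: e.
exact: chart_image_coord.
Qed.

Lemma innerZl (Y Z W : vector_field X) c x : (forall i, dom i x -> Y i x = c *: Z i x) ->
  inner g Y W x = c * inner g Z W x.
Proof.
by move=> H; rewrite /inner (H _ (dom_chart_at X x)) /= -!scalemxAl mxE.
Qed.

Lemma innerZZ (Y Z : vector_field X) c x : (forall i, dom i x -> Y i x = c *: Z i x) ->
  inner g Y Y x = c ^+ 2 * inner g Z Z x.
Proof.
move=> H; rewrite /inner (H _ (dom_chart_at X x)) /= linearZ/= -!scalemxAl -scalemxAr !mxE -/(_ *m _).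
by rewrite mulrA.
Qed.

Lemma vnormZ (Y Z : vector_field X) c x : (forall i, dom i x -> Y i x = c *: Z i x) ->
  vnorm g Y x = `|c| * vnorm g Z x.
Proof.
by move=> H; rewrite /vnorm (innerZZ H) sqrtrM ?sqr_ge0// sqrtr_sqr.
Qed.

End geometry.

(** * Signed powers *)

Lemma is_derive_continuous (R : realType) (f : R -> R) (x df : R) :
  is_derive x (1 : R) f df -> {for x, continuous f}.
Proof. by move=> [df1 _]; apply/differentiable_continuous/derivable1_diffP. Qed.

Section signed_power.
Context {R : realType}.
Variable p : R.
Implicit Types s t : R.

(** The one-dimensional flux of the p-Laplacian. The factor s gives it the value 0 at 0 for every p,
    whatever the convention for 0^(p-2). *)
Definition spow s : R := s * `|s| `^ (p - 2).

(** A power of s^2 replaces that of |s|, so that the chain rule applies away from 0. *)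
Lemma spowE s : spow s = s * (s ^+ 2) `^ ((p - 2) / 2).
Proof.
rewrite /spow -[s ^+ 2]real_normK ?num_real// -powR_mulrn ?normr_ge0// -powRrM.
by congr (_ * _ `^ _); rewrite mulrC divfK.
Qed.

Lemma norm_spow s : `|spow s| = `|s| * `|s| `^ (p - 2).
Proof. by rewrite normrM [X in _ * X]ger0_norm ?powR_ge0. Qed.

Lemma is_derive_sqr s : is_derive s (1 : R) (fun t : R => t ^+ 2) (2 * s).
Proof.
split; first exact: exprn_derivable.
by rewrite exp_derive /GRing.scale/= mulr1 expr1.
Qed.

Lemma is_derive_spow s : s != 0 ->
  is_derive s (1 : R) spow ((p - 1) * `|s| `^ (p - 2)).
Proof.
move=> s0; have s20 : 0 < s ^+ 2 by rewrite exprn_even_gt0.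
rewrite (_ : spow = (fun t => t * (t ^+ 2) `^ ((p - 2) / 2))); last first.
  by apply/funext => t; exact: spowE.
have d1 := @is_derive1_comp R (fun x => x `^ ((p - 2) / 2)) (fun t => t ^+ 2) s _ _
  (is_derive1_powR ((p - 2) / 2) s20) (is_derive_sqr s).
apply: is_derive_eq (is_deriveM (is_derive_id s (1 : R)) d1) _.
have E1 : (s ^+ 2) `^ ((p - 2) / 2) = `|s| `^ (p - 2).
  rewrite -[s ^+ 2]real_normK ?num_real// -powR_mulrn ?normr_ge0// -powRrM.
  by congr (_ `^ _); rewrite mulrC divfK.
have E2 : (s ^+ 2) `^ ((p - 2) / 2 - 1) = `|s| `^ (p - 2) / s ^+ 2.
  by rewrite powRB// ?E1 ?powRr1 ?ltW// (gt_eqF s20) implybT.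
rewrite /GRing.scale/= E1 E2; field.
by rewrite s0.
Qed.

Lemma continuous_norm_powR (r s : R) : s != 0 -> {for s, continuous (fun t => `|t| `^ r)}.
Proof.
move=> s0; apply: (@continuous_comp _ _ _ (fun t : R => `|t|) (fun t => t `^ r)).
  exact: norm_continuous.
by apply: continuous_powR_pos; rewrite normr_gt0.
Qed.

(** The cutoff vanishes for (k+1) s^2 <= 1 and tends to 1 at every nonzero s. *)
Definition spow_cut (k : nat) s : R := spow s * flat 0 (k.+1%:R * s ^+ 2 - 1).

(** In the second term [flat 2] is the derivative of [flat 0], and the factor s of [spow] is
    absorbed into s^2. What remains is the weight |s|^(p-2) times 2 (t + 1) [flat 2 t] with t =
    (k+1) s^2 - 1, a bounded quantity. *)
Definition dspow_cut (k : nat) s : R :=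
  (p - 1) * `|s| `^ (p - 2) * flat 0 (k.+1%:R * s ^+ 2 - 1) +
  `|s| `^ (p - 2) * (2 * (k.+1%:R * s ^+ 2) * flat 2 (k.+1%:R * s ^+ 2 - 1)).

Lemma near_cut k : \forall s \near (0 : R), k.+1%:R * s ^+ 2 - 1 <= 0.
Proof.
have k0 : (0 : R) < k.+1%:R by rewrite ltr0n.
have : \forall s \near (0 : R), `|0 - s| < k.+1%:R^-1.
  by apply: (@cvgr_dist_lt _ _ _ (nbhs (0 : R)) _ id (0 : R)); [exact: id|rewrite invr_gt0].
apply: filterS => s; rewrite sub0r normrN => sk.
rewrite subr_le0 -real_normK ?num_real// expr2 mulrA.
rewrite mulr_ile1 ?mulr_ge0// ?(ltW k0)//.
  by rewrite mulrC -ler_pdivlMr// mul1r ltW.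
apply: le_trans (ltW sk) _; rewrite invf_le1//; by rewrite ler1n.
Qed.

Lemma is_derive_spow_cut k s : is_derive s (1 : R) (spow_cut k) (dspow_cut k s).
Proof.
have [->|s0] := eqVneq s 0.
  rewrite /dspow_cut expr0n/= mulr0 sub0r !flat_neg ?lerN10// !mulr0 addr0.
  apply: (@near_eq_is_derive _ _ _ (cst 0)).
  by apply: filterS (near_cut k) => t tk; rewrite /spow_cut flat_neg// mulr0.
have d1 : is_derive s (1 : R) (fun s => k.+1%:R * s ^+ 2 - 1 : R) (k.+1%:R * (2 * s)).
  have := is_deriveB (is_deriveZ k.+1%:R (is_derive_sqr s)) (is_derive_cst (1 : R) s (1 : R)).
  by rewrite subr0.
have d2 := @is_derive1_comp R (flat 0) (fun s => k.+1%:R * s ^+ 2 - 1) s _ _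
  (is_derive_flat 0 (k.+1%:R * s ^+ 2 - 1)) d1.
apply: is_derive_eq (is_deriveM (is_derive_spow s0) d2) _.
rewrite mul0r subr0 /GRing.scale/= /dspow_cut /spow.
set f0 := flat 0 _; set f2 := flat 2 _; set w := `|s| `^ _; ring.
Qed.

Lemma continuous_dspow_cut k : continuous (dspow_cut k).
Proof.
move=> s; have cl j : {for s, continuous (fun s => flat j (k.+1%:R * s ^+ 2 - 1) : R)}.
  apply: (@continuous_comp _ _ _ (fun s : R => k.+1%:R * s ^+ 2 - 1) (flat j)); last exact: continuous_flat.
  apply: (@continuousB _ _ _ (fun s : R => k.+1%:R * s ^+ 2) (fun=> 1)); last exact: cst_continuous.
  apply: (@continuousM _ _ (fun=> k.+1%:R) (fun s : R => s ^+ 2)); first exact: cst_continuous.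
  exact: exprn_continuous.
have [s0|s0] := eqVneq s 0.
  rewrite s0 /continuous_at.
  have -> : dspow_cut k 0 = 0.
    by rewrite /dspow_cut expr0n/= mulr0 sub0r !flat_neg ?lerN10// !mulr0 addr0.
  apply: cvg_near_cst; apply: filterS (near_cut k) => t tk.
  by rewrite /dspow_cut !flat_neg// !mulr0 addr0.
have cp := @continuous_norm_powR (p - 2) s s0.
apply: (@continuousD _ _ _ (fun s => (p - 1) * `|s| `^ (p - 2) * flat 0 (k.+1%:R * s ^+ 2 - 1))
  (fun s => `|s| `^ (p - 2) * (2 * (k.+1%:R * s ^+ 2) * flat 2 (k.+1%:R * s ^+ 2 - 1)))).
  apply: (@continuousM _ _ (fun s => (p - 1) * `|s| `^ (p - 2))); last exact: cl.
  by apply: (@continuousM _ _ (fun=> p - 1)) cp; exact: cst_continuous.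
apply: (@continuousM _ _ (fun s => `|s| `^ (p - 2))) cp _.
apply: (@continuousM _ _ (fun s => 2 * (k.+1%:R * s ^+ 2))); last exact: cl.
apply: (@continuousM _ _ (fun=> 2)); first exact: cst_continuous.
apply: (@continuousM _ _ (fun=> k.+1%:R)); first exact: cst_continuous.
exact: exprn_continuous.
Qed.

(** For t > 0 the middle term is 2 (flat 1 t + flat 2 t), and [flat_le] bounds it by 2 (1! + 2!) =
    6. The bound is uniform in the index of the cutoff, which enters only through t. *)
Lemma cut_bound t : 0 <= 2 * (t + 1) * flat 2 t <= 6.
Proof.
have [t0|t0] := leP t 0; first by rewrite flat_neg// mulr0 lexx ler0n.
have -> : 2 * (t + 1) * flat 2 t = 2 * (flat 1 t + flat 2 t).
  rewrite (flatS 1 t0); set f := flat 1 t; field; by rewrite gt_eqF.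
have := flat_le 1 t; have := flat_le 2 t; rewrite /factorial/=.
have := flat_ge0 1 t; have := flat_ge0 2 t; lra.
Qed.

Lemma cvg_cut s : s != 0 -> forall A, \forall k \near \oo, A <= k.+1%:R * s ^+ 2 - 1 :> R.
Proof.
move=> s0 A; have s20 : 0 < s ^+ 2 by rewrite exprn_even_gt0.
near=> k; rewrite lerBrDr -ler_pdivrMr//.
have : (A + 1) / s ^+ 2 <= k%:R by near: k; exact: nbhs_infty_ger.
by move=> /le_trans; apply; rewrite ler_nat.
Unshelve. all: by end_near. Qed.

(** These C^1 functions feed the dominated convergence. At s = 0 the derivatives must converge to
    the value that the power convention gives to (p-1) |s|^(p-2): it is 0 for p != 2, in accordance
    with cutoffs that vanish near 0, and 1 for p = 2, where [spow] is the identity and is taken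
    without cutoff. *)
Lemma spow_approx : exists (G dG : nat -> R -> R) (C : R),
  [/\ forall k s, is_derive s (1 : R) (G k) (dG k s),
      forall k, continuous (dG k),
      forall s, (G k s @[k --> \oo] --> spow s) /\
                (dG k s @[k --> \oo] --> (p - 1) * `|s| `^ (p - 2)),
      forall k s, `|G k s| <= `|spow s| &
      forall k s, `|dG k s| <= C * `|s| `^ (p - 2)].
Proof.
have [p2|p2] := eqVneq p 2.
  have sE s : spow s = s by rewrite /spow p2 subrr powRr0 mulr1.
  have wE s : `|s| `^ (p - 2) = 1 by rewrite p2 subrr powRr0.
  exists (fun=> id), (fun _ _ => 1), 1; split.
  - by move=> k s; exact: is_derive_id.
  - by move=> k; exact: cst_continuous.
  - move=> s; rewrite sE wE mulr1; split; first exact: cvg_cst.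
    by rewrite p2 (_ : 2 - 1 = 1); [exact: cvg_cst|ring].
  - by move=> k s; rewrite sE.
  - by move=> k s; rewrite wE mulr1 normr1.
exists spow_cut, dspow_cut, (`|p - 1| + 6); split.
- exact: is_derive_spow_cut.
- exact: continuous_dspow_cut.
- move=> s; have [->|s0] := eqVneq s 0.
    rewrite normr0 powR0 ?subr_eq0// mulr0 /spow mul0r; split.
      by apply: cvg_near_cst; apply: nearW => k; rewrite /spow_cut /spow mul0r mul0r.
    by apply: cvg_near_cst; apply: nearW => k;
      rewrite /dspow_cut normr0 powR0 ?subr_eq0// mulr0 !mul0r addr0.
  have c0 := cvg_flat0 (cvg_cut s0).
  split; first by rewrite -[X in _ --> X]mulr1; apply: cvgMr.
  rewrite -[X in _ --> X]addr0; apply: cvgD.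
    by rewrite -[X in _ --> X]mulr1; apply: cvgMr.
  rewrite -(mulr0 (`|s| `^ (p - 2))); apply: cvgMr.
  apply/cvgrPdist_le => e e0; near=> k.
  have : 6 / e <= k.+1%:R * s ^+ 2 - 1 by near: k; exact: cvg_cut.
  set t := k.+1%:R * s ^+ 2 - 1 => te.
  have t0 : 0 < t by apply: lt_le_trans te; rewrite divr_gt0.
  have -> : k.+1%:R * s ^+ 2 = t + 1 by rewrite subrK.
  (* Since [flat 0] and [flat 1] are at most 1, the right-hand side is at most 4 / t, and t tends to
     infinity with k. *)
  have -> : 2 * (t + 1) * flat 2 t = 2 * (flat 0 t + flat 1 t) / t.
    rewrite (flatS 1 t0) (flatS 0 t0); set f := flat 0 t; field; by rewrite gt_eqF.
  have := flat_ge0 0 t; have := flat_ge0 1 t; have := flat0_le1 t; have := flat_le 1 t.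
  rewrite /factorial/= => a1 a2 a3 a4.
  rewrite sub0r normrN ger0_norm; last first.
    by rewrite divr_ge0 ?(ltW t0)// mulr_ge0// addr_ge0.
  rewrite ler_pdivrMr//; move: te; rewrite ler_pdivrMr// => te.
  rewrite mulrC in te; lra.
- move=> k s; rewrite /spow_cut normrM ler_piMr// ger0_norm ?flat_ge0//.
  exact: flat0_le1.
- move=> k s; rewrite /dspow_cut; set t := k.+1%:R * s ^+ 2 - 1.
  have -> : k.+1%:R * s ^+ 2 = t + 1 by rewrite subrK.
  have w0 : 0 <= `|s| `^ (p - 2) by exact: powR_ge0.
  rewrite [leRHS]mulrDl; apply: le_trans (ler_normD _ _) _; apply: lerD.
    rewrite normrM normrM (ger0_norm w0) ler_piMr ?mulr_ge0// ger0_norm ?flat_ge0//.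
    exact: flat0_le1.
  rewrite normrM (ger0_norm w0) mulrC ler_wpM2r//.
  by have /andP[? ?] := cut_bound t; rewrite ger0_norm.
Unshelve. all: by end_near. Qed.

Lemma powR_mulr (a r : R) : 0 < a -> a `^ r * a = a `^ (r + 1).
Proof. by move=> a0; rewrite powRD ?powRr1 ?ltW// (gt_eqF a0) implybT. Qed.

Lemma cvg_norm_powR0 (r : R) : 0 < r -> `|t| `^ r @[t --> (0 : R)] --> (0 : R).
Proof.
move=> r0; apply/cvgrPdist_le => e e0.
have er : 0 < e `^ r^-1 by exact: powR_gt0.
have : \forall t \near (0 : R), `|0 - t| < e `^ r^-1.
  by apply: (@cvgr_dist_lt _ _ _ (nbhs (0 : R)) _ id (0 : R)); [exact: id|].
apply: filterS => t; rewrite !sub0r !normrN => te.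
rewrite ger0_norm ?powR_ge0// -[leRHS]powRr1 ?ltW// -(mulVf (lt0r_neq0 r0)) powRrM.
by rewrite gt0_ltr_powR// nnegrE ?powR_ge0.
Qed.

Hypothesis p1 : 1 < p.

Lemma norm_spowE s : `|spow s| = `|s| `^ (p - 1).
Proof.
rewrite norm_spow; have [->|s0] := eqVneq s 0.
  by rewrite normr0 mul0r powR0// subr_eq0 gt_eqF.
by rewrite mulrC powR_mulr ?normr_gt0//; congr (_ `^ _); ring.
Qed.

(** For p > 1 this includes the origin, where |t|^p = |t| |t|^(p-1). Hence |phi|^p is C^1 for every
    test function phi. *)
Lemma is_derive_norm_powR s : is_derive s (1 : R) (fun t => `|t| `^ p) (p * spow s).
Proof.
have p0 : 0 < p by exact: lt_trans p1.
have [->|s0] := eqVneq s 0.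
  rewrite /spow mul0r mulr0; apply: (@is_derive_squeeze0 _ _ (fun t => `|t| `^ (p - 1))).
  - by rewrite normr0 powR0// gt_eqF.
  - move=> t; rewrite ger0_norm ?powR_ge0//; have [->|t0] := eqVneq t 0.
      by rewrite normr0 mul0r powR0// gt_eqF.
    by rewrite mulrC powR_mulr ?normr_gt0// subrK.
  - by apply: cvg_norm_powR0; rewrite subr_gt0.
have s20 : 0 < s ^+ 2 by rewrite exprn_even_gt0.
rewrite (_ : (fun t => _) = (fun t : R => (t ^+ 2) `^ (p / 2))); last first.
  apply/funext => t; rewrite -[t ^+ 2]real_normK ?num_real// -powR_mulrn ?normr_ge0// -powRrM.
  by congr (_ `^ _); field.
have d1 := @is_derive1_comp R (fun x => x `^ (p / 2)) (fun t => t ^+ 2) s _ _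
  (is_derive1_powR (p / 2) s20) (is_derive_sqr s).
apply: is_derive_eq d1 _; rewrite spowE (_ : p / 2 - 1 = (p - 2) / 2); last by field.
by field.
Qed.

Lemma continuous_spow : continuous spow.
Proof.
move=> s; have [->|s0] := eqVneq s 0; last first.
  exact: is_derive_continuous (is_derive_spow s0).
rewrite /continuous_at [spow 0]mul0r; apply: norm_cvg0.
rewrite (_ : (fun t => _) = (fun t => `|t| `^ (p - 1))); last by apply/funext => t; exact: norm_spowE.
by apply: cvg_norm_powR0; rewrite subr_gt0.
Qed.

(** Young's inequality for z^(p-1) and b with the conjugate exponents p / (p - 1) and p, multiplied
    by p. *)
Lemma young_powR (z b : R) : 0 <= z -> 0 <= b ->
  p * z `^ (p - 1) * b <= (p - 1) * z `^ p + b `^ p.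
Proof.
move=> z0 b0; have p0 : 0 < p by exact: lt_trans p1.
have p10 : 0 < p - 1 by rewrite subr_gt0.
have q0 : 0 < p / (p - 1) by rewrite divr_gt0.
have pn : p != 0 by rewrite gt_eqF.
have pn1 : p - 1 != 0 by rewrite gt_eqF.
have e : (p / (p - 1))^-1 + p^-1 = 1 by field; rewrite pn pn1.
have := conjugate_powR (powR_ge0 z (p - 1)) b0 q0 p0 e.
rewrite -powRrM (_ : (p - 1) * (p / (p - 1)) = p); last by field.
move=> /(ler_wpM2l (ltW p0)); rewrite mulrA => /le_trans; apply.
by rewrite le_eqVlt; apply/orP; left; apply/eqP; field; rewrite pn pn1.
Qed.

(** Pointwise Picone inequality, with s = phi, a = |grad u|, b = |grad phi| and k = <grad u, grad
    phi>: the left side is |grad u|^(p-2) <grad u, grad(|phi|^p u^(1-p))>. The bound on k reduces it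
    to Young's inequality for z = |phi| |grad u| / u. *)
Lemma picone_powR (s a b u k : R) : 0 <= a -> 0 <= b -> 0 < u -> `|k| <= a * b ->
  a `^ (p - 2) * (`|s| `^ p * ((1 - p) * u `^ (- p) * a ^+ 2) + u `^ (1 - p) * (p * spow s * k)) <=
  b `^ p.
Proof.
move=> a0 b0 u0 kab; have p0 : 0 < p by exact: lt_trans p1.
(* Splitting a^p into a^(p-2) a^2 requires a != 0. For a = 0 the bound on k forces k = 0, and both
   terms in the parenthesis vanish. *)
have [az|az] := eqVneq a 0.
  move: kab; rewrite az mul0r normr_le0 => /eqP ->.
  by rewrite expr0n/= !mulr0 addr0 mulr0 powR_ge0.
have {az}a0 : 0 < a by rewrite lt_neqAle eq_sym az.
pose z := `|s| * a * u^-1.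
have z0 : 0 <= z by rewrite /z !mulr_ge0// ?invr_ge0 ltW.
have zE r : z `^ r = `|s| `^ r * a `^ r * u `^ (- r).
  rewrite /z powRM ?mulr_ge0 ?invr_ge0 ?(ltW a0) ?(ltW u0)// powRM ?(ltW a0)//.
  by rewrite -(powR_inv1 (ltW u0)) -powRrM mulN1r.
have apE : a `^ p = a `^ (p - 2) * a ^+ 2.
  by rewrite -powR_mulrn ?ltW// -powRD ?subrK// (gt_eqF a0) implybT.
have ap1E : a `^ (p - 1) = a `^ (p - 2) * a.
  by rewrite powR_mulr//; congr (_ `^ _); ring.
have Y := young_powR z0 b0.
have kb : p * spow s * k <= p * `|s| `^ (p - 1) * (a * b).
  rewrite -mulrA -[leRHS]mulrA; apply: ler_wpM2l; first exact: ltW.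
  by rewrite -norm_spowE (le_trans (ler_norm _))// normrM ler_wpM2l.
rewrite -subr_ge0; rewrite -subr_ge0 !zE apE ap1E opprB in Y.
set w := a `^ (p - 2) in Y *; have w0 : 0 <= w by exact: powR_ge0.
set v := u `^ (1 - p); have v0 : 0 <= v by exact: powR_ge0.
rewrite -/v in Y.
apply: le_trans Y _; rewrite -subr_ge0.
rewrite (_ : _ - _ = w * v * (p * `|s| `^ (p - 1) * (a * b) - p * spow s * k)); last by ring.
by rewrite mulr_ge0 ?mulr_ge0// subr_ge0.
Qed.

End signed_power.

(** * Weak divergence of radial fluxes *)

Section locally_integrable.
Context {T : ptopologicalType} {R : realType}.
Variable mu : {measure set (borel T) -> \bar R}.
Variable U : set T.
Hypotheses (hT : hausdorff_space T) (oU : open U).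
Hypothesis mufin : forall K, compact K -> K `<=` U -> (mu K < +oo)%E.
Implicit Types (f h : T -> R) (K : set T).
Local Notation locint := (locally_integrable_on mu U).

Lemma locint_continuous f : (forall x, U x -> {for x, continuous f}) -> locint f.
Proof. by move=> cf K cK KU; apply: integrable_on_compact cf => //; exact: mufin. Qed.

Lemma locintD f h : locint f -> locint h -> locint (fun x => f x + h x).
Proof.
move=> fi hi K cK KU; have mK := borel_compact hT cK.
have := integrableD mK (fi K cK KU) (hi K cK KU).
by apply: eq_integrable => // x _; rewrite EFinD.
Qed.

Lemma locintZ c f : locint f -> locint (fun x => c * f x).
Proof.
move=> fi K cK KU; have mK := borel_compact hT cK.
have := integrableZl mK c (fi K cK KU).
by apply: eq_integrable => // x _; rewrite EFinM.
Qed.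

Lemma locintM f h : (forall x, U x -> {for x, continuous f}) -> locint h ->
  locint (fun x => f x * h x).
Proof.
move=> cf hi K cK KU; have mK := borel_compact hT cK.
have mf : measurable_fun (K : set (borel T)) (f : borel T -> R).
  by apply: measurable_funS (continuous_on_measurable oU cf) => //; exact: borel_open.
have [C C0 HC] := compact_bound cK (fun x Kx => cf x (KU x Kx)).
have bf : [bounded (f : borel T -> R) x | x in (K : set (borel T))].
  exists C; split; first exact: num_real.
  by move=> B CB x Kx /=; rewrite (le_trans (HC _ Kx))// ltW.
have := integrableMr mK mf bf (hi K cK KU).
by apply: eq_integrable => // x _; rewrite /= EFinM.
Qed.

Lemma locint_eq f h : (forall x, U x -> f x = h x) -> locint f -> locint h.
Proof.
move=> fh fi K cK KU; apply: eq_integrable (fi K cK KU) => [|x /[!inE] Kx].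
  exact: borel_compact.
by rewrite fh//; exact: KU.
Qed.

Lemma locint_le f h : measurable_fun (U : set (borel T)) (f : borel T -> R) ->
  (forall x, U x -> `|f x| <= h x) -> locint h -> locint f.
Proof.
move=> mf fh hi K cK KU; have mK := borel_compact hT cK.
apply: (le_integrable mK _ _ (hi K cK KU)).
  by apply/measurable_EFinP; apply: measurable_funS mf => //; exact: borel_open.
move=> x Kx; rewrite !abse_EFin lee_fin (le_trans (fh x (KU x Kx)))//; exact: ler_norm.
Qed.

Lemma locint_integrable K f : locint f -> compact K -> K `<=` U ->
  (forall x, U x -> ~ K x -> f x = 0) ->
  mu.-integrable (U : set (borel T)) (fun x : borel T => (f x)%:E).
Proof.
move=> fi cK KU f0; apply: (@integrable_zero_off _ _ _ K) => //.
- exact: borel_compact.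
- exact: borel_open.
- by move=> x Ux Kx; rewrite f0.
- exact: fi.
Qed.

Lemma locint_Linfty V f : Linfty_loc mu U V -> locint f -> locint (fun x => V x * f x).
Proof.
move=> [mV HV] fi K cK KU; have mK := borel_compact hT cK.
have [C HC] := HV K cK KU.
have mVK : measurable_fun (K : set (borel T)) (V : borel T -> R).
  by apply: measurable_funS mV => //; exact: borel_open.
have /integrableP[/measurable_EFinP mf _] := fi K cK KU.
have mVf : measurable_fun (K : set (borel T)) (fun x : borel T => V x * f x).
  exact: measurable_funM.
have /integrableP[_ H] := integrableZl mK C (integrable_abse (fi K cK KU)).
apply/integrableP; split; first exact/measurable_EFinP.
apply: le_lt_trans H; apply: ae_ge0_le_integral => //.
- by apply: measurableT_comp => //; exact/measurable_EFinP.
- apply: measurableT_comp => //; apply: emeasurable_funM; first exact: measurable_cst.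
  by apply: measurableT_comp => //; exact/measurable_EFinP.
apply: filterS HC => x Hx Kx; have VC := Hx Kx.
rewrite /= lee_fin !normrM normr_id ler_wpM2r//.
exact: le_trans VC (ler_norm C).
Qed.

End locally_integrable.

Lemma dominated_eq d (T : measurableType d) (R : realType) (mu : {measure set T -> \bar R})
    (D : set T) (f_ h_ : nat -> T -> R) (f h bf bh : T -> R) :
  measurable D ->
  (forall k, measurable_fun D (f_ k)) -> (forall k, measurable_fun D (h_ k)) ->
  (forall x, D x -> f_ k x @[k --> \oo] --> f x) ->
  (forall x, D x -> h_ k x @[k --> \oo] --> h x) ->
  (forall k x, D x -> `|f_ k x| <= bf x) -> (forall k x, D x -> `|h_ k x| <= bh x) ->
  mu.-integrable D (EFin \o bf) -> mu.-integrable D (EFin \o bh) ->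
  (forall k, \int[mu]_(x in D) (f_ k x)%:E = \int[mu]_(x in D) (h_ k x)%:E)%E ->
  [/\ mu.-integrable D (EFin \o f), mu.-integrable D (EFin \o h) &
      (\int[mu]_(x in D) (f x)%:E = \int[mu]_(x in D) (h x)%:E)%E].
Proof.
move=> mD mf mh fc hc fb hb ibf ibh E.
have H (u_ : nat -> T -> R) u b : (forall k, measurable_fun D (u_ k)) ->
    (forall x, D x -> u_ k x @[k --> \oo] --> u x) ->
    (forall k x, D x -> `|u_ k x| <= b x) -> mu.-integrable D (EFin \o b) ->
    mu.-integrable D (EFin \o u) /\
    (\int[mu]_(x in D) (u_ k x)%:E @[k --> \oo] --> \int[mu]_(x in D) (u x)%:E)%E.
  move=> mu_ uc ub ib.
  have mu' : measurable_fun D u by apply: measurable_fun_cvg mu_ _; exact: uc.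
  have [] := @dominated_convergence _ T R mu D mD (fun k x => (u_ k x)%:E) (EFin \o u) (EFin \o b).
  - by move=> k; exact/measurable_EFinP.
  - exact/measurable_EFinP.
  - by apply: aeW => x Dx; apply: cvg_EFin; [exact: nearW|exact: uc].
  - exact: ib.
  - by apply: aeW => x k Dx; rewrite lee_fin ub.
  - by move=> iu _ cu; split.
have [fi cf] := H _ _ _ mf fc fb ibf; have [hi ch] := H _ _ _ mh hc hb ibh.
split => //; apply: (@cvg_unique _ (@ereal_hausdorff R) _ _ _ _ cf).
by rewrite (_ : (fun k => _) = (fun k => \int[mu]_(x in D) (h_ k x)%:E)%E)//; exact/funext.
Qed.

(** * Divergence of a flux multiplied by a function of t *)

Section flux.
Context {R : realType} {n : nat}.
Local Notation E := 'rV[R]_n.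
Variable lam : {measure set (borel E) -> \bar R}.
Hypothesis hlam : is_lebesgue lam.
Variables (U : set E) (A : 'I_n -> E -> R) (t : E -> R).
Hypotheses (oU : open U) (cA : forall a, Ck 1 U (A a)) (ct : Ck 1 U t).
Implicit Types (psi : E -> R) (K : set E).
Local Notation UB := (U : set (borel E)).

Definition flux psi (y : E) : R := \sum_a A a y * partial a psi y.

(** In the application [A] already contains the density of nu with respect to [lam], so that this
    coordinate divergence is the divergence with respect to nu times that density. *)
Definition flux_div (y : E) : R := \sum_a partial a (A a) y.

Lemma continuous_flux psi : Ck 1 U psi -> Ck 0 U (flux psi).
Proof.
move=> [_ cpsi]; apply: (Ck_sum _ oU) => a _.
exact: (CkM oU (CkW (cA a)) (cpsi a)).
Qed.

Lemma continuous_flux_div : Ck 0 U flux_div.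
Proof. by apply: Ck_sum => // a _; have [_] := cA a; apply. Qed.

Lemma flux_zero_off K psi : compact K -> (forall y, ~ K y -> psi y = 0) ->
  forall y, ~ K y -> flux psi y = 0.
Proof.
move=> cK psi0 y Ky; apply: big1 => a _.
by rewrite (partial_zero_off a cK psi0) ?mulr0.
Qed.

Lemma flux_by_parts K (k dk : R -> R) psi : compact K -> K `<=` U -> Ck 1 U psi ->
  (forall y, ~ K y -> psi y = 0) ->
  (forall y, U y -> is_derive (t y) 1 k (dk (t y))) ->
  (forall y, U y -> {for t y, continuous dk}) ->
  (\int[lam]_(y in UB) (k (t y) * flux psi y)%:E =
   \int[lam]_(y in UB)
     (- (k (t y) * flux_div y + dk (t y) * flux t y) * psi y)%:E)%E.
Proof.
move=> cK KU cpsi psi0 dkt cdk; have mU := borel_open oU.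
have ck : Ck 1 U (fun y => k (t y)) := C1_comp1 oU dkt cdk ct.
pose f a y := k (t y) * A a y.
have cf a : Ck 1 U (f a) := CkM oU ck (cA a).
have ibp a := integration_by_parts hlam a oU cK KU (cf a) cpsi psi0.
transitivity (\int[lam]_(y in UB) \sum_a (f a y * partial a psi y)%:E)%E.
  apply: eq_integral => y _; rewrite /flux mulr_sumr sumEFin; congr (_%:E).
  by apply: eq_bigr => a _; rewrite mulrA.
rewrite integral_sum//; last by move=> a; have [] := ibp a.
transitivity (\sum_a (\int[lam]_(y in UB) (- partial a (f a) y * psi y)%:E))%E.
  apply: eq_bigr => a _; have [_ i2 ->] := ibp a.
  rewrite -mulN1e -(integralZl mU i2); apply: eq_integral => y _.
  by rewrite mulNr EFinN mulN1e.
rewrite -integral_sum//; last first.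
  move=> a; have [_ i2 _] := ibp a; have := integrableN i2.
  by apply: eq_integrable => // y _; rewrite /= mulNr.
apply: eq_integral => y /[!inE] Uy; rewrite sumEFin; congr (_%:E).
rewrite -mulr_suml sumrN; congr (- _ * _).
rewrite /flux_div /flux !mulr_sumr -big_split/=; apply: eq_bigr => a _.
rewrite partialM; [|exact: (Ck_diff ck)|exact: (Ck_diff (cA a))].
rewrite (partial_comp1 a (dkt y Uy) (Ck_diff ct Uy)); ring.
Qed.

(** P stands for F^(p-1), whose derivative is (p-1) F^(p-1) q. Integration by parts is performed
    with G_k(q) in place of spow(q), and k tends to infinity; the dominating functions are sums of
    products of |q|^(p-2) with continuous functions that vanish off K. *)
Lemma profile_flux (p : R) K (P q dq : R -> R) psi : compact K -> K `<=` U ->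
  Ck 1 U psi -> (forall y, ~ K y -> psi y = 0) ->
  (forall y, U y -> is_derive (t y) 1 P ((p - 1) * P (t y) * q (t y))) ->
  (forall y, U y -> is_derive (t y) 1 q (dq (t y))) ->
  (forall y, U y -> {for t y, continuous dq}) ->
  locally_integrable_on lam U (fun y => `|q (t y)| `^ (p - 2)) ->
  let f y := P (t y) * spow p (q (t y)) * flux psi y in
  let h y := - (P (t y) * `|q (t y)| `^ (p - 2) *
    (q (t y) * flux_div y + (p - 1) * (q (t y) ^+ 2 + dq (t y)) * flux t y)) * psi y in
  [/\ lam.-integrable UB (fun y => (f y)%:E),
      lam.-integrable UB (fun y => (h y)%:E) &
      (\int[lam]_(y in UB) (f y)%:E =
       \int[lam]_(y in UB) (h y)%:E)%E].
Proof.
move=> cK KU cpsi psi0 dP dq' cdq iw f h.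
have hE : hausdorff_space E by exact: norm_hausdorff.
have mU := borel_open oU.
have lfin K' : compact K' -> K' `<=` U -> (lam K' < +oo)%E.
  by move=> cK' _; exact: lam_compact.
have [G [dG [C [HG cG lG bG bdG]]]] := spow_approx p.
have cq' y : U y -> {for t y, continuous q} by move=> Uy; exact: is_derive_continuous (dq' y Uy).
have cP' y : U y -> {for t y, continuous P} by move=> Uy; exact: is_derive_continuous (dP y Uy).
have c0 (u : R -> R) : (forall y, U y -> {for t y, continuous u}) -> Ck 0 U (fun y => u (t y)).
  move=> cu y Uy; apply: (@continuous_comp _ _ _ t u); last exact: cu.
  exact: Ck0 ct Uy.
have cq := c0 _ cq'; have cP := c0 _ cP'; have cdq0 := c0 _ cdq.
have cfl := continuous_flux cpsi; have cft := continuous_flux ct.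
have cdiv := continuous_flux_div.
have cpsi_ : Ck 0 U psi by exact: CkW.
pose fk k y := P (t y) * G k (q (t y)) * flux psi y.
pose dk k s := (p - 1) * P s * q s * G k (q s) + P s * (dG k (q s) * dq s).
pose hk k y := - (P (t y) * G k (q (t y)) * flux_div y + dk k (t y) * flux t y) * psi y.
have cGk k : continuous (G k).
  by move=> s; exact: is_derive_continuous (HG k s).
have cGq k : Ck 0 U (fun y => G k (q (t y))).
  apply: (c0 (fun s => G k (q s))) => y Uy.
  by apply: (@continuous_comp _ _ _ q (G k)); [exact: cq'|exact: cGk].
have cdGq k : Ck 0 U (fun y => dG k (q (t y))).
  apply: (c0 (fun s => dG k (q s))) => y Uy.
  by apply: (@continuous_comp _ _ _ q (dG k)); [exact: cq'|exact: cG].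
have Ckc c : Ck 0 U (fun=> c) by exact: Ck_cst.
have mCk (u : E -> R) : Ck 0 U u -> measurable_fun UB (u : borel E -> R).
  by move=> cu; exact: continuous_on_measurable.
have cfk k : Ck 0 U (fk k) by apply: CkM => //; exact: CkM.
have chk k : Ck 0 U (hk k).
  apply: CkM => //.
  rewrite (_ : (fun y => _) = (fun y => (-1) * (P (t y) * G k (q (t y)) * flux_div y +
     ((p - 1) * P (t y) * q (t y) * G k (q (t y)) + P (t y) * (dG k (q (t y)) * dq (t y))) * flux t y))).
    apply: CkM => //; apply: CkD => //; first by apply: CkM => //; exact: CkM.
    apply: CkM => //; apply: CkD => //; last by apply: CkM => //; exact: CkM.
    by apply: CkM => //; apply: CkM => //; exact: CkM.
  by apply/funext => y; rewrite mulN1r.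
have iK (u : E -> R) : Ck 0 U u -> (forall y, ~ K y -> u y = 0) ->
    lam.-integrable UB (fun y : borel E => (`|u y| * `|q (t y)| `^ (p - 2))%:E).
  move=> cu u0; apply: (@locint_integrable _ _ lam U hE oU K) => //; last first.
    by move=> y _ /u0 ->; rewrite normr0 mul0r.
  apply: locintM => // y Uy; apply: continuous_comp; first exact: cu.
  exact: norm_continuous.
apply: (@dominated_eq _ (borel E) R lam U fk hk f h
  (fun y => `|P (t y) * q (t y) * flux psi y| * `|q (t y)| `^ (p - 2))
  (fun y => `|P (t y) * q (t y) * flux_div y * psi y| * `|q (t y)| `^ (p - 2) +
     (`|(p - 1) * P (t y) * q (t y) ^+ 2 * flux t y * psi y| * `|q (t y)| `^ (p - 2) +
      `|C * P (t y) * dq (t y) * flux t y * psi y| * `|q (t y)| `^ (p - 2)))) => //.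
- by move=> k; exact: mCk.
- by move=> k; exact: mCk.
- move=> y Uy; apply: cvgMl; apply: cvgMr; by have [] := lG (q (t y)).
- move=> y Uy; apply: cvgMl; have [l1 l2] := lG (q (t y)).
  rewrite (_ : - _ = - (P (t y) * spow p (q (t y)) * flux_div y +
    ((p - 1) * P (t y) * q (t y) * spow p (q (t y)) +
     P (t y) * ((p - 1) * `|q (t y)| `^ (p - 2) * dq (t y))) * flux t y)); last first.
    by congr (- _); rewrite /spow; set w := _ `^ _; ring.
  apply: cvgN; apply: cvgD; first by apply: cvgMl; exact: cvgMr.
  apply: cvgMl; apply: cvgD; first exact: cvgMr.
  by apply: cvgMr; apply: cvgMl.
- move=> k y Uy; rewrite /fk !normrM -!mulrA ler_wpM2l// mulrC [leRHS]mulrC -!mulrA ler_wpM2l//.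
  by rewrite [leRHS]mulrC -norm_spow.
- move=> k y Uy; rewrite /hk /dk normrM normrN.
  set w := _ `^ _; have w0 : 0 <= w by exact: powR_ge0.
  have b1 := bG k (q (t y)); have b2 := bdG k (q (t y)); rewrite norm_spow -/w in b1 b2.
  rewrite -/w in b2.
  apply: (@le_trans _ _ ((`|P (t y) * G k (q (t y)) * flux_div y| +
     (`|(p - 1) * P (t y) * q (t y) * G k (q (t y)) * flux t y| +
      `|P (t y) * (dG k (q (t y)) * dq (t y)) * flux t y|)) * `|psi y|)).
    rewrite ler_wpM2r// (le_trans (ler_normD _ _))// lerD2l mulrDl; exact: ler_normD.
  rewrite [leLHS]mulrDl [X in _ + X <= _]mulrDl.
  apply: lerD; [|apply: lerD].
  + rewrite !normrM; set aP := `|P _|; set ad := `|flux_div y|; set aq := `|q _|; set aps := `|psi y|.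
    have -> : aP * aq * ad * aps * w = aP * ad * aps * (aq * w) by ring.
    have -> : aP * `|G k (q (t y))| * ad * aps = aP * ad * aps * `|G k (q (t y))| by ring.
    by apply: ler_wpM2l b1; rewrite !mulr_ge0 /aP /ad /aps ?normr_ge0.
  + rewrite expr2 !normrM; set aP := `|P _|; set ad := `|flux t y|; set aq := `|q _|; set aps := `|psi y|.
    set ap := `|p - 1|.
    have -> : ap * aP * (aq * aq) * ad * aps * w = ap * aP * aq * ad * aps * (aq * w) by ring.
    have -> : ap * aP * aq * `|G k (q (t y))| * ad * aps = ap * aP * aq * ad * aps * `|G k (q (t y))| by ring.
    by apply: ler_wpM2l b1; rewrite !mulr_ge0 /ap /aP /aq /ad /aps ?normr_ge0.
  + rewrite !normrM; set aP := `|P _|; set ad := `|flux t y|; set aq := `|dq _|; set aps := `|psi y|.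
    have -> : `|C| * aP * aq * ad * aps * w = aP * aq * ad * aps * (`|C| * w) by ring.
    have -> : aP * (`|dG k (q (t y))| * aq) * ad * aps = aP * aq * ad * aps * `|dG k (q (t y))| by ring.
    apply: ler_wpM2l; first by rewrite !mulr_ge0 /aP /aq /ad /aps ?normr_ge0.
    by rewrite (le_trans b2)// ler_wpM2r// ler_norm.
- apply: iK => [|y Ky]; first by apply: CkM => //; exact: CkM.
  by rewrite (flux_zero_off cK psi0 Ky) mulr0.
- have i1 := iK (fun y => P (t y) * q (t y) * flux_div y * psi y).
  have i2 := iK (fun y => (p - 1) * P (t y) * q (t y) ^+ 2 * flux t y * psi y).
  have i3 := iK (fun y => C * P (t y) * dq (t y) * flux t y * psi y).
  have z (c : R) y : ~ K y -> c * psi y = 0 by move=> /psi0 ->; rewrite mulr0.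
  have cq2 : Ck 0 U (fun y => q (t y) ^+ 2).
    rewrite (_ : (fun y => _) = (fun y => q (t y) * q (t y))); first exact: CkM.
    by apply/funext => y; rewrite expr2.
  have {}i1 := i1 (CkM oU (CkM oU (CkM oU cP cq) cdiv) cpsi_) (fun y => z _ y).
  have {}i2 := i2 (CkM oU (CkM oU (CkM oU (CkM oU (Ckc (p - 1)) cP) cq2) cft) cpsi_) (fun y => z _ y).
  have {}i3 := i3 (CkM oU (CkM oU (CkM oU (CkM oU (Ckc C) cP) cdq0) cft) cpsi_) (fun y => z _ y).
  have := integrableD mU i1 (integrableD mU i2 i3).
  by apply: eq_integrable => // y _; rewrite /= !EFinD.
- move=> k; apply: (flux_by_parts cK KU cpsi psi0 (k := fun s => P s * G k (q s)) (dk := dk k)).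
    move=> y Uy; rewrite /dk.
    have d1 := is_derive1_comp (HG k (q (t y))) (dq' y Uy).
    apply: is_derive_eq (is_deriveM (dP y Uy) d1) _.
    rewrite /GRing.scale/=; ring.
  move=> y Uy; rewrite /dk.
  have ccst (c : R) : {for t y, continuous (fun=> c : R)} by exact: cst_continuous.
  have cGq1 : {for t y, continuous (fun s => G k (q s))}.
    by apply: (@continuous_comp _ _ _ q (G k)); [exact: cq'|exact: cGk].
  have cdGq1 : {for t y, continuous (fun s => dG k (q s))}.
    by apply: (@continuous_comp _ _ _ q (dG k)); [exact: cq'|exact: cG].
  have cm (u v : R -> R) : {for t y, continuous u} -> {for t y, continuous v} ->
     {for t y, continuous (fun s => u s * v s)} by exact: continuousM.
  have ca (u v : R -> R) : {for t y, continuous u} -> {for t y, continuous v} ->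
     {for t y, continuous (fun s => u s + v s)} by exact: continuousD.
  exact: (ca _ _ (cm _ _ (cm _ _ (cm _ _ (ccst (p - 1)) (cP' y Uy)) (cq' y Uy)) cGq1)
    (cm _ _ (cP' y Uy) (cm _ _ cdGq1 (cdq y Uy)))).
Qed.

End flux.

(** * Solutions that are functions of one solution *)

Lemma integral_ae_ge0 d (T : measurableType d) (R : realType) (mu : {measure set T -> \bar R})
    (D : set T) (f : T -> R) : measurable D -> measurable_fun D f ->
  {ae mu, forall x, D x -> 0 <= f x} -> (0 <= \int[mu]_(x in D) (f x)%:E)%E.
Proof.
move=> mD mf f0; rewrite (@ae_eq_integral _ _ _ mu D (fun x => `|f x|%:E))//.
- by apply: integral_ge0 => x _; rewrite lee_fin.
- exact/measurable_EFinP.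
- by apply/measurable_EFinP; exact: measurableT_comp.
- by apply: filterS f0 => x Hx /Hx fx; rewrite ger0_norm.
Qed.

Lemma compact_seq_cover (T : ptopologicalType) (K : set T) (V : T -> set T) :
  compact K -> (forall x, K x -> open (V x) /\ V x x) ->
  exists s : seq T, (forall x, x \in s -> K x) /\
    forall z, K z -> exists2 x, x \in s & V x z.
Proof.
rewrite compact_cover => cK HV.
have [x Kx|z Kz|D' D'K KD'] := cK T K V.
- by have [] := HV x Kx.
- by exists z => //; have [] := HV z Kz.
- exists (finmap.enum_fset D'); split=> [x /D'K/set_mem//|z /KD'[x /= xD Vxz]].
  by exists x.
Qed.

Section solutions.
Context {R : realType} {n : nat} {M : ptopologicalType}.
Variable X : smooth_manifold R n M.
Variable g : riemannian_metric X.
Variable Om : set M.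
Hypothesis oOm : open Om.
Local Notation E := 'rV[R]_n.
Variables (lam : {measure set (borel E) -> \bar R}) (vol nu : {measure set (borel M) -> \bar R}).
Hypotheses (hlam : is_lebesgue lam) (hvol : is_riemannian_volume g lam vol).
Variable rho : M -> R.
Hypotheses (srho : smooth_on X Om rho) (rho0 : forall x, Om x -> 0 < rho x).
Hypothesis hnu : forall A : set (borel M), measurable A -> A `<=` Om ->
  nu A = (\int[vol]_(x in A) (rho x)%:E)%E.
Local Notation U := (chart_image (X := X) Om).

(** * The measure nu in charts *)

Definition chart_density (i : idx X) (y : E) : R :=
  rho (param i y) * Num.sqrt (\det (gram g i (param i y))).

Lemma chart_density_gt0 i y : U i y -> 0 < chart_density i y.
Proof.
move=> /chart_imageP[dy Oy _]; rewrite mulr_gt0 ?rho0// sqrtr_gt0.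
by apply: posdef_det_gt0 => w; exact: gram_posdef.
Qed.

Lemma C1_chart_density i : Ck 1 (U i) (chart_density i).
Proof.
apply: CkM; [exact: open_chart_image|exact: srho 1%N i|exact: C1_sqrt_det].
Qed.

Lemma measurable_param i : measurable_fun (U i : set (borel E)) (param i : borel E -> borel M).
Proof.
apply: continuous_on_measurable_borel; first exact: open_chart_image.
exact: param_cont.
Qed.

Lemma measurable_chart_density i :
  measurable_fun (U i : set (borel E)) (chart_density i : borel E -> R).
Proof.
apply: continuous_on_measurable; first exact: open_chart_image.
by move=> y Uy; exact: Ck0 (C1_chart_density i) Uy.
Qed.

Let mU i : measurable (U i : set (borel E)).
Proof. by apply: borel_open; exact: open_chart_image. Qed.

Lemma measurable_domI (i : idx X) : measurable (dom i `&` Om : set (borel M)).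
Proof. by apply: borel_open; exact: open_domI. Qed.

Lemma coord_image i (A : set M) : A `<=` dom i `&` Om -> coord i @` A = U i `&` param i @^-1` A.
Proof.
move=> AD; apply/seteqP; split=> [_ [x Ax <-]|y [[x [dx Ox] <-]]] /=.
  by have [dx Ox] := AD x Ax; rewrite coordK//; split => //; exact: chart_image_coord.
by rewrite coordK// => Ax; exists x.
Qed.

Let mrho : measurable_fun (Om : set (borel M)) (rho : borel M -> R).
Proof.
apply: continuous_on_measurable => // x Ox.
exact: (Ck_on_continuous (srho 0%N) Ox).
Qed.

(** Two densities are composed: rho of nu with respect to the volume, and the square root of the
    Gram determinant of the volume with respect to [lam]. *)
Lemma nu_chart i (A : set (borel M)) : measurable A -> A `<=` dom i `&` Om ->
  (nu A = \int[lam]_(y in (U i : set (borel E)) `&` param i @^-1` A) (chart_density i y)%:E)%E.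
Proof.
move=> mA AD; have AO : A `<=` Om by move=> x /AD[].
pose D2 : set (borel E) := U i `&` param i @^-1` A.
have mD2 : measurable D2 by exact: measurable_param.
have D2U : D2 `<=` U i by exact: subIsetl.
have msd : measurable_fun (U i : set (borel E))
    (fun y : borel E => Num.sqrt (\det (gram g i (param i y))) : R).
  apply: continuous_on_measurable; first exact: open_chart_image.
  by move=> y Uy; exact: Ck0 (C1_sqrt_det _ _ _) Uy.
rewrite hnu//.
have := @integral_change _ _ _ _ _ vol lam A D2 (param i)
  (fun y => Num.sqrt (\det (gram g i (param i y)))) mA mD2.
move=> -> //.
- by apply: (measurable_funS (mU i) D2U); exact: measurable_param.
- by move=> y [].
- exact: (measurable_funS (mU i) D2U msd).
- move=> B mB BA; rewrite (hvol (i := i))//; last by move=> x /BA/AD[].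
  congr (integral lam _ _); rewrite (@coord_image i); last by move=> x /BA /AD.
  apply/seteqP; split=> y /=; first by move=> [Uy By]; split => //; split => //; exact: BA.
  by move=> [[Uy Ay] By].
- exact: (measurable_funS (borel_open oOm) AO mrho).
Qed.

Lemma nu_integral i (f : M -> R) :
  measurable_fun (dom i `&` Om : set (borel M)) (f : borel M -> R) ->
  (\int[nu]_(x in (dom i `&` Om : set (borel M))) (f x)%:E =
   \int[lam]_(y in (U i : set (borel E))) (f (param i y) * chart_density i y)%:E)%E.
Proof.
move=> mf.
apply: (@integral_change _ _ _ _ _ nu lam (dom i `&` Om) (U i) (param i) (chart_density i)) => //.
- exact: measurable_domI.
- exact: measurable_param.
- by move=> y /chart_imageP[].
- exact: measurable_chart_density.
- by move=> y Uy; rewrite ltW// chart_density_gt0.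
- by move=> A mA AD; exact: nu_chart.
Qed.

Lemma nu_integrable i (f : M -> R) :
  measurable_fun (dom i `&` Om : set (borel M)) (f : borel M -> R) ->
  nu.-integrable (dom i `&` Om : set (borel M)) (EFin \o f) <->
  lam.-integrable (U i : set (borel E)) (fun y => (f (param i y) * chart_density i y)%:E).
Proof.
move=> mf.
apply: (@integrable_change _ _ _ _ _ nu lam (dom i `&` Om) (U i) (param i) (chart_density i)) => //.
- exact: measurable_domI.
- exact: measurable_param.
- by move=> y /chart_imageP[].
- exact: measurable_chart_density.
- by move=> y Uy; rewrite ltW// chart_density_gt0.
- by move=> A mA AD; exact: nu_chart.
Qed.

Lemma compact_coord_image i (K : set M) : compact K -> K `<=` dom i `&` Om ->
  compact (coord i @` K) /\ coord i @` K `<=` U i.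
Proof.
move=> cK KD; split.
  apply: continuous_compact => //; apply: continuous_in_subspaceT => x /[!inE] Kx.
  by apply: coord_continuous; have [] := KD x Kx.
by move=> _ [x Kx <-]; have [dx Ox] := KD x Kx; exact: chart_image_coord.
Qed.

Lemma compact_param_image i (K : set E) : compact K -> K `<=` U i ->
  compact (param i @` K) /\ param i @` K `<=` dom i `&` Om.
Proof.
move=> cK KU; split.
  apply: continuous_compact => //; apply: continuous_in_subspaceT => y /[!inE] Ky.
  by apply: (@param_cont _ _ _ X Om i); exact: KU.
by move=> _ [y Ky <-]; have [dy Oy _] := chart_imageP (KU y Ky).
Qed.

Let hE : hausdorff_space E. Proof. exact: norm_hausdorff. Qed.
Let hM : hausdorff_space M := manifold_hausdorff X.

Lemma open_cube (c : E) (r : R) : 0 < r -> open [set y : E | forall a, `|y 0 a - c 0 a| < r].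
Proof.
move=> r0; rewrite (_ : [set y : E | _] = ball c r); first exact: ball_open.
apply/seteqP; split=> y /=.
  by move=> H; split=> // i j; rewrite (ord1 i) -ball_normE /= distrC.
by move=> [_ H] a; have := H 0 a; rewrite -ball_normE /= distrC.
Qed.

Lemma chart_cube (V : set M) x : Om x -> open V -> V x ->
  exists (c : E) (r : R), let i := chart_at X x in
    [/\ 0 < r, forall a, `|coord i x 0 a - c 0 a| < r, ccube c r `<=` U i &
        param i @` ccube c r `<=` V].
Proof.
move=> Ox oV Vx; pose i := chart_at X x; have dx := dom_chart_at X x.
have oUV : open (U i `&` param i @^-1` V).
  by apply: open_preimageI => //; [exact: open_chart_image|exact: param_cont].
have [|q [k [xq qU]]] := rat_cube oUV (x := coord i x).
  by split; [exact: chart_image_coord|rewrite /= coordK].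
exists (rat_center q), k.+1%:R^-1; split => //.
- by move=> y yc; have [] := qU y yc.
- by move=> _ [y yc <-]; have [] := qU y yc.
Qed.

(** Each point has a neighbourhood inside the image of a compact coordinate cube, on which the
    continuous chart density has a finite integral; finitely many such neighbourhoods cover K. *)
Lemma nu_compact (K : set M) : compact K -> K `<=` Om -> (nu K < +oo)%E.
Proof.
move=> cK KO.
have H x : exists V : set M, K x -> [/\ open V, V x & (nu V < +oo)%E].
  have [Kx|Kx] := pselect (K x); last by exists set0.
  have Ox := KO x Kx; have [c [r]] := chart_cube Ox openT I.
  set i := chart_at X x => -[r0 xc cU _].
  have [cP PD] := compact_param_image (@compact_ccube _ _ c r) cU.
  exists ((dom i `&` Om) `&` coord i @^-1` [set y | forall a, `|y 0 a - c 0 a| < r]) => _.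
  have oC : open [set y : E | forall a, `|y 0 a - c 0 a| < r].
    exact: open_cube.
  split.
  - apply: open_preimageI => //; first exact: open_domI.
    by move=> z [dz _]; exact: coord_continuous.
  - by split => //; split => //; exact: dom_chart_at.
  - apply: (@le_lt_trans _ _ (nu (param i @` ccube c r))).
      apply: le_measure; rewrite ?inE.
      + apply: borel_open; apply: open_preimageI => //; first exact: open_domI.
        by move=> z [dz _]; exact: coord_continuous.
      + exact: borel_compact.
      + move=> z [[dz Oz] /= zc]; exists (coord i z); last by rewrite coordK.
        by move=> a; apply: ltW; exact: zc.
    have mC := borel_compact hE (@compact_ccube R n c r).
    have -> : nu (param i @` ccube c r) =
        (\int[lam]_(y in (ccube c r : set (borel E))) (chart_density i y)%:E)%E.
      rewrite (@nu_chart i)//; last exact: borel_compact.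
      congr (integral lam _ _); apply/seteqP; split=> y /=.
        move=> [Uy [z zc zy]]; have [_ _ <-] := chart_imageP Uy; rewrite -zy.
        by have [_ _ ->] := chart_imageP (cU z zc).
      by move=> yc; split; [exact: cU|exists y].
    have := @integrable_on_compact _ _ lam _ _ (chart_density i) hE (@compact_ccube R n c r)
       (lam_compact hlam (@compact_ccube R n c r)) (@open_chart_image _ _ _ X Om oOm i) cU
       (fun y Uy => Ck0 (C1_chart_density i) Uy).
    move=> ic; have /integrableP[_] := ic; apply: le_lt_trans; apply: le_integral => //.
    exact: integrable_abse.
    by move=> y _; rewrite lee_abs.
pose V x := sval (cid (H x)).
have HV x : K x -> [/\ open (V x), V x x & (nu (V x) < +oo)%E] by rewrite /V; case: cid.
have [x Kx|s [sK Ks]] := @compact_seq_cover _ K V cK.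
  by have [] := HV x Kx.
apply: (@le_lt_trans _ _ (\sum_(x \in [set` s]) nu (V x))%E).
  apply: content_sub_fsum => //.
  - exact: finite_seq.
  - by move=> x /= /sK/HV[oV _ _]; exact: borel_open.
  - exact: borel_compact.
rewrite fsbig_finite//= big_seq; apply: lte_sum_pinfty => x.
by rewrite (in_fset_set (finite_seq s)) => /set_mem /= /sK/HV[].
Qed.

(** * Functions supported in a chart and partition of unity *)

Definition chart_fun (i : idx X) (psi : E -> R) (x : M) : R :=
  if `[< dom i x >] then psi (coord i x) else 0.

Lemma chart_funE i psi y : U i y -> chart_fun i psi (param i y) = psi y.
Proof. by move=> /chart_imageP[dy _ cy]; rewrite /chart_fun asboolT// cy. Qed.

Lemma chart_fun_ge0 i psi x : (forall y, 0 <= psi y) -> 0 <= chart_fun i psi x.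
Proof. by move=> p0; rewrite /chart_fun; case: ifP. Qed.

Lemma chart_fun_off i psi (K : set E) x : (forall y, ~ K y -> psi y = 0) ->
  ~ (param i @` K) x -> chart_fun i psi x = 0.
Proof.
move=> p0 Kx; rewrite /chart_fun; case: asboolP => // dx.
by apply: p0 => Kc; apply: Kx; exists (coord i x) => //; rewrite coordK.
Qed.

(** At a point of [dom i] the function is psi composed with a smooth transition map. At any other
    point it vanishes nearby, because the image of K is compact, hence closed in a Hausdorff
    space. *)
Lemma Ck_chart_fun k i psi (K : set E) : compact K -> K `<=` U i ->
  (forall y, ~ K y -> psi y = 0) -> Ck k (U i) psi -> Ck_on X k Om (chart_fun i psi).
Proof.
move=> cK KU p0 cpsi j; apply/CkP => y Uy; have [dy Oy cy] := chart_imageP Uy.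
have oUj := @open_chart_image _ _ _ X Om oOm j.
have [diy|diy] := pselect (dom i (param j y)).
  pose V := U j `&` param j @^-1` dom i.
  have oV : open V by apply: open_preimageI => //; [exact: param_cont|exact: open_dom].
  have Vy : V y by [].
  apply: (@Ck_near _ _ _ (fun z => psi (coord i (param j z)))).
    apply: (open_near oV) => // z [Uz dz]; by rewrite /chart_fun asboolT.
  apply: (@Ck_sub _ _ _ _ V) => [_ -> //|].
  apply: (@Ck_compV _ _ k (fun z => coord i (param j z)) V (U i)) => //.
    move=> z [/chart_imageP[_ Oz _] dz]; exact: chart_image_coord.
  move=> b; apply: (@Ck_sub _ _ _ _ (coord j @` (dom j `&` dom i))); last exact: transition_smooth.
  by move=> z [/chart_imageP[djz Oz cz] dz]; exists (param j z).
have [cP PD] := compact_param_image cK KU.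
pose V := U j `&` param j @^-1` (~` (param i @` K)).
have oV : open V.
  apply: open_preimageI => //; first exact: param_cont.
  by apply: closed_openC; exact: compact_closed.
apply: (@Ck_near _ _ _ (fun=> 0)); last exact: Ck_cst.
apply: (open_near oV); last by split => // /PD[].
by move=> z [_ Kz]; rewrite (chart_fun_off p0 Kz).
Qed.

Lemma test_chart_fun i psi : rV_test (U i) psi -> test_function X Om (chart_fun i psi).
Proof.
move=> [spsi [K [cK KU p0]]]; have [cP PD] := compact_param_image cK KU.
split=> [k|]; first exact: (Ck_chart_fun cK KU p0).
exists (param i @` K); split => //; first by move=> x /PD[].
by move=> x; exact: chart_fun_off.
Qed.

(** A partition of unity phrased as an induction principle: an additive property of functions
    supported in a single chart passes to all compactly supported ones. [Q] is a constraint on the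
    values, such as a sign, that survives multiplication by the nonnegative weights. *)
Lemma C1_partition (Q : R -> Prop) (P : (M -> R) -> Prop) :
  (forall a c, Q a -> 0 <= c -> Q (a * c)) -> P (fun=> 0) ->
  (forall f h, P f -> P h -> P (fun x => f x + h x)) ->
  (forall (i : idx X) eta (K : set M), Ck_on X 1 Om eta -> compact K -> K `<=` dom i `&` Om ->
     (forall x, ~ K x -> eta x = 0) -> (forall x, Q (eta x)) -> P eta) ->
  forall eta (K : set M), Ck_on X 1 Om eta -> compact K -> K `<=` Om ->
     (forall x, ~ K x -> eta x = 0) -> (forall x, Q (eta x)) -> P eta.
Proof.
move=> HQ P0 PD Ploc eta K ceta cK KO eta0 Qeta.
have clK : closed K by exact: compact_closed.
have H x : exists (b : M -> R) (Kb V : set M), K x ->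
    [/\ Ck_on X 1 Om b, compact Kb /\ Kb `<=` dom (chart_at X x) `&` Om,
        forall z, ~ Kb z -> b z = 0, forall z, 0 <= b z &
        [/\ open V, V x & forall z, V z -> 0 < b z]].
  have [Kx|Kx] := pselect (K x); last by exists (fun=> 0), set0, set0.
  have Ox := KO x Kx; have [c [r]] := chart_cube Ox openT I.
  set i := chart_at X x => -[r0 xc cU _]; have dx := dom_chart_at X x.
  have cC := @compact_ccube R n c r.
  have [cP PDm] := compact_param_image cC cU.
  have off y : ~ ccube c r y -> cube_bump c r y = 0 by exact: bump_eq0.
  exists (chart_fun i (cube_bump c r)), (param i @` ccube c r),
    ((dom i `&` Om) `&` coord i @^-1` [set y | forall a, `|y 0 a - c 0 a| < r]) => _.
  split => //.
  - apply: (Ck_chart_fun cC cU off).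
    by apply: (@Ck_sub _ _ _ _ setT) => //; exact: smooth_bump.
  - by move=> z; exact: (chart_fun_off off).
  - by move=> z; apply: chart_fun_ge0; exact: bump_ge0.
  split.
  - apply: open_preimageI; [exact: open_domI| |exact: open_cube].
    by move=> z [dz _]; exact: coord_continuous.
  - by split => //; split.
  - by move=> z [[dz Oz] /= zc]; rewrite /chart_fun asboolT//; exact: bump_gt0.
have [b Hb] := choice H; have [Kb {}Hb] := choice Hb; have {Hb}[V Hb] := choice Hb.
have [|s [sK Ks]] := @compact_seq_cover _ K V cK.
  by move=> x /Hb[_ _ _ _ [oV Vx _]].
pose S z := \sum_(x <- s) b x z.
have b0 x z : x \in s -> 0 <= b x z by move=> /sK/Hb[_ _ _ + _]; exact.
have S0 z : K z -> 0 < S z.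
  move=> /Ks[x xs Vz]; have [_ _ _ _ [_ _ /(_ z Vz) bz]] := Hb x (sK x xs).
  rewrite /S (big_rem x)//= ltr_pwDl// big_seq sumr_ge0// => w /mem_rem; exact: b0.
have cS : Ck_on X 1 Om S.
  move=> j; rewrite /S.
  have -> : (fun y => \sum_(x <- s) b x (param j y)) =
      (fun y => \sum_(x <- s | x \in s) b x (param j y)).
    by apply/funext => y; rewrite big_seq.
  apply: Ck_sum; first exact: open_chart_image.
  by move=> x /sK/Hb[cb _ _ _ _]; exact: cb.
pose e x z := eta z * (b x z * (S z)^-1).
(* Near a point of K the sum S stays positive and the quotient is C^1. The complement of K is open
   and eta vanishes there, whatever the value of the inverse of S. *)
have ce x : x \in s -> Ck_on X 1 Om (e x).
  move=> xs j; apply/CkP => y Uy; have [dy Oy cy] := chart_imageP Uy.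
  have oUj := @open_chart_image _ _ _ X Om oOm j.
  have cp := fun z => @param_cont _ _ _ X Om j z.
  have [Ky|Ky] := pselect (K (param j y)).
    have oV : open (U j `&` (rep j S) @^-1` [set t | 0 < t]).
      apply: open_preimageI => //.
      by move=> z Uz; exact: Ck0 (cS j) Uz.
    pose f z := eta (param j z) * (b x (param j z) * S (param j z) `^ (-1)).
    have [cb _ _ _ _] := Hb x (sK x xs).
    have cf : Ck 1 (U j `&` (rep j S) @^-1` [set t | 0 < t]) f.
      apply: CkM => //; first exact: Ck_sub (@subIsetl _ _ _) (ceta j).
      apply: CkM => //; first exact: Ck_sub (@subIsetl _ _ _) (cb j).
      apply: C1_powR => //; first by move=> z [].
      exact: Ck_sub (@subIsetl _ _ _) (cS j).
    apply: (@Ck_near _ _ _ f); last first.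
      by apply: Ck_sub cf => _ ->; split => //; exact: S0.
    apply: (open_near oV); last by split => //; exact: S0.
    by move=> z [Uz /= Sz]; rewrite /f /e powR_inv1// ltW.
  have oV : open (U j `&` param j @^-1` (~` K)).
    by apply: open_preimageI => //; exact: closed_openC.
  apply: (@Ck_near _ _ _ (fun=> 0)); last exact: Ck_cst.
  by apply: (open_near oV) => // z [_ Kz]; rewrite /e eta0// mul0r.
have Pe x : x \in s -> P (e x).
  move=> xs; have [cb [cKb KbD] boff _ _] := Hb x (sK x xs).
  apply: (Ploc (chart_at X x) (e x) (Kb x) (ce x xs) cKb KbD).
    by move=> z Kz; rewrite /e boff// mul0r mulr0.
  move=> z; apply: HQ => //; rewrite mulr_ge0 ?b0// invr_ge0 /S big_seq sumr_ge0// => w; exact: b0.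
have -> : eta = (fun z => \sum_(x <- s) e x z).
  apply/funext => z; rewrite /e -mulr_sumr -mulr_suml -/(S z).
  have [Kz|Kz] := pselect (K z); last by rewrite eta0// mul0r.
  by rewrite mulfV ?mulr1// gt_eqF// S0.
have : forall s', {subset s' <= s} -> P (fun z => \sum_(x <- s') e x z).
  elim=> [|x s' IH] ss.
    by rewrite (_ : (fun z => _) = (fun=> 0))//; apply/funext => z; rewrite big_nil.
  rewrite (_ : (fun z => _) = (fun z => e x z + \sum_(x <- s') e x z)).
    apply: PD; first by apply/Pe/ss; rewrite inE eqxx.
    by apply: IH => w ws; apply: ss; rewrite inE ws orbT.
  by apply/funext => z; rewrite big_cons.
exact.
Qed.

Local Notation m := chart_density.
Local Notation nu_locint := (locally_integrable_on nu Om).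
Local Notation OmB := (Om : set (borel M)).
Local Notation UB i := (U i : set (borel E)).
Implicit Types (f : M -> R) (K : set M).

Let mO : measurable OmB. Proof. exact: borel_open. Qed.
Let oU i : open (U i). Proof. exact: open_chart_image. Qed.
Let mD (i : idx X) : measurable (dom i `&` Om : set (borel M)). Proof. exact: measurable_domI. Qed.
Let cm i : Ck 0 (U i) (m i). Proof. exact: CkW (C1_chart_density i). Qed.
Let m0 i y : U i y -> 0 < m i y. Proof. exact: chart_density_gt0. Qed.

Let lfin i (K : set E) : compact K -> K `<=` U i -> (lam K < +oo)%E.
Proof. by move=> cK _; exact: lam_compact. Qed.

Lemma continuous_inv_chart_density i : Ck 0 (U i) (fun y => (m i y)^-1).
Proof.
by move=> y Uy; apply: (continuousV _ (@cm i y Uy)); rewrite gt_eqF// m0.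
Qed.

Lemma measurable_chart_pull i f :
  measurable_fun (UB i) (rep i f : borel E -> R) ->
  measurable_fun (dom i `&` Om : set (borel M)) (f : borel M -> R).
Proof.
move=> mf; apply: (@eq_measurable_fun _ _ (borel M) R _ (fun x : borel M => rep i f (coord i x))).
  by move=> x /[!inE] -[dx _]; rewrite /rep coordK.
apply: (measurable_comp (@mU i) _ mf).
  by move=> _ [x [dx Ox] <-]; exact: chart_image_coord.
apply: continuous_on_measurable_borel; first exact: open_domI.
by move=> x [dx _]; exact: coord_continuous.
Qed.

Lemma integral_chart i K f : compact K -> K `<=` dom i `&` Om -> (forall x, ~ K x -> f x = 0) ->
  nu.-integrable OmB (fun x : borel M => (f x)%:E) ->
  lam.-integrable (UB i) (fun y => (f (param i y) * m i y)%:E) /\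
  (\int[nu]_(x in OmB) (f x)%:E =
   \int[lam]_(y in (UB i)) (f (param i y) * m i y)%:E)%E.
Proof.
move=> cK KD f0 fi.
have fi' : nu.-integrable (dom i `&` Om : set (borel M)) (EFin \o f).
  by apply: integrableS fi; [exact: borel_open|exact: mD|exact: subIsetr].
have /integrableP[/measurable_EFinP mf _] := fi'; split.
  exact/(nu_integrable mf).
rewrite -(nu_integral mf).
apply: integral_zero_off; first exact: subIsetr.
by move=> x Ox Dx; rewrite f0// => /KD.
Qed.

Lemma integrable_chart i K f : compact K -> K `<=` dom i `&` Om -> (forall x, ~ K x -> f x = 0) ->
  lam.-integrable (UB i) (fun y => (f (param i y) * m i y)%:E) ->
  nu.-integrable OmB (fun x : borel M => (f x)%:E).
Proof.
move=> cK KD f0 fi.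
have mf : measurable_fun (dom i `&` Om : set (borel M)) (f : borel M -> R).
  have /integrableP[/measurable_EFinP mfm _] := fi.
  have mi := continuous_on_measurable (@oU i) (@continuous_inv_chart_density i).
  apply: (measurable_chart_pull (i := i)).
  apply: eq_measurable_fun (measurable_funM mfm mi) => y /[!inE] Uy.
  by rewrite /= mulfK// gt_eqF// m0.
apply: (@integrable_zero_off _ _ _ (dom i `&` Om)) => //.
- by move=> x Ox Dx; rewrite f0// => /KD.
- exact/(nu_integrable mf).
Qed.

(** The chart density is continuous and positive, so it can be divided out. [f] is cut off outside
    the image of K because [integral_chart] transports functions supported in a compact subset of
    the chart. *)
Lemma locally_integrable_chart i f : nu_locint f ->
  locally_integrable_on lam (U i) (rep i f).
Proof.
move=> fi; apply: (locint_eq hE (f := fun y => (m i y)^-1 * (rep i f y * m i y))) => [y Uy|].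
  by rewrite mulrC mulfK// gt_eqF// m0.
apply: (locintM hE (@oU i)) => [|K cK KU]; first exact: continuous_inv_chart_density.
have [cP PD] := compact_param_image cK KU.
have fiP := fi _ cP (fun x Px => (PD x Px).2).
pose h x := if `[< (param i @` K) x >] then f x else 0.
have hi : nu.-integrable OmB (fun x : borel M => (h x)%:E).
  apply: (@integrable_zero_off _ _ _ (param i @` K)) => //.
  - exact: borel_compact.
  - by move=> x /PD[].
  - by move=> x _ Px; rewrite /h asboolF.
  - apply: eq_integrable fiP => [|x /[!inE] Px]; first exact: borel_compact.
    by rewrite /h asboolT.
have [] := integral_chart cP PD _ hi; first by move=> x Px; rewrite /h asboolF.
move=> hU _; have mK := borel_compact hE cK.
apply: eq_integrable (integrableS (@mU i) mK KU hU) => // y /[!inE] Ky.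
by rewrite /h asboolT//; exists y.
Qed.

(** Over the preimage of a nu-null set the chart density has integral 0; as it is positive, that
    preimage is null for [lam]. *)
Lemma ae_chart i (P : M -> Prop) : {ae nu, forall x : borel M, P x} ->
  {ae lam, forall y : borel E, U i y -> P (param i y)}.
Proof.
move=> [N [mN N0 PN]].
pose N' := N `&` (dom i `&` Om); have mN' : measurable (N' : set (borel M)) by exact: measurableI (@mD i).
pose D : set (borel E) := U i `&` param i @^-1` N'.
have DU : D `<=` U i by exact: subIsetl.
have mDD : measurable D by exact: measurable_param.
have N'0 : nu N' = 0%E.
  apply/eqP; rewrite -measure_le0 -[leRHS]N0; apply: le_measure; rewrite ?inE//.
  exact: subIsetl.
exists D; split => //; last first.
  move=> y /= /not_implyP[Uy Py]; have [dy Oy _] := chart_imageP Uy.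
  by split => //; split => //; exact: PN.
have mm : measurable_fun D (EFin \o (m i : borel E -> R)).
  apply/measurable_EFinP.
  have H := measurable_funS (@mU i) DU (measurable_chart_density (i:=i)).
  exact H.
have I0 : (\int[lam]_(y in D) `|(m i y)%:E| = 0)%E.
  rewrite -N'0 (nu_chart (i := i) mN')//; last exact: subIsetr.
  by apply: eq_integral => y /[!inE] -[Uy _]; rewrite abse_EFin gtr0_norm// m0.
have [Z [mZ Z0 DZ]] := (ae_eq_integral_abs lam mDD mm).1 I0.
apply/eqP; rewrite -measure_le0 -[leRHS]Z0; apply: le_measure; rewrite ?inE//.
move=> y Dy; apply: DZ => /= /(_ Dy)[] my; have := @m0 i y Dy.1.
by rewrite my ltxx.
Qed.

Lemma Linfty_chart i V : Linfty_loc nu Om V -> Linfty_loc lam (U i) (rep i V).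
Proof.
move=> [mV HV]; split.
  apply: (measurable_comp (borel_open oOm) _ mV); last exact: measurable_param.
  by move=> _ [y /chart_imageP[_ Oy _] <-].
move=> K cK KU; have [cP PD] := compact_param_image cK KU.
have [C HC] := HV _ cP (fun x Px => (PD x Px).2).
exists C; apply: filterS (ae_chart i HC) => y H Ky.
by apply: H; [exact: KU|exists y].
Qed.

(** * The flux of v0, weak gradients and test functions *)

Variables (p : R) (v0 : M -> R).
Hypotheses (p1 : 1 < p) (cv0 : Ck_on X 2 Om v0).
Hypothesis gv0 : forall x, Om x -> vnorm g (grad g v0) x != 0.

Definition speed2 (x : M) : R := inner g (grad g v0) (grad g v0) x.

Lemma speed2_gt0 x : Om x -> 0 < speed2 x.
Proof.
by move=> Ox; rewrite /speed2 vnorm_inner exprn_even_gt0//= gv0.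
Qed.

Lemma vnorm_powR (Y : vector_field X) (r : R) x :
  vnorm g Y x `^ r = inner g Y Y x `^ (r / 2).
Proof. by rewrite /vnorm -powR12_sqrt ?inner_ge0// -powRrM mulrC. Qed.

(** The field |grad v0|^(p-2) grad v0 times the density of nu. Expressing it through |grad v0|^2, a
    positive C^1 function, makes its regularity visible. *)
Definition chart_flux (i : idx X) (a : 'I_n) (y : E) : R :=
  speed2 (param i y) `^ ((p - 2) / 2) * grad g v0 i (param i y) 0 a * m i y.

Lemma C1_chart_flux i a : Ck 1 (U i) (chart_flux i a).
Proof.
apply: (CkM (@oU i) (CkM (@oU i) _ (C1_grad g oOm i a cv0)) (C1_chart_density i)).
apply: C1_powR => [//|y /chart_imageP[_ Oy _]|]; first exact: speed2_gt0.
exact: (C1_inner_grad g oOm cv0 cv0 i).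
Qed.

Lemma flux_chart i eta y : Ck_on X 1 Om eta -> U i y ->
  flux (chart_flux i) (rep i eta) y =
  speed2 (param i y) `^ ((p - 2) / 2) * inner g (grad g v0) (grad g eta) (param i y) * m i y.
Proof.
move=> ceta Uy; have [dy Oy cy] := chart_imageP Uy.
rewrite (inner_grad g oOm (grad_vector_field g oOm (Ck_onW cv0)) ceta Oy dy) cy.
rewrite /flux mulr_sumr mulr_suml; apply: eq_bigr => a _; rewrite /chart_flux; ring.
Qed.

(** A C^2 condition on F formulated through its logarithmic derivative q, in which the residuals are
    naturally written. It is imposed only at values of [v0], where the profile of v1 is
    controlled. *)
Definition log_profile (F q dq : R -> R) := forall x, Om x ->
  [/\ 0 < F (v0 x), is_derive (v0 x) 1 F (F (v0 x) * q (v0 x)),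
      is_derive (v0 x) 1 q (dq (v0 x)) & {for v0 x, continuous dq}].

Lemma grad_off K eta : compact K -> (forall x, ~ K x -> eta x = 0) ->
  forall i x, ~ K x -> dom i x -> grad g eta i x = 0.
Proof.
move=> cK eta0 i x Kx dx.
have oK : open (~` K) by apply: closed_openC; exact: compact_closed.
rewrite (eq_grad g oK (phi := fun=> 0) eta0 Kx dx) /grad.
rewrite (_ : differential _ i x = 0) ?mul0mx//.
by apply/rowP => a; rewrite !mxE partial_cst.
Qed.

(* Cauchy-Schwarz bounds the components of the covector dual to Y by its norm,
   so that they are locally integrable. *)
Lemma weak_gradient_unique (u : M -> R) (Y : vector_field X) i : Ck_on X 1 Om u ->
  W1p_loc g lam nu p Om u Y ->
  {ae lam, forall y : borel E, U i y -> Y i (param i y) = grad g u i (param i y)}.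
Proof.
move=> cu [_ [hY mY] iY wY].
pose c a y := (Y i (param i y) *m gram g i (param i y)) 0 a.
pose d a := partial a (rep i u).
have cG a b : Ck 0 (U i) (fun y => gram g i (param i y) a b).
  apply: (@Ck_sub _ _ _ _ (coord i @` dom i)); last exact: gram_smooth.
  by move=> _ [x [dx _] <-]; exists x.
have mc a : measurable_fun (UB i) (c a : borel E -> R).
  rewrite (_ : c a = fun y => \sum_b Y i (param i y) 0 b * gram g i (param i y) b a); last first.
    by apply/funext => y; rewrite /c mxE.
  apply: measurable_sum => b; apply: measurable_funM.
    have mYb := mY i b; rewrite setIC in mYb.
    have sub : param i @` U i `<=` dom i `&` Om by move=> _ [y /chart_imageP[dy Oy _] <-].
    by refine (measurable_comp (@mD i) _ mYb (measurable_param (i := i))); exact: sub.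
  by apply: continuous_on_measurable => //; exact: cG.
have cd a : Ck 0 (U i) (d a) by have [_] := cu i; exact.
have ic a : locally_integrable_on lam (U i) (c a).
  apply: (locint_le hE (@oU i) (h := fun y => Num.sqrt (gram g i (param i y) a a) *
    (1 + rep i (fun x => vnorm g Y x `^ p) y))) => //.
    move=> y Uy; have [dy Oy _] := chart_imageP Uy; rewrite /rep; set x := param i y.
    have := posdef_cauchy_schwarz (Y i x) (delta_mx 0 a : 'rV_n) (fun w => @gram_posdef _ _ _ _ g i x w dy)
      (gram_sym g dy).
    rewrite trmx_delta -colE mxE -(inner_chart g hY hY Oy dy) -rowE -!colE 2!mxE => cs.
    have := ler_wsqrtr cs; rewrite sqrtr_sqr sqrtrM ?inner_ge0// => {}cs.
    rewrite /c mxE (le_trans cs)// [row _ _ _ _]mxE mulrC ler_wpM2l ?sqrtr_ge0// -/(vnorm g Y x).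
    (* As p > 1, |Y| <= 1 + |Y|^p, and the right-hand side is locally integrable. *)
    have [v1|v1] := leP (vnorm g Y x) 1; first by rewrite ler_wpDr// powR_ge0.
    rewrite ler_wpDl// -[leLHS]powRr1 ?sqrtr_ge0// ler_powR// ?ltW//.
  apply: (locintM hE (@oU i)) => [y Uy|].
    apply: continuous_comp; [exact: cG|exact: sqrt_continuous].
  apply: (locintD hE); last exact (locally_integrable_chart (i := i) iY).
  by apply: (locint_continuous hE (@oU i) (@lfin i)) => y _; exact: cst_continuous.
have id_ a : locally_integrable_on lam (U i) (d a) by exact: (locint_continuous hE (@oU i) (@lfin i) (cd a)).
have icd a : locally_integrable_on lam (U i) (fun y => c a y - d a y).
  apply: (locint_eq hE (f := fun y => c a y + (-1) * d a y)) => [y _|]; first by rewrite mulN1r.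
  exact: (locintD hE (ic a) (locintZ hE (-1) (id_ a))).
(* The tested integrals vanish for every s, since the C^1 function u can be integrated by parts
   classically as well. The values 1 and -1 of s then give equality almost everywhere. *)
have H a (s : R) : {ae lam, forall y : borel E, U i y -> 0 <= s * (c a y - d a y)}.
  apply: (ae_ge0_of_test (@oU i)) => [K cK KU|psi tpsi _].
    exact: (locintZ hE s (icd a)).
  have [spsi [K [cK KU psi0]]] := tpsi.
  have [_ i2 ibp] := integration_by_parts hlam a (@oU i) cK KU (cu i) (spsi 1%N) psi0.
  have i1 : lam.-integrable (UB i) (EFin \o (fun y => c a y * psi y)).
    apply: (locint_integrable hE (@oU i) _ cK KU) => [|y _ /psi0 ->]; last by rewrite mulr0.
    apply: (locint_eq hE (f := fun y => psi y * c a y)) => [y _|]; first by rewrite mulrC.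
    by apply: (locintM hE (@oU i)) => // y Uy; exact: Ck0 (spsi 0%N) Uy.
  have E1 : (\int[lam]_(y in (UB i)) (c a y * psi y)%:E =
             \int[lam]_(y in (UB i)) (d a y * psi y)%:E)%E.
    by apply: oppe_inj; rewrite -[RHS]ibp; exact: esym (wY i a psi tpsi).
  have E0 : (\int[lam]_(y in (UB i)) (c a y * psi y - d a y * psi y)%:E = 0)%E.
    by rewrite integralB_EFin// E1 subee// integrable_fin_num.
  have i3 : lam.-integrable (UB i) (EFin \o (fun y => c a y * psi y - d a y * psi y)).
    by have := integrableB (@mU i) i1 i2; apply: eq_integrable => // y _; rewrite /= EFinB.
  have := integralZl (@mU i) i3 s; rewrite [X in (_ * X)%E]E0 mule0 => E2.
  rewrite (_ : integral _ _ _ = 0%E)// -E2; apply: eq_integral => y _.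
  by rewrite /= -EFinM -mulrBl mulrA.
have Hcd : {ae lam, forall y : borel E, forall a, U i y -> c a y = d a y}.
  apply: filter_forall => a; apply: filterS2 (H a 1) (H a (-1)) => y h1 h2 Uy.
  apply/eqP; rewrite -subr_eq0 eq_le; have := h1 Uy; have := h2 Uy.
  by rewrite mul1r mulN1r oppr_ge0 => -> ->.
apply: filterS Hcd => y Hy Uy; have [dy Oy cy] := chart_imageP Uy.
rewrite /grad -[LHS](mulmxK (gram_unit g dy)); congr (_ *m _).
by apply/rowP => a; rewrite [LHS]Hy// mxE cy.
Qed.

Lemma inner_gradD (Y : vector_field X) f h x : vector_field_on Om Y ->
  Ck_on X 1 Om f -> Ck_on X 1 Om h -> Om x ->
  inner g Y (grad g (fun z => f z + h z)) x = inner g Y (grad g f) x + inner g Y (grad g h) x.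
Proof.
move=> hY cf ch Ox; have dx := dom_chart_at X x; have Ux := chart_image_coord dx Ox.
rewrite (inner_grad g oOm hY (Ck_onD oOm cf ch) Ox dx).
rewrite (inner_grad g oOm hY cf Ox dx) (inner_grad g oOm hY ch Ox dx).
rewrite -big_split/=; apply: eq_bigr => a _.
by rewrite partialD ?mulrDr//; [exact: (Ck_diff (cf _))|exact: (Ck_diff (ch _))].
Qed.

Lemma inner_gradM (Y : vector_field X) f h x : vector_field_on Om Y ->
  Ck_on X 1 Om f -> Ck_on X 1 Om h -> Om x ->
  inner g Y (grad g (fun z => f z * h z)) x =
  f x * inner g Y (grad g h) x + h x * inner g Y (grad g f) x.
Proof.
move=> hY cf ch Ox; have dx := dom_chart_at X x; have Ux := chart_image_coord dx Ox.
rewrite (inner_grad g oOm hY (Ck_onM oOm cf ch) Ox dx).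
rewrite (inner_grad g oOm hY cf Ox dx) (inner_grad g oOm hY ch Ox dx).
rewrite !mulr_sumr -big_split/=; apply: eq_bigr => a _.
rewrite partialM; [|exact: (Ck_diff (cf _))|exact: (Ck_diff (ch _))].
by rewrite /rep coordK//; ring.
Qed.

Lemma inner_grad_comp1 (Y : vector_field X) f (h : R -> R) dh x : vector_field_on Om Y ->
  Ck_on X 1 Om f -> Ck_on X 1 Om (fun z => h (f z)) -> Om x -> is_derive (f x) 1 h dh ->
  inner g Y (grad g (fun z => h (f z))) x = dh * inner g Y (grad g f) x.
Proof.
move=> hY cf ch Ox hd; have dx := dom_chart_at X x; have Ux := chart_image_coord dx Ox.
rewrite (inner_grad g oOm hY ch Ox dx) (inner_grad g oOm hY cf Ox dx) mulr_sumr; apply: eq_bigr => a _.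
have hd' : is_derive (rep (chart_at X x) f (coord (chart_at X x) x)) 1 h dh.
  by rewrite /rep coordK.
by rewrite (partial_comp1 a hd' (Ck_diff (cf _) Ux)); ring.
Qed.

Lemma continuous_vnorm_powR f x : Ck_on X 1 Om f -> Om x ->
  {for x, continuous (fun z => vnorm g (grad g f) z `^ p)}.
Proof.
move=> cf Ox; have cI : {for x, continuous (inner g (grad g f) (grad g f))}.
  have c0 : Ck_on X 0 Om (inner g (grad g f) (grad g f)) by exact: C0_inner_grad.
  exact: (Ck_on_continuous c0 Ox).
rewrite (_ : (fun z => _) = (fun z => `|vnorm g (grad g f) z| `^ p)); last first.
  by apply/funext => z; rewrite ger0_norm ?sqrtr_ge0.
apply: (@continuous_comp _ _ _ (vnorm g (grad g f)) (fun t => `|t| `^ p)); last first.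
  exact: is_derive_continuous (is_derive_norm_powR p1 _).
apply: (@continuous_comp _ _ _ (inner g (grad g f) (grad g f)) Num.sqrt) => //.
exact: sqrt_continuous.
Qed.

Lemma continuous_rep (h : M -> R) i : (forall x, Om x -> {for x, continuous h}) ->
  Ck 0 (U i) (rep i h).
Proof.
move=> ch y Uy; have [_ Oy _] := chart_imageP Uy.
by apply: (@continuous_comp _ _ _ (param i) h); [exact: param_cont Uy|exact: ch].
Qed.

Local Notation weak V u eta :=
  (fun x : borel M => (weak_integrand g p V u (grad g u) eta x)%:E).

(** The factor s treats both notions at once: s = 1 expresses a supersolution, and s = 1 together
    with s = -1 a solution. *)
Definition weak_sign (s : R) (V u eta : M -> R) : Prop :=
  nu.-integrable OmB (weak V u eta) /\ (0 <= s%:E * \int[nu]_(x in OmB) weak V u eta x)%E.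

(** Wider than the smooth test functions, so as to contain |phi|^p u^(1-p). *)
Definition C1_test (eta : M -> R) : Prop := Ck_on X 1 Om eta /\
  exists K, [/\ compact K, K `<=` Om & forall x, ~ K x -> eta x = 0].

Lemma test_C1 phi : test_function X Om phi -> C1_test phi.
Proof. by move=> [sphi supp]; split => //; exact: sphi. Qed.

(** * The equation for a function of v0 *)

Section profile.
Variables (F q dq : R -> R) (u : M -> R).
Hypotheses (hF : log_profile F q dq) (uF : forall x, Om x -> u x = F (v0 x)).
Hypothesis iw : nu_locint (fun x => `|q (v0 x)| `^ (p - 2)).

Definition flux_term (w : M -> R) eta x : R :=
  vnorm g (grad g w) x `^ (p - 2) * inner g (grad g w) (grad g eta) x.

Lemma C1_profile : Ck_on X 1 Om u.
Proof.
apply: (eq_Ck_on oOm (phi := u) (u := fun x => F (v0 x))) => [x /uF//|].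
apply: (C1_on_comp1 oOm (dh := fun s => F s * q s)) => [x /hF[]//|x /hF[_ dF dq' _]|]; last exact: Ck_onW.
exact: continuousM (is_derive_continuous dF) (is_derive_continuous dq').
Qed.

Lemma continuous_profile x : Om x ->
  {for x, continuous (fun z => F (v0 z) `^ (p - 1))} /\ {for x, continuous (fun z => q (v0 z))}.
Proof.
move=> Ox; have [F0 dF dq' _] := hF Ox.
have cv : {for x, continuous v0} by exact: Ck_on_continuous cv0 Ox.
split.
  apply: (@continuous_comp _ _ _ v0 (fun s => F s `^ (p - 1))) => //.
  apply: (@continuous_comp _ _ _ F (fun s => s `^ (p - 1))); last exact: continuous_powR_pos.
  exact: is_derive_continuous dF.
apply: (@continuous_comp _ _ _ v0 q) => //.
exact: is_derive_continuous dq'.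
Qed.

Lemma grad_profile i x : Om x -> dom i x ->
  grad g u i x = (F (v0 x) * q (v0 x)) *: grad g v0 i x.
Proof.
move=> Ox dx; rewrite (eq_grad g oOm uF Ox dx).
by have [_ dF _ _] := hF Ox; exact: (grad_comp1 g (Ck_onW cv0) Ox dx dF).
Qed.

Lemma vnorm_grad_profile x : Om x ->
  vnorm g (grad g u) x = F (v0 x) * `|q (v0 x)| * vnorm g (grad g v0) x.
Proof.
move=> Ox; rewrite (vnormZ g (fun i => @grad_profile i x Ox)).
by have [F0 _ _ _] := hF Ox; rewrite normrM gtr0_norm.
Qed.

Lemma powR_profile x : Om x -> `|u x| `^ (p - 2) * u x = F (v0 x) `^ (p - 1).
Proof.
move=> Ox; have [F0 _ _ _] := hF Ox; rewrite uF// gtr0_norm// powR_mulr//.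
by congr (_ `^ _); ring.
Qed.

Lemma flux_term_profile eta x : Om x -> flux_term u eta x =
  F (v0 x) `^ (p - 1) * spow p (q (v0 x)) *
    (speed2 x `^ ((p - 2) / 2) * inner g (grad g v0) (grad g eta) x).
Proof.
move=> Ox; have [F0 _ _ _] := hF Ox; rewrite /flux_term vnorm_grad_profile//.
rewrite (innerZl g _ (fun i => @grad_profile i x Ox)).
rewrite powRM ?mulr_ge0 ?sqrtr_ge0 ?normr_ge0 ?ltW// powRM ?normr_ge0 ?ltW//.
rewrite vnorm_powR -/(speed2 x) -powR_profile// uF// (gtr0_norm F0) /spow.
by set a := _ `^ _; set b := _ `^ _; set c := _ `^ _; ring.
Qed.

(** In coordinates, the p-Laplacian of u times the chart density; the last flux is |grad v0|^p times
    that density. Where q vanishes the expression follows the power convention, and the integral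
    identity of [flux_integral] holds with this value. *)
Definition profile_div i (y : E) : R :=
  F (v0 (param i y)) `^ (p - 1) * `|q (v0 (param i y))| `^ (p - 2) *
  (q (v0 (param i y)) * flux_div (chart_flux i) y +
   (p - 1) * (q (v0 (param i y)) ^+ 2 + dq (v0 (param i y))) * flux (chart_flux i) (rep i v0) y).

Lemma flux_integral i K eta : Ck_on X 1 Om eta -> compact K -> K `<=` dom i `&` Om ->
  (forall x, ~ K x -> eta x = 0) ->
  [/\ nu.-integrable OmB (fun x : borel M => (flux_term u eta x)%:E),
      lam.-integrable (UB i) (fun y : borel E => (- profile_div i y * rep i eta y)%:E) &
      (\int[nu]_(x in OmB) (flux_term u eta x)%:E =
       \int[lam]_(y in (UB i)) (- profile_div i y * rep i eta y)%:E)%E].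
Proof.
move=> ceta cK KD eta0; have [cC CU] := compact_coord_image cK KD.
(* [param i] is arbitrary outside the chart image, so the representative is set to 0 there in order
   to vanish off a compact set of the whole coordinate space. *)
pose psi y := if `[< U i y >] then rep i eta y else 0.
have psiE y : U i y -> psi y = rep i eta y by move=> Uy; rewrite /psi asboolT.
have cpsi : Ck 1 (U i) psi by apply: (Ck_eq (@oU i) _ (ceta i)) => y /psiE.
have psi0 y : ~ (coord i @` K) y -> psi y = 0.
  rewrite /psi; case: asboolP => // Uy Cy; apply: eta0 => Ky; apply: Cy.
  by exists (param i y) => //; have [_ _] := chart_imageP Uy.
have fluxE y : U i y -> flux (chart_flux i) psi y = flux (chart_flux i) (rep i eta) y.
  move=> Uy; apply: eq_bigr => a _; congr (_ * _).
  by apply: (eq_partial _ (@oU i) _ Uy) => z /psiE.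
have Ft y : U i y -> [/\ 0 < F (rep i v0 y),
    is_derive (rep i v0 y) 1 F (F (rep i v0 y) * q (rep i v0 y)),
    is_derive (rep i v0 y) 1 q (dq (rep i v0 y)) & {for rep i v0 y, continuous dq}].
  by move=> /chart_imageP[_ Oy _]; exact: hF.
have [||||i1 i2 I12] := @profile_flux _ _ lam hlam (U i) (chart_flux i) (rep i v0) (@oU i)
  (C1_chart_flux i) (Ck_onW cv0 i) p _ (fun s => F s `^ (p - 1)) q dq psi cC CU cpsi psi0.
- move=> y /Ft[F0 dF _ _].
  have d1 := @is_derive1_comp R (fun x => x `^ (p - 1)) F (rep i v0 y) _ _
    (is_derive1_powR (p - 1) F0) dF.
  apply: is_derive_eq d1 _; set f := F _ in F0 *.
  have -> : f `^ (p - 1) = f `^ (p - 1 - 1) * f.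
    by rewrite powR_mulr//; congr (_ `^ _); ring.
  by ring.
- by move=> y /Ft[].
- by move=> y /Ft[].
- exact (locally_integrable_chart (i := i) iw).
have e1 y : U i y -> F (rep i v0 y) `^ (p - 1) * spow p (q (rep i v0 y)) *
    flux (chart_flux i) psi y = flux_term u eta (param i y) * m i y.
  move=> Uy; have [_ Oy _] := chart_imageP Uy.
  rewrite fluxE// flux_chart// flux_term_profile//; ring.
have e2 y : U i y -> - (F (rep i v0 y) `^ (p - 1) * `|q (rep i v0 y)| `^ (p - 2) *
    (q (rep i v0 y) * flux_div (chart_flux i) y + (p - 1) *
     (q (rep i v0 y) ^+ 2 + dq (rep i v0 y)) * flux (chart_flux i) (rep i v0) y)) * psi y =
    - profile_div i y * rep i eta y.
  by move=> Uy; rewrite psiE.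
have {}i1 : lam.-integrable (UB i)
    (fun y => (flux_term u eta (param i y) * m i y)%:E).
  by apply: eq_integrable i1 => // y /[!inE] Uy; rewrite e1.
have f0 x : ~ K x -> flux_term u eta x = 0.
  move=> Kx; rewrite /flux_term /inner (grad_off cK eta0 Kx (dom_chart_at X x)).
  by rewrite trmx0 mulmx0 mxE mulr0.
have inu := integrable_chart cK KD f0 i1.
split => //; first by apply: eq_integrable i2 => // y /[!inE] Uy; rewrite e2.
have [_ ->] := integral_chart cK KD f0 inu.
transitivity (\int[lam]_(y in (UB i))
   (F (rep i v0 y) `^ (p - 1) * spow p (q (rep i v0 y)) * flux (chart_flux i) psi y)%:E)%E.
  by apply: eq_integral => y /[!inE] Uy; rewrite e1.
by rewrite I12; apply: eq_integral => y /[!inE] Uy; rewrite e2.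
Qed.

(* The density of Q_V(u) with respect to lam in chart i. *)
Definition residual (V : M -> R) i (y : E) : R :=
  V (param i y) * F (v0 (param i y)) `^ (p - 1) * m i y - profile_div i y.

Definition residual_ge0 (s : R) V i : Prop :=
  {ae lam, forall y : borel E, U i y -> 0 <= s * residual V i y}.

Lemma weak_residual V i K eta : Ck_on X 1 Om eta -> compact K -> K `<=` dom i `&` Om ->
  (forall x, ~ K x -> eta x = 0) ->
  nu_locint (fun x => V x * F (v0 x) `^ (p - 1)) ->
  [/\ nu.-integrable OmB
        (weak V u eta),
      lam.-integrable (UB i) (fun y : borel E => (residual V i y * rep i eta y)%:E) &
      (\int[nu]_(x in OmB) weak V u eta x =
       \int[lam]_(y in (UB i)) (residual V i y * rep i eta y)%:E)%E].
Proof.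
move=> ceta cK KD eta0 iV; have [i1 i2 I12] := flux_integral ceta cK KD eta0.
have KO : K `<=` Om by move=> x /KD[].
pose z x := V x * F (v0 x) `^ (p - 1) * eta x.
have z0 x : ~ K x -> z x = 0 by move=> /eta0; rewrite /z => ->; rewrite mulr0.
have i3 : nu.-integrable OmB (fun x : borel M => (z x)%:E).
  apply: (locint_integrable hM oOm _ cK KO) => [|x _ /z0//].
  apply: (locint_eq hM (f := fun x => eta x * (V x * F (v0 x) `^ (p - 1)))) => [x _|].
    by rewrite mulrC.
  apply: (locintM hM oOm _ iV) => x Ox.
  exact: (Ck_on_continuous (Ck_onW ceta) Ox).
have [i4 I34] := integral_chart cK KD z0 i3.
have weakE x : Om x -> weak_integrand g p V u (grad g u) eta x = flux_term u eta x + z x.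
  by move=> Ox; rewrite /weak_integrand /z -powR_profile// -!mulrA.
have resE y : - profile_div i y * rep i eta y + z (param i y) * m i y =
    residual V i y * rep i eta y.
  by rewrite /residual /z /rep; ring.
split.
- by apply: eq_integrable (integrableD mO i1 i3) => // x /[!inE] Ox; rewrite /= weakE// EFinD.
- apply: eq_integrable (integrableD (@mU i) i2 i4) => // y _.
  by rewrite /= -EFinD resE.
transitivity (\int[nu]_(x in OmB) ((flux_term u eta x)%:E + (z x)%:E))%E.
  by apply: eq_integral => x /[!inE] Ox; rewrite weakE// EFinD.
rewrite integralD// I12 I34 -integralD//.
by apply: eq_integral => y _; rewrite -EFinD resE.
Qed.



(** The potential term is a locally bounded function times a continuous one, and [profile_div] is
    |q|^(p-2) times a continuous function, which is where [iw] enters. *)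
Lemma locint_residual V i : Linfty_loc nu Om V ->
  locally_integrable_on lam (U i) (residual V i).
Proof.
move=> hV; have cP : Ck 0 (U i) (fun y => F (v0 (param i y)) `^ (p - 1)).
  by apply: (continuous_rep (h := fun x => F (v0 x) `^ (p - 1))) => x /continuous_profile[].
have cq : Ck 0 (U i) (fun y => q (v0 (param i y))).
  by apply: (continuous_rep (h := fun x => q (v0 x))) => x /continuous_profile[].
have cdq : Ck 0 (U i) (fun y => dq (v0 (param i y))).
  apply: (continuous_rep (h := fun x => dq (v0 x))) => x Ox; have [_ _ _ cdq] := hF Ox.
  by apply: (@continuous_comp _ _ _ v0 dq) => //; exact: Ck_on_continuous cv0 Ox.
have cdiv := continuous_flux_div (@oU i) (C1_chart_flux i).
have cfl := continuous_flux (@oU i) (C1_chart_flux i) (Ck_onW cv0 i).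
have c1 := Ck_cst 0 (U i).
apply: (locint_eq hE (f := fun y => rep i V y * (F (v0 (param i y)) `^ (p - 1) * m i y) +
  (- 1 * F (v0 (param i y)) `^ (p - 1) * (q (v0 (param i y)) * flux_div (chart_flux i) y +
   (p - 1) * (q (v0 (param i y)) * q (v0 (param i y)) + dq (v0 (param i y))) *
   flux (chart_flux i) (rep i v0) y)) * rep i (fun x => `|q (v0 x)| `^ (p - 2)) y)) => [y Uy|].
  rewrite /residual /profile_div /rep; ring.
apply: locintD => //.
  apply: (locint_Linfty hE (@oU i) (Linfty_chart i hV)).
  apply: (locint_continuous hE (@oU i) (@lfin i)); exact: (CkM (@oU i) cP (@cm i)).
apply: (locintM hE (@oU i)); last exact (locally_integrable_chart (i := i) iw).
apply: (CkM (@oU i) (CkM (@oU i) (c1 _) cP)).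
apply: (CkD (@oU i) (CkM (@oU i) cq cdiv)).
apply: (CkM (@oU i) (CkM (@oU i) (c1 _) _) cfl).
exact: (CkD (@oU i) (CkM (@oU i) cq cq) cdq).
Qed.

Lemma weak_integrand_off V (Y : vector_field X) K eta : compact K ->
  (forall x, ~ K x -> eta x = 0) -> forall x, ~ K x -> weak_integrand g p V u Y eta x = 0.
Proof.
move=> cK eta0 x Kx; rewrite /weak_integrand eta0// mulr0 addr0 /inner.
by rewrite (grad_off cK eta0 Kx (dom_chart_at X x)) trmx0 mulmx0 mxE mulr0.
Qed.

(** Test functions supported in one chart, together with the almost everywhere equality of Y and the
    classical gradient, turn the weak inequality into one for the integrals of s times [residual];
    the fundamental lemma makes it pointwise. *)
Lemma residual_sign V i (Y : vector_field X) (s : R) : Linfty_loc nu Om V ->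
  W1p_loc g lam nu p Om u Y ->
  (forall phi, test_function X Om phi -> (forall x, 0 <= phi x) ->
     nu.-integrable OmB
       (fun x : borel M => (weak_integrand g p V u Y phi x)%:E) /\
     (0 <= s%:E * \int[nu]_(x in OmB) (weak_integrand g p V u Y phi x)%:E)%E) ->
  residual_ge0 s V i.
Proof.
move=> hV hY hs; have iR := locint_residual (i := i) hV.
apply: (ae_ge0_of_test (@oU i) (f := fun y => s * residual V i y)) => [K cK KU|psi tpsi psi_ge0].
  exact: (locintZ hE s iR).
have [spsi [K [cK KU psi0]]] := tpsi.
have tphi := test_chart_fun tpsi; have [cP PD] := compact_param_image cK KU.
have phi_ge0 x : 0 <= chart_fun i psi x by exact: chart_fun_ge0.
have phi0 x : ~ (param i @` K) x -> chart_fun i psi x = 0 by exact: chart_fun_off.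
have [iY sY] := hs _ tphi phi_ge0.
have iV : nu_locint (fun x => V x * F (v0 x) `^ (p - 1)).
  apply: (locint_Linfty hM oOm hV); apply: (locint_continuous hM oOm nu_compact) => x Ox.
  by have [] := continuous_profile Ox.
have [iW _ IW] := weak_residual (tphi.1 1%N) cP PD phi0 iV.
have i3 : lam.-integrable (UB i) (EFin \o (fun y => residual V i y * psi y)).
  apply: (locint_integrable hE (@oU i) _ cK KU) => [|y _ /psi0 ->]; last by rewrite mulr0.
  apply: (locint_eq hE (f := fun y => psi y * residual V i y)) => [y _|]; first by rewrite mulrC.
  by apply: (locintM hE (@oU i)) => // y Uy; exact: Ck0 (spsi 0%N) Uy.
have -> : (\int[lam]_(y in (UB i)) (s * residual V i y * psi y)%:E =
    s%:E * \int[nu]_(x in OmB)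
      (weak_integrand g p V u (grad g u) (chart_fun i psi) x)%:E)%E.
  rewrite IW -[RHS](_ : (\int[lam]_(y in (UB i)) (s%:E * (residual V i y * psi y)%:E) = _)%E).
    by apply: eq_integral => y _; rewrite -EFinM mulrA.
  rewrite (integralZl (@mU i) i3); congr (_ * _)%E; apply: eq_integral => y /[!inE] Uy.
  by rewrite /rep (chart_funE _ Uy).
rewrite (_ : integral _ _ _ = \int[nu]_(x in OmB)
  (weak_integrand g p V u Y (chart_fun i psi) x)%:E)%E//.
have [iY' ->] := integral_chart cP PD (weak_integrand_off V _ cP phi0) iY.
have [iW' ->] := integral_chart cP PD (weak_integrand_off V _ cP phi0) iW.
have /integrableP[mY' _] := iY'; have /integrableP[mW' _] := iW'.
apply: (ae_eq_integral _ _ (@mU i) mW' mY').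
apply: filterS (weak_gradient_unique i C1_profile hY) => y Hy Uy; have [dy Oy _] := chart_imageP Uy.
congr (_%:E); congr (_ * _); rewrite /weak_integrand /vnorm /inner.
have [_ [vY _] _ _] := hY; have dx := dom_chart_at X (param i y).
by rewrite (vY i _ _ Oy dy dx) (grad_vector_field g oOm C1_profile Oy dy dx) Hy.
Qed.

(* Q selects the sign of the test functions: nonnegative for supersolutions,
   arbitrary for solutions. *)
Lemma weak_ge0 V (Q : R -> Prop) (s : R) : (forall a c, Q a -> 0 <= c -> Q (a * c)) ->
  nu_locint (fun x => V x * F (v0 x) `^ (p - 1)) ->
  (forall i, {ae lam, forall y : borel E, U i y ->
     forall a, Q a -> 0 <= s * residual V i y * a}) ->
  forall eta, C1_test eta -> (forall x, Q (eta x)) -> weak_sign s V u eta.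
Proof.
move=> HQ iV Hres.
have hu := grad_vector_field g oOm C1_profile.
suff H : forall eta K, Ck_on X 1 Om eta -> compact K -> K `<=` Om ->
    (forall x, ~ K x -> eta x = 0) -> (forall x, Q (eta x)) ->
    Ck_on X 1 Om eta /\ weak_sign s V u eta.
  by move=> eta [ceta [K [cK KO eta0]]] Qeta; have [] := H eta K ceta cK KO eta0 Qeta.
apply: (C1_partition HQ).
- have w0 x : weak_integrand g p V u (grad g u) (fun=> 0) x = 0.
    by apply: (weak_integrand_off V _ (K := set0)) => //; exact: compact0.
  split; first by move=> i; exact: Ck_cst.
  split.
    apply: eq_integrable (integrable0 nu OmB) => // x _.
    by rewrite w0.
  by rewrite (eq_integral (cst 0%E)) ?integral0 ?mule0// => x _; rewrite w0.
- move=> f h [cf [fi f0]] [ch [hi h0]]; split; first exact: Ck_onD.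
  have weakD x : Om x -> (weak V u f x + weak V u h x)%E = weak V u (fun z => f z + h z) x.
    move=> Ox; rewrite /= -EFinD /weak_integrand (inner_gradD hu cf ch Ox) !mulrDr.
    by congr (_%:E); ring.
  split; first by apply: eq_integrable (integrableD mO fi hi) => // x /[!inE] /weakD.
  rewrite (eq_integral (fun x : borel M => weak V u f x + weak V u h x)%E); last first.
    by move=> x /[!inE] /weakD.
  rewrite integralD// muleDr// ?adde_ge0//.
  by rewrite fin_num_adde_defl// integrable_fin_num.
- move=> i eta K ceta cK KD eta0 Qeta.
  have [iW iR IW] := weak_residual ceta cK KD eta0 iV; split => //; split => //.
  rewrite IW -(integralZl (@mU i) iR).
  have mR := measurable_int _ iR.
  rewrite (eq_integral (fun y : borel E => (s * residual V i y * rep i eta y)%:E)); last first.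
    by move=> y _; rewrite -EFinM mulrA.
  apply: integral_ae_ge0 => //.
    move/measurable_EFinP : mR => mR.
    rewrite (_ : (fun y => _) = (fun y : borel E => s * (residual V i y * rep i eta y))).
      exact: measurable_funM.
    by apply/funext => y; rewrite mulrA.
  by apply: filterS (Hres i) => y Hy Uy; apply: Hy => //; exact: Qeta.
Qed.

Lemma W1p_profile : W1p_loc g lam nu p Om u (grad g u).
Proof.
have cu := C1_profile.
have cu0 x : Om x -> {for x, continuous u} by move=> Ox; exact: Ck_on_continuous cu Ox.
split.
- split; first exact: continuous_on_measurable.
  apply: (locint_continuous hM oOm nu_compact) => x Ox.
  apply: (@continuous_comp _ _ _ u (fun t => `|t| `^ p)); first exact: cu0.
  exact: is_derive_continuous (is_derive_norm_powR p1 _).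
- split; first exact: grad_vector_field.
  move=> i a; rewrite setIC; apply: (measurable_chart_pull (i := i) (f := fun x => grad g u i x 0 a)).
  by apply: continuous_on_measurable => //; exact: C0_grad.
- apply: (locint_continuous hM oOm nu_compact) => x Ox; exact: continuous_vnorm_powR.
- move=> i a psi; rewrite /= -/(chart_image Om i) => -[spsi [K [cK KU psi0]]].
  have [_ _ ->] := integration_by_parts hlam a (@oU i) cK KU (cu i) (spsi 1%N) psi0.
  congr (- _)%E; apply: eq_integral => y /[!inE] Uy; have [dy Oy cy] := chart_imageP Uy.
  by rewrite /grad mulmxKV ?gram_unit// mxE cy.
Qed.

(** F^(p-1) is continuous and positive, so |phi|^p divided by it is a continuous compactly supported
    multiplier. *)
Lemma integrable_potential V phi : nu_locint (fun x => V x * F (v0 x) `^ (p - 1)) ->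
  test_function X Om phi ->
  nu.-integrable OmB (fun x : borel M => (V x * `|phi x| `^ p)%:E).
Proof.
move=> iV [sphi [K [cK KO phi0]]]; have pn : p != 0 by rewrite gt_eqF// (lt_trans ltr01 p1).
apply: (locint_integrable hM oOm _ cK KO) => [|x _ /phi0 ->]; last first.
  by rewrite normr0 powR0// mulr0.
apply: (locint_eq hM (f := fun x => `|phi x| `^ p * (F (v0 x) `^ (p - 1))^-1 *
    (V x * F (v0 x) `^ (p - 1)))) => [x Ox|].
  have [F0 _ _ _] := hF Ox; have := powR_gt0 (p - 1) F0; set P := F _ `^ _ => P0.
  by field; rewrite gt_eqF.
apply: (locintM hM oOm _ iV) => x Ox; have [F0 _ _ _] := hF Ox.
apply: (@continuousM _ _ (fun x => `|phi x| `^ p) (fun x => (F (v0 x) `^ (p - 1))^-1)).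
  apply: (@continuous_comp _ _ _ phi (fun t => `|t| `^ p)).
    exact: (Ck_on_continuous (sphi 0%N) Ox).
  exact: is_derive_continuous (is_derive_norm_powR p1 _).
apply: (@continuousV _ _ (fun x => F (v0 x) `^ (p - 1))); first by rewrite gt_eqF// powR_gt0.
by have [] := continuous_profile Ox.
Qed.

Lemma picone V phi : nu_locint (fun x => V x * F (v0 x) `^ (p - 1)) ->
  (forall eta, C1_test eta -> (forall x, 0 <= eta x) -> weak_sign 1 V u eta) ->
  test_function X Om phi ->
  nu.-integrable OmB (fun x : borel M => (vnorm g (grad g phi) x `^ p)%:E) /\
  (0 <= \int[nu]_(x in OmB)
     (vnorm g (grad g phi) x `^ p + V x * `|phi x| `^ p)%:E)%E.
Proof.
move=> iV weak0 tphi; have iVp := integrable_potential iV tphi.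
have [sphi [K [cK KO phi0]]] := tphi.
have p0 : 0 < p by exact: lt_trans p1.
have cu := C1_profile.
have cphi := sphi 1%N; have hu := grad_vector_field g oOm cu.
have u0 x : Om x -> 0 < u x by move=> Ox; rewrite uF//; have [] := hF Ox.
have cn : Ck_on X 1 Om (fun x => `|phi x| `^ p).
  apply: (C1_on_comp1 oOm (h := fun t => `|t| `^ p) (dh := fun t => p * spow p t)) cphi => x Ox.
    exact: is_derive_norm_powR.
  by apply: (@continuousM _ _ (fun=> p)); [exact: cst_continuous|exact: continuous_spow].
have cv : Ck_on X 1 Om (fun x => u x `^ (1 - p)).
  apply: (C1_on_comp1 oOm (h := fun t => t `^ (1 - p)) (dh := fun t => (1 - p) * t `^ (1 - p - 1))) cu => x Ox.
    exact: is_derive1_powR (u0 x Ox).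
  apply: (@continuousM _ _ (fun=> 1 - p)); first exact: cst_continuous.
  exact: continuous_powR_pos (u0 x Ox).
pose eta x := `|phi x| `^ p * u x `^ (1 - p).
have ceta : Ck_on X 1 Om eta by exact: Ck_onM.
have eta0 x : ~ K x -> eta x = 0.
  by move=> /phi0; rewrite /eta => ->; rewrite normr0 powR0 ?gt_eqF// mul0r.
(* The potential terms on the two sides coincide because |u|^(p-2) u eta = |phi|^p; only the
   gradient terms remain to be compared pointwise. *)
have etaE x : Om x -> V x * `|u x| `^ (p - 2) * u x * eta x = V x * `|phi x| `^ p.
  move=> Ox; rewrite -!mulrA; congr (_ * _); rewrite mulrA powR_profile// -uF// /eta mulrCA -powRD.
    by rewrite (_ : p - 1 + (1 - p) = 0) ?powRr0 ?mulr1//; ring.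
  by rewrite (gt_eqF (u0 x Ox)) implybT.
have ib : nu.-integrable OmB (fun x : borel M => (vnorm g (grad g phi) x `^ p)%:E).
  apply: (locint_integrable hM oOm _ cK KO) => [|x _ Kx].
    apply: (locint_continuous hM oOm nu_compact) => x Ox; exact: continuous_vnorm_powR.
  rewrite /vnorm /inner (grad_off cK phi0 Kx (dom_chart_at X x)) !mul0mx mxE sqrtr0.
  by rewrite powR0// gt_eqF.
have eta_ge0 x : 0 <= eta x by rewrite mulr_ge0 ?powR_ge0.
have [|//|iW] := weak0 eta; first by split => //; exists K.
rewrite mul1e => W0.
split => //; apply: (le_trans W0).
apply: le_integral => //.
  by apply: eq_integrable (integrableD mO ib iVp) => // x _; rewrite /= EFinD.
move=> x /[!inE] Ox; rewrite lee_fin /weak_integrand etaE// lerD2r.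
have vn f : 0 <= vnorm g (grad g f) x by exact: sqrtr_ge0.
have := picone_powR p1 (phi x) (vn u) (vn phi) (u0 x Ox)
  (inner_cauchy_schwarz g (grad g u) (grad g phi) x).
rewrite -vnorm_inner.
have E1 : inner g (grad g u) (grad g (fun z => `|phi z| `^ p)) x =
    p * spow p (phi x) * inner g (grad g u) (grad g phi) x.
  exact: (inner_grad_comp1 (h := fun t => `|t| `^ p) hu cphi cn Ox (is_derive_norm_powR p1 (phi x))).
have E2 : inner g (grad g u) (grad g (fun z => u z `^ (1 - p))) x =
    (1 - p) * u x `^ (- p) * inner g (grad g u) (grad g u) x.
  have e3 : 1 - p - 1 = - p by ring.
  exact: (etrans (inner_grad_comp1 (h := fun t => t `^ (1 - p)) hu cu cv Ox
    (is_derive1_powR (1 - p) (u0 x Ox))) (congr1 (fun r => (1 - p) * u x `^ r * _) e3)).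
have E : inner g (grad g u) (grad g eta) x = _ := etrans (inner_gradM hu cn cv Ox)
  (f_equal2 (fun a b => `|phi x| `^ p * a + u x `^ (1 - p) * b) E2 E1).
by rewrite E.
Qed.

Lemma grad_log_profile x : Om x ->
  grad_log_norm g u x = `|q (v0 x)| * vnorm g (grad g v0) x.
Proof.
move=> Ox; apply: vnormZ => i dx.
rewrite (eq_grad g oOm (phi := fun z => ln (F (v0 z))) _ Ox dx) => [|z Oz]; last by rewrite uF.
have [F0 dF _ _] := hF Ox.
have d1 := @is_derive1_comp R (@ln R) F (v0 x) _ _ (is_derive1_ln F0) dF.
have d2 : is_derive (v0 x) 1 (fun s => ln (F s)) (q (v0 x)).
  by apply: is_derive_eq d1 _; rewrite mulrA mulVf ?mul1r// gt_eqF.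
exact: (grad_comp1 g (Ck_onW cv0) Ox dx d2).
Qed.

End profile.

(** Logarithmic derivatives of powers and products combine linearly. The exponents alpha and 1 -
    alpha produce v_alpha, while -1 and 1 produce v0 / v1. *)
Lemma log_profile_powR F0 q0 dq0 F1 q1 dq1 a b : log_profile F0 q0 dq0 ->
  log_profile F1 q1 dq1 ->
  log_profile (fun s => F1 s `^ a * F0 s `^ b) (fun s => a * q1 s + b * q0 s)
    (fun s => a * dq1 s + b * dq0 s).
Proof.
move=> h0 h1 x Ox; have [F00 d0 e0 c0] := h0 x Ox; have [F10 d1 e1 c1] := h1 x Ox.
split; first by rewrite mulr_gt0 ?powR_gt0.
- have k1 := @is_derive1_comp R (fun s => s `^ a) F1 (v0 x) _ _ (is_derive1_powR a F10) d1.
  have k0 := @is_derive1_comp R (fun s => s `^ b) F0 (v0 x) _ _ (is_derive1_powR b F00) d0.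
  apply: is_derive_eq (is_deriveM k1 k0) _; rewrite /GRing.scale/=.
  have E c s : 0 < s -> s `^ c = s `^ (c - 1) * s :> R.
    by move=> s0; rewrite powR_mulr// subrK.
  rewrite (E a _ F10) (E b _ F00).
  by set w1 := F1 _ `^ _; set w0 := F0 _ `^ _; ring.
- have := is_deriveD (is_deriveZ a e1) (is_deriveZ b e0); exact.
- have cc c : {for v0 x, continuous (fun=> c : R)} by exact: cst_continuous.
  apply: (@continuousD _ _ _ (fun s => a * dq1 s) (fun s => b * dq0 s)).
    exact: (@continuousM _ _ (fun=> a) dq1 _ (cc a) c1).
  exact: (@continuousM _ _ (fun=> b) dq0 _ (cc b) c0).
Qed.

Lemma locint_profile_ne0 F q dq : log_profile F q dq -> (forall x, Om x -> q (v0 x) != 0) ->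
  nu_locint (fun x => `|q (v0 x)| `^ (p - 2)).
Proof.
move=> hF q0; apply: (locint_continuous hM oOm nu_compact) => x Ox.
have [_ cq] := continuous_profile hF Ox.
apply: (@continuous_comp _ _ _ (fun z => q (v0 z)) (fun s => `|s| `^ (p - 2))) => //.
exact: continuous_norm_powR (q0 x Ox).
Qed.

Lemma measurable_profile F q dq : log_profile F q dq ->
  measurable_fun OmB (fun x : borel M => `|q (v0 x)| `^ (p - 2)).
Proof.
move=> hF; apply: (measurableT_comp (measurable_powR _)).
apply: continuous_on_measurable => // x Ox; have [_ cq] := continuous_profile hF Ox.
apply: (@continuous_comp _ _ _ (fun z => q (v0 z)) (fun s : R => `|s|)) => //.
exact: norm_continuous.
Qed.

(** For p >= 2 the inequality |q| <= 1 + q^2 can be raised to the power p - 2, and the base 1 + q^2,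
    having no zeros, has a continuous power. *)
Lemma locint_profile_ge2 F q dq : 2 <= p -> log_profile F q dq ->
  nu_locint (fun x => `|q (v0 x)| `^ (p - 2)).
Proof.
move=> p2 hF; apply: (locint_le hM oOm (h := fun x => (1 + q (v0 x) * q (v0 x)) `^ (p - 2))).
- exact: measurable_profile hF.
- move=> x Ox; rewrite ger0_norm ?powR_ge0//; apply: ge0_ler_powR; rewrite ?nnegrE ?subr_ge0//.
    by rewrite addr_ge0// -expr2 sqr_ge0.
  have -> : q (v0 x) * q (v0 x) = `|q (v0 x)| ^+ 2 by rewrite real_normK ?num_real// expr2.
  have := sqr_ge0 (`|q (v0 x)| - 1); have := normr_ge0 (q (v0 x)); nra.
- apply: (locint_continuous hM oOm nu_compact) => x Ox; have [_ cq] := continuous_profile hF Ox.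
  apply: (@continuous_comp _ _ _ (fun z => 1 + q (v0 z) * q (v0 z)) (fun s => s `^ (p - 2))).
    apply: (@continuousD _ _ _ (fun=> 1 : R) (fun z => q (v0 z) * q (v0 z))); first exact: cst_continuous.
    exact: (@continuousM _ _ (fun z => q (v0 z)) (fun z => q (v0 z))).
  by apply: continuous_powR_pos; rewrite ltr_wpDr// -expr2 sqr_ge0.
Qed.

(** * Interpolation between v0 and v1 *)

Section interpolation.
Variables (V0 V1 v1 : M -> R) (F1 q1 dq1 : R -> R) (alpha : R).
Hypotheses (hV0 : Linfty_loc nu Om V0) (hV1 : Linfty_loc nu Om V1).
Hypothesis v0_gt0 : forall x, Om x -> 0 < v0 x.
Hypotheses (hF1 : log_profile F1 q1 dq1) (v1E : forall x, Om x -> v1 x = F1 (v0 x)).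
Hypothesis q1_neq0 : forall x, Om x -> q1 (v0 x) != 0.
Hypothesis alpha01 : 0 <= alpha <= 1.
Hypothesis hW : p < 2 -> nu_locint (W_interp g p alpha v0 v1).

(** v0 is treated as a profile of itself, with logarithmic derivative 1 / s, so that both endpoints
    obey the same lemmas. *)
Let F0 (s : R) := s.
Let q0 (s : R) := s^-1.
Let dq0 (s : R) := - (s^-1 * s^-1).
Let F s := F1 s `^ alpha * F0 s `^ (1 - alpha).
Let q s := alpha * q1 s + (1 - alpha) * q0 s.
Let dq s := alpha * dq1 s + (1 - alpha) * dq0 s.
Let v := v_interp alpha v0 v1.
Let V := V_interp g p alpha V0 V1 v0 v1.
Let W := W_interp g p alpha v0 v1.
Let speed x := vnorm g (grad g v0) x.

Lemma log_profile0 : log_profile F0 q0 dq0.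
Proof.
move=> x Ox; have t0 := v0_gt0 Ox; have tn : v0 x != 0 by rewrite gt_eqF.
have cV : {for v0 x, continuous (fun s : R => s^-1)}.
  by apply: (@continuousV _ _ id) => //; exact: id.
split => //.
- by rewrite /F0 /q0 mulfV//; exact: is_derive_id.
- apply: is_derive_eq (is_deriveV (f := id) tn (is_derive_id _ _)) _.
  by rewrite /dq0 /GRing.scale/= mulr1 -exprVn expr2.
- have cVV := @continuousM _ _ (fun s : R => s^-1) (fun s => s^-1) _ cV cV.
  exact: (continuousN cVV).
Qed.

Lemma log_profile_interp : log_profile F q dq.
Proof. exact: log_profile_powR log_profile0 hF1. Qed.

Lemma v_interpE x : Om x -> v x = F (v0 x).
Proof. by move=> Ox; rewrite /v /v_interp v1E. Qed.

Lemma q0_neq0 x : Om x -> q0 (v0 x) != 0.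
Proof. by move=> Ox; rewrite invr_eq0 gt_eqF// v0_gt0. Qed.

Lemma speed_gt0 x : Om x -> 0 < speed x.
Proof. by move=> Ox; rewrite lt_neqAle eq_sym gv0// sqrtr_ge0. Qed.

(** Each |grad log| is |q| |grad v0| for the corresponding q, and the powers 2 - p and p - 2 of
    |grad v0| cancel. *)
Lemma V_interpE x : Om x -> V x =
  ((1 - alpha) * V0 x * `|q0 (v0 x)| `^ (2 - p) + alpha * V1 x * `|q1 (v0 x)| `^ (2 - p)) *
  `|q (v0 x)| `^ (p - 2).
Proof.
move=> Ox; rewrite /V /V_interp.
rewrite (grad_log_profile log_profile0 (u := v0))// (grad_log_profile hF1 v1E)//.
rewrite (grad_log_profile log_profile_interp v_interpE)//.
have s0 := speed_gt0 Ox; rewrite -/(speed x) !powRM ?(ltW s0)//.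
have E : speed x `^ (2 - p) * speed x `^ (p - 2) = 1.
  by rewrite -powRD ?(gt_eqF s0) ?implybT// (_ : 2 - p + (p - 2) = 0) ?powRr0//; ring.
transitivity (((1 - alpha) * V0 x * `|q0 (v0 x)| `^ (2 - p) +
  alpha * V1 x * `|q1 (v0 x)| `^ (2 - p)) * `|q (v0 x)| `^ (p - 2) *
  (speed x `^ (2 - p) * speed x `^ (p - 2))); last by rewrite E mulr1.
set a := _ `^ (2 - p); set b := _ `^ (2 - p); set c := _ `^ (p - 2).
set d := _ `^ (2 - p); set e := _ `^ (p - 2); ring.
Qed.

Lemma W_interpE x : Om x -> W x =
  alpha * (1 - alpha) * (p - 1) * (q0 (v0 x) - q1 (v0 x)) ^+ 2 * (speed x ^+ 2 * speed x `^ (p - 2)) *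
  `|q (v0 x)| `^ (p - 2).
Proof.
move=> Ox; rewrite /W /W_interp.
(* The quotient is again of profile form, with logarithmic derivative q_0 - q_1. *)
have e z : Om z -> v0 z / v1 z = F1 (v0 z) `^ (-1) * F0 (v0 z) `^ 1.
  move=> Oz; have [F10 _ _ _] := hF1 Oz.
  by rewrite v1E// powR_inv1 ?ltW// powRr1 ?ltW ?v0_gt0// mulrC.
rewrite (grad_log_profile (log_profile_powR (-1) 1 log_profile0 hF1) e)//.
rewrite (grad_log_profile log_profile_interp v_interpE)//.
have s0 := speed_gt0 Ox; rewrite -/(speed x) powRM ?(ltW s0)// exprMn real_normK ?num_real//.
by set c := _ `^ (p - 2); set e' := _ `^ (p - 2); ring.
Qed.

(* Where |q| < q_0/2 the difference q_0 - q_1 = (q_0 - q)/alpha is bounded away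
   from 0, so that W dominates |q|^(p-2). *)
Lemma locint_interp : nu_locint (fun x => `|q (v0 x)| `^ (p - 2)).
Proof.
have [p2|p2] := leP 2 p; first exact: locint_profile_ge2 log_profile_interp.
(* At both endpoints W vanishes identically and controls nothing, but q is then q_0 or q_1, which
   have no zeros. *)
have [a0|a0] := eqVneq alpha 0.
  apply: (locint_profile_ne0 log_profile_interp) => x Ox.
  by rewrite /q a0 mul0r add0r subr0 mul1r q0_neq0.
have [a1|a1] := eqVneq alpha 1.
  apply: (locint_profile_ne0 log_profile_interp) => x Ox.
  by rewrite /q a1 subrr mul0r addr0 mul1r q1_neq0.
have {a0}a0 : 0 < alpha by rewrite lt_neqAle eq_sym a0; case/andP: alpha01.
have {a1}a1 : 0 < 1 - alpha by rewrite subr_gt0 lt_neqAle a1; case/andP: alpha01.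
have p10 : 0 < p - 1 by rewrite subr_gt0.
(* Chosen so that B W = (2 (q_0 - q) / q_0)^2 |q|^(p-2), because alpha (q_0 - q_1) = q_0 - q and v0
   = 1 / q_0. The square is at least 1 as soon as |q| < q_0 / 2. *)
pose B x := 4 * alpha * ((1 - alpha) * (p - 1))^-1 * (v0 x * v0 x) * (speed2 x `^ (p / 2))^-1.
have speed2E x : Om x -> speed2 x `^ (p / 2) = speed x ^+ 2 * speed x `^ (p - 2).
  move=> Ox; rewrite -vnorm_powR -/(speed x) -powR_mulrn ?sqrtr_ge0// -powRD.
    by congr (_ `^ _); ring.
  by rewrite (gt_eqF (speed_gt0 Ox)) implybT.
apply: (locint_le hM oOm (h := fun x => (q0 (v0 x) / 2) `^ (p - 2) + B x * W x)).
- exact: measurable_profile log_profile_interp.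
- move=> x Ox; rewrite ger0_norm ?powR_ge0//.
  have t0 := v0_gt0 Ox; have q00 : 0 < q0 (v0 x) by rewrite invr_gt0.
  have s0 := speed_gt0 Ox; have sp0 := powR_gt0 (p - 2) s0.
  have w0 : 0 <= `|q (v0 x)| `^ (p - 2) by exact: powR_ge0.
  have BW : B x * W x = (4 * alpha ^+ 2 * (q0 (v0 x) - q1 (v0 x)) ^+ 2 * (v0 x) ^+ 2) * `|q (v0 x)| `^ (p - 2).
    rewrite W_interpE// /B speed2E//; set w := `|q _| `^ _; set sp := speed x `^ _ in sp0 *.
    by field; rewrite (gt_eqF s0) (gt_eqF sp0) (gt_eqF p10) (gt_eqF a1).
  have [qle|qgt] := leP (q0 (v0 x) / 2) `|q (v0 x)|.
    apply: ler_wpDr.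
      rewrite BW; apply: mulr_ge0 w0; apply: mulr_ge0 (sqr_ge0 _).
      by apply: mulr_ge0 (sqr_ge0 _); apply: mulr_ge0 (sqr_ge0 _).
    (* The exponent p - 2 is negative, so |q| >= q_0 / 2 bounds |q|^(p-2) by the first term of the
       majorant. *)
    have -> : p - 2 = - (2 - p) by ring.
    rewrite !powRN lef_pV2 ?posrE ?powR_gt0//; last 2 first.
    - by apply: lt_le_trans qle; rewrite divr_gt0.
    - by rewrite divr_gt0.
    apply: ge0_ler_powR; rewrite ?nnegrE ?subr_ge0 ?(ltW p2)//.
    by rewrite divr_ge0// ltW.
  apply: ler_wpDl; first exact: powR_ge0.
  rewrite BW -[leLHS]mul1r ler_wpM2r//.
  have -> : 4 * alpha ^+ 2 * (q0 (v0 x) - q1 (v0 x)) ^+ 2 * (v0 x) ^+ 2 =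
      (2 * (q0 (v0 x) - q (v0 x)) * v0 x) ^+ 2 by rewrite /q; ring.
  have h1 : 1 <= 2 * (q0 (v0 x) - q (v0 x)) * v0 x.
    have e1 : 2 * (q0 (v0 x) / 2) * v0 x = 1 by rewrite /q0; field; rewrite gt_eqF.
    rewrite -[leLHS]e1 ler_pM2r// ler_pM2l//; have := ler_norm (q (v0 x)); lra.
  by rewrite expr_ge1// (le_trans ler01 h1).
- have cv x : Om x -> {for x, continuous v0} by move=> Ox; exact: Ck_on_continuous cv0 Ox.
  apply: (locintD hM).
    apply: (locint_continuous hM oOm nu_compact) => x Ox.
    have [_ cq] := continuous_profile log_profile0 Ox.
    apply: (@continuous_comp _ _ _ (fun z => q0 (v0 z) / 2) (fun s => s `^ (p - 2))).
      by apply: (@continuousM _ _ (fun z => q0 (v0 z)) (fun=> 2^-1)) => //; exact: cst_continuous.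
    by apply: continuous_powR_pos; rewrite divr_gt0// invr_gt0 v0_gt0.
  apply: (locintM hM oOm) => [x Ox|]; last exact: hW.
  have cs : {for x, continuous speed2}.
    have c0 : Ck_on X 0 Om speed2.
      by apply: C0_inner_grad => //; exact: Ck_onW.
    exact: (Ck_on_continuous c0 Ox).
  apply: (@continuousM _ _ (fun x => 4 * alpha * ((1 - alpha) * (p - 1))^-1 * (v0 x * v0 x))).
    apply: (@continuousM _ _ (fun=> 4 * alpha * ((1 - alpha) * (p - 1))^-1)); first exact: cst_continuous.
    by apply: (@continuousM _ _ v0 v0); exact: cv.
  apply: (@continuousV _ _ (fun x => speed2 x `^ (p / 2))).
    by rewrite gt_eqF// powR_gt0// speed2_gt0.
  apply: (@continuous_comp _ _ _ speed2 (fun s => s `^ (p / 2))) => //.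
  exact: continuous_powR_pos (speed2_gt0 Ox).
Qed.

Let iw0 : nu_locint (fun x => `|q0 (v0 x)| `^ (p - 2)).
Proof. exact: locint_profile_ne0 log_profile0 q0_neq0. Qed.

Let iw1 : nu_locint (fun x => `|q1 (v0 x)| `^ (p - 2)).
Proof. exact: locint_profile_ne0 hF1 q1_neq0. Qed.

(** In profile form both potentials are |q|^(p-2) times continuous or locally bounded factors, so
    [locint_interp] applies. *)
Lemma locint_potential :
  nu_locint (fun x => V x * F (v0 x) `^ (p - 1)) /\
  nu_locint (fun x => W x * F (v0 x) `^ (p - 1)).
Proof.
have iw := locint_interp.
have cst_ (x : M) (c : R) : {for x, continuous (fun=> c : R)} by exact: cst_continuous.
have cP x : Om x -> {for x, continuous (fun z => F (v0 z) `^ (p - 1))}.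
  by move=> Ox; have [] := continuous_profile log_profile_interp Ox.
have cr (q' : R -> R) (r : R) x : {for x, continuous (fun z => q' (v0 z))} -> q' (v0 x) != 0 ->
    {for x, continuous (fun z => `|q' (v0 z)| `^ r)}.
  move=> cq q'0; apply: (@continuous_comp _ _ _ (fun z => q' (v0 z)) (fun s => `|s| `^ r)) => //.
  exact: continuous_norm_powR.
have cq0 x : Om x -> {for x, continuous (fun z => q0 (v0 z))}.
  by move=> Ox; have [] := continuous_profile log_profile0 Ox.
have cq1 x : Om x -> {for x, continuous (fun z => q1 (v0 z))}.
  by move=> Ox; have [] := continuous_profile hF1 Ox.
have cMM x (f h : M -> R) : {for x, continuous f} -> {for x, continuous h} ->
  {for x, continuous (fun z => f z * h z)} by exact: continuousM.
split.
- apply: (locint_eq hM (f := fun x =>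
    V0 x * ((1 - alpha) * (`|q0 (v0 x)| `^ (2 - p) * F (v0 x) `^ (p - 1)) * `|q (v0 x)| `^ (p - 2)) +
    V1 x * (alpha * (`|q1 (v0 x)| `^ (2 - p) * F (v0 x) `^ (p - 1)) * `|q (v0 x)| `^ (p - 2)))) => [x Ox|].
    rewrite V_interpE//; set a := _ `^ (2 - p); set b := _ `^ (2 - p); set c := _ `^ (p - 2).
    by set d := _ `^ (p - 1); ring.
  apply: (locintD hM).
    apply: (locint_Linfty hM oOm hV0); apply: (locintM hM oOm _ iw) => x Ox.
    apply: (cMM x (fun=> 1 - alpha)) => //.
    by apply: cMM; [apply: cr; [exact: cq0|exact: q0_neq0]|exact: cP].
  apply: (locint_Linfty hM oOm hV1); apply: (locintM hM oOm _ iw) => x Ox.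
  apply: (cMM x (fun=> alpha)) => //.
  by apply: cMM; [apply: cr; [exact: cq1|exact: q1_neq0]|exact: cP].
- apply: (locint_eq hM (f := fun x => (alpha * (1 - alpha) * (p - 1)) *
    ((q0 (v0 x) - q1 (v0 x)) * (q0 (v0 x) - q1 (v0 x))) *
     speed2 x `^ (p / 2) * F (v0 x) `^ (p - 1) * `|q (v0 x)| `^ (p - 2))) => [x Ox|].
    rewrite W_interpE// -vnorm_powR -/(speed x).
    have -> : speed x `^ p = speed x ^+ 2 * speed x `^ (p - 2).
      rewrite -powR_mulrn ?sqrtr_ge0// -powRD; first by congr (_ `^ _); ring.
      by rewrite (gt_eqF (speed_gt0 Ox)) implybT.
    by set c := _ `^ (p - 2); set d := _ `^ (p - 1); set e := _ `^ (p - 2); ring.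
  apply: (locintM hM oOm _ iw) => x Ox.
  apply: (cMM x); last exact: cP.
  apply: (cMM x); last first.
    have c0 : Ck_on X 0 Om speed2 by apply: C0_inner_grad => //; exact: Ck_onW.
    apply: (@continuous_comp _ _ _ speed2 (fun s => s `^ (p / 2))).
      exact: (Ck_on_continuous c0 Ox).
    exact: continuous_powR_pos (speed2_gt0 Ox).
  apply: (cMM x (fun=> alpha * (1 - alpha) * (p - 1))) => //.
  have cB : {for x, continuous (fun z => q0 (v0 z) - q1 (v0 z))}.
    by apply: (@continuousB _ _ _ (fun z => q0 (v0 z)) (fun z => q1 (v0 z))); [exact: cq0|exact: cq1].
  exact: cMM.
Qed.

(** Once |q_j|^(2-p) is the inverse of |q_j|^(p-2), this is the identity between squares of the q's.
    Every term carries the factor |q|^(p-2) and nothing is divided by it, so the zeros of q are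
    covered by the same computation. *)
Lemma residual_interp i y : U i y ->
  residual F q dq (fun x => V x - W x) i y =
  F (v0 (param i y)) `^ (p - 1) * `|q (v0 (param i y))| `^ (p - 2) *
  ((1 - alpha) * (residual F0 q0 dq0 V0 i y /
     (F0 (v0 (param i y)) `^ (p - 1) * `|q0 (v0 (param i y))| `^ (p - 2))) +
   alpha * (residual F1 q1 dq1 V1 i y /
     (F1 (v0 (param i y)) `^ (p - 1) * `|q1 (v0 (param i y))| `^ (p - 2)))).
Proof.
move=> Uy; have [dy Oy cy] := chart_imageP Uy; rewrite /residual V_interpE// W_interpE//.
have fE : flux (chart_flux i) (rep i v0) y =
    speed (param i y) ^+ 2 * speed (param i y) `^ (p - 2) * m i y.
  rewrite flux_chart//; last exact: Ck_onW.
  rewrite -/(speed2 _) -vnorm_powR -/(speed _) /speed2 vnorm_inner -/(speed _); ring.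
rewrite /profile_div fE; set x := param i y.
have inv_w (s : R) : s != 0 -> `|s| `^ (2 - p) = (`|s| `^ (p - 2))^-1.
  by move=> s0; rewrite -powRN; congr (_ `^ _); ring.
rewrite !inv_w ?q0_neq0 ?q1_neq0//.
have [F10 _ _ _] := hF1 Oy.
have t0 : v0 x != 0 by rewrite gt_eqF// v0_gt0.
have := powR_gt0 (p - 1) (v0_gt0 Oy); have := powR_gt0 (p - 1) F10.
have : 0 < `|q1 (v0 x)| `^ (p - 2) by rewrite powR_gt0// normr_gt0 q1_neq0.
have : 0 < `|q0 (v0 x)| `^ (p - 2) by rewrite powR_gt0// normr_gt0 q0_neq0.
rewrite /F0 -/x; set w0 := `|q0 _| `^ _; set w1 := `|q1 _| `^ _; set P1 := F1 _ `^ _; set P0 := v0 _ `^ _.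
set P := F _ `^ _; set w := `|q _| `^ _; set sp := speed x `^ _; set D := flux_div _ y.
rewrite /dq /dq0 /q /q0 => h1 h2 h3 h4.
field; rewrite ?t0 ?(gt_eqF h1) ?(gt_eqF h2) ?(gt_eqF h3) ?(gt_eqF h4)//.
Qed.

Lemma residual_interp_sign i (s : R) :
  residual_ge0 F0 q0 dq0 s V0 i ->
  residual_ge0 F1 q1 dq1 s V1 i ->
  residual_ge0 F q dq s (fun x => V x - W x) i.
Proof.
apply: filterS2 => y h0 h1 Uy; rewrite residual_interp//.
have [a0 a1] := andP alpha01.
have H (P r0 r1 k0 k1 : R) : 0 <= P -> 0 <= s * r0 -> 0 <= s * r1 -> 0 <= k0 -> 0 <= k1 ->
    0 <= s * (P * ((1 - alpha) * (r0 / k0) + alpha * (r1 / k1))).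
  move=> P_ge0 r0_ge0 r1_ge0 k0_ge0 k1_ge0.
  have -> : s * (P * ((1 - alpha) * (r0 / k0) + alpha * (r1 / k1))) =
    P * ((1 - alpha) * ((s * r0) / k0) + alpha * ((s * r1) / k1)) by ring.
  by rewrite mulr_ge0// addr_ge0// mulr_ge0 ?subr_ge0// divr_ge0.
by apply: (H _ _ _ _ _ _ (h0 Uy) (h1 Uy)); exact: mulr_ge0 (powR_ge0 _ _) (powR_ge0 _ _).
Qed.

Let v0E x : Om x -> v0 x = F0 (v0 x). Proof. by []. Qed.

Let locint_VW : nu_locint (fun x => (V x - W x) * F (v0 x) `^ (p - 1)).
Proof.
have [iV iW] := locint_potential.
apply: (locint_eq hM (f := fun x => V x * F (v0 x) `^ (p - 1) + -1 * (W x * F (v0 x) `^ (p - 1)))).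
  by move=> x _; ring.
exact: (locintD hM iV (locintZ hM (-1) iW)).
Qed.

Let U_ x := V x - W x.

Let improved := forall phi, test_function X Om phi ->
  (\int[nu]_(x in OmB) (W x * `|phi x| `^ p)%:E <=
   \int[nu]_(x in OmB) (vnorm g (grad g phi) x `^ p + V x * `|phi x| `^ p)%:E)%E.

Lemma improved_inequality_interp :
  (forall eta, C1_test eta -> (forall x, 0 <= eta x) -> weak_sign 1 U_ v eta) -> improved.
Proof.
move=> Hweak phi tphi.
have [iV iW] := locint_potential.
have iVp := integrable_potential log_profile_interp iV tphi.
have iWp := integrable_potential log_profile_interp iW tphi.
have [ib] := picone log_profile_interp v_interpE locint_VW Hweak tphi.
have iA : nu.-integrable OmB
    (fun x : borel M => (vnorm g (grad g phi) x `^ p + V x * `|phi x| `^ p)%:E).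
  by apply: eq_integrable (integrableD mO ib iVp) => // x _; rewrite /= EFinD.
rewrite (eq_integral (fun x : borel M => (vnorm g (grad g phi) x `^ p + V x * `|phi x| `^ p)%:E -
    (W x * `|phi x| `^ p)%:E)%E); last first.
  by move=> x _; rewrite -EFinB; congr (_%:E); ring.
by rewrite integralB// sube_ge0// integrable_fin_num// orbT.
Qed.

Lemma supersolution_interp :
  supersolution g lam nu p Om V0 v0 -> supersolution g lam nu p Om V1 v1 ->
  supersolution g lam nu p Om U_ v /\ improved.
Proof.
move=> [Y0 [hY0 s0]] [Y1 [hY1 s1]].
have r0 i : residual_ge0 F0 q0 dq0 1 V0 i.
  apply: (residual_sign log_profile0 v0E iw0 i hV0 hY0) => // phi tphi phi_ge0.
  by rewrite mul1e; exact: s0.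
have r1 i : residual_ge0 F1 q1 dq1 1 V1 i.
  apply: (residual_sign hF1 v1E iw1 i hV1 hY1) => // phi tphi phi_ge0.
  by rewrite mul1e; exact: s1.
have Hweak eta : C1_test eta -> (forall x, 0 <= eta x) -> weak_sign 1 U_ v eta.
  have HQ (a c : R) : 0 <= a -> 0 <= c -> 0 <= a * c by exact: mulr_ge0.
  apply: (weak_ge0 log_profile_interp v_interpE locint_interp HQ locint_VW) => i.
  apply: filterS (residual_interp_sign (r0 i) (r1 i)) => y h Uy a a0.
  by rewrite mulr_ge0// h.
split; last exact: improved_inequality_interp.
exists (grad g v); split; first exact: (W1p_profile log_profile_interp v_interpE).
by move=> phi /test_C1 tphi phi_ge0; have [iw] := Hweak phi tphi phi_ge0; rewrite mul1e.
Qed.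

Lemma solution_interp :
  solution g lam nu p Om V0 v0 -> solution g lam nu p Om V1 v1 ->
  solution g lam nu p Om U_ v /\ improved.
Proof.
move=> [Y0 [hY0 s0]] [Y1 [hY1 s1]].
(* For an equation the tested integral is 0, hence nonnegative after multiplication by any s; the
   signs 1 and -1 will make the residual of v_alpha vanish. *)
have r0 i (s : R) : residual_ge0 F0 q0 dq0 s V0 i.
  apply: (residual_sign log_profile0 v0E iw0 i hV0 hY0) => // phi tphi phi_ge0.
  by have [i0 ->] := s0 phi tphi; rewrite mule0.
have r1 i (s : R) : residual_ge0 F1 q1 dq1 s V1 i.
  apply: (residual_sign hF1 v1E iw1 i hV1 hY1) => // phi tphi phi_ge0.
  by have [i1 ->] := s1 phi tphi; rewrite mule0.
have Hweak (s : R) eta : C1_test eta -> weak_sign s U_ v eta.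
  move=> teta; apply: (weak_ge0 (Q := fun=> True) log_profile_interp v_interpE locint_interp
    _ locint_VW) => // i.
  apply: filterS2 (residual_interp_sign (r0 i 1) (r1 i 1))
    (residual_interp_sign (r0 i (-1)) (r1 i (-1))) => y h1 h2 Uy a _.
  have -> : residual F q dq U_ i y = 0.
    by apply/eqP; rewrite eq_le; have := h1 Uy; have := h2 Uy; rewrite mul1r mulN1r oppr_ge0 => -> ->.
  by rewrite mulr0 mul0r.
split; last by apply: improved_inequality_interp => eta teta _; exact: Hweak.
exists (grad g v); split; first exact: (W1p_profile log_profile_interp v_interpE).
move=> phi /test_C1 tphi; have [iw w1] := Hweak 1 phi tphi; have [_ w2] := Hweak (-1) phi tphi.
split => //.
by apply/eqP; rewrite eq_le; move: w1 w2; rewrite mul1e mulN1e oppe_ge0 => -> ->.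
Qed.

End interpolation.

End solutions.

(** (f'/f)' = f''/f - (f'/f)^2, whose continuity is what class C^2 provides. *)
Lemma log_profile_C2 (R : realType) (M : ptopologicalType) (Om : set M) (v : M -> R) (f : R -> R) :
  C2_real (v @` Om) f -> (forall x, Om x -> 0 < f (v x)) ->
  log_profile Om v f (fun s => derive1 f s / f s)
    (fun s => derive1 (derive1 f) s / f s - (derive1 f s / f s) * (derive1 f s / f s)).
Proof.
move=> fC2 f0 x Ox; have fx0 := f0 x Ox; have fxn : f (v x) != 0 by rewrite gt_eqF.
have [|df ddf cddf] := fC2 (v x); first by exists x.
have isd (h : R -> R) : derivable h (v x) 1 -> is_derive (v x) 1 h (derive1 h (v x)).
  by move=> dh; rewrite derive1E; apply: derivableP.
have cd (h : R -> R) (dh : derivable h (v x) 1) := is_derive_continuous (isd h dh).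
have dV := is_deriveV (f := f) fxn (isd _ df).
have cV : {for v x, continuous (fun s => (f s)^-1)} by apply: continuousV => //; exact: cd.
have cq := continuousM (cd _ ddf) cV.
split; first exact: fx0.
- rewrite (_ : f (v x) * _ = derive1 f (v x)); first exact: isd.
  by rewrite mulrC divfK.
- apply: is_derive_eq (is_deriveM (isd _ ddf) dV) _.
  by rewrite /GRing.scale/=; field.
- exact: continuousB (continuousM cddf cV) (continuousM cq cq).
Qed.

Unset Implicit Arguments.

Theorem theorem8p1 (R : realType) (n : nat) (hn : (2 <= n)%N)
  (M : ptopologicalType) (X : smooth_manifold R n M)
  (hM : ~ compact [set: M]) (g : riemannian_metric X)
  (lam : {measure set (borel 'rV[R]_n) -> \bar R}) (hlam : is_lebesgue lam)
  (vol : {measure set (borel M) -> \bar R}) (hvol : is_riemannian_volume g lam vol)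
  (Om : set M) (hOm : domain Om)
  (nu : {measure set (borel M) -> \bar R})
  (hnu : smooth_positive_density X vol nu Om)
  (p : R) (hp : 1 < p)
  (V0 V1 : M -> R) (hV0 : Linfty_loc nu Om V0) (hV1 : Linfty_loc nu Om V1)
  (v0 v1 : M -> R)
  (hv0pos : positive_on Om v0) (hv1pos : positive_on Om v1)
  (hindep : linearly_independent_on Om v0 v1)
  (hv0C2 : Ck_on X 2 Om v0) (hv1C2 : Ck_on X 2 Om v1)
  (hgrad : forall x, Om x -> vnorm g (grad g v0) x != 0)
  (phi1 : R -> R) (hphi1C2 : C2_real (v0 @` Om) phi1)
  (hphi1 : forall t, (v0 @` Om) t -> derive1 phi1 t != 0)
  (hv1 : forall x, Om x -> v1 x = phi1 (v0 x))
  (alpha : R) (halpha : 0 <= alpha <= 1)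
  (hW : p < 2 -> locally_integrable_on nu Om (W_interp g p alpha v0 v1)) :
  let v := v_interp alpha v0 v1 in
  let V := V_interp g p alpha V0 V1 v0 v1 in
  let W := W_interp g p alpha v0 v1 in
  let improved_inequality :=
    forall phi, test_function X Om phi ->
      (\int[nu]_(x in (Om : set (borel M)))
          (vnorm g (grad g phi) x `^ p + V x * `|phi x| `^ p)%:E >=
       \int[nu]_(x in (Om : set (borel M))) (W x * `|phi x| `^ p)%:E)%E in
  (solution g lam nu p Om V0 v0 -> solution g lam nu p Om V1 v1 ->
     [/\ positive_on Om v, solution g lam nu p Om (fun x => V x - W x) v
       & improved_inequality]) /\
  (supersolution g lam nu p Om V0 v0 -> supersolution g lam nu p Om V1 v1 ->
     [/\ positive_on Om v, supersolution g lam nu p Om (fun x => V x - W x) v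
       & improved_inequality]).
Proof.
move=> v V W ineq; have [rho [srho rho0 nuE]] := hnu; have [oOm _ _] := hOm.
have phi1_gt0 x : Om x -> 0 < phi1 (v0 x) by move=> Ox; rewrite -hv1//; exact: hv1pos.
have hF1 := log_profile_C2 hphi1C2 phi1_gt0.
(* The condition phi1' != 0 enters here: it keeps the weight |q_1|^(p-2) continuous and
   invertible. *)
have q1_neq0 x : Om x -> derive1 phi1 (v0 x) / phi1 (v0 x) != 0.
  move=> Ox; rewrite mulf_neq0 ?invr_eq0 ?(gt_eqF (phi1_gt0 x Ox))//.
  by apply: hphi1; exists x.
have vpos : positive_on Om v.
  by move=> x Ox; rewrite /v /v_interp mulr_gt0 ?powR_gt0 ?hv1pos ?hv0pos.
split=> s0 s1.
- have [sv I] := solution_interp oOm hlam hvol srho rho0 nuE hp hv0C2 hgrad hV0 hV1 hv0pos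
    hF1 hv1 q1_neq0 halpha hW s0 s1.
  by split.
- have [sv I] := supersolution_interp oOm hlam hvol srho rho0 nuE hp hv0C2 hgrad hV0 hV1 hv0pos
    hF1 hv1 q1_neq0 halpha hW s0 s1.
  by split.
Qed.
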